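(* Let $F\in H^{-2}(\Omega)$, $F\ne0$, be independent of time and let $0<\alpha<\nu\bar\lambda_1/2$. Then there exists a bounded absorbing ball for the semi-discrete problem, namely $$B_\rho(0)=\{v_h\in S_h^0:\|\nabla v_h\|\leq\rho\},\qquad\text{where }\rho\text{ is given by }\ \rho^2=\frac{\mu^2}{\alpha\nu}\|F\|_{-2}^2 .$$
   Context: $\Omega\subset\mathbb{R}^2$ is a bounded domain, $\nu>0$, $\mu>0$ are constants. $(\cdot,\cdot)$ and $\|\cdot\|$ are the $L^2(\Omega)$ inner product (also duality pairing) and norm. $H^{-2}(\Omega)$ is the dual of $H^2_0(\Omega)$ with norm $\|\cdot\|_{-2}$ dual to $\|\Delta\cdot\|$. $\bar\lambda_1>0$ is the minimum eigenvalue of $-\Delta\phi=\bar\lambda\phi$ in $\Omega$ with homogeneous Dirichlet boundary condition. $\mathcal{T}_h$ is a shape regular partition of $\overline\Omega$ of mesh size $h$; $S_h\subset C^1(\Omega)\cap\mathcal{P}$ is a $C^1$-conforming finite element space of piecewise polynomials ($\mathcal P$ a piecewise polynomial space) of degree up to $k\ge3$, and $S_h^0=\{v\in S_h: v=\partial_{\mathbf n}v=0\text{ on }\partial\Omega\}\subset H^2_0(\Omega)$. Set $a(v,w)=(\Delta v,\Delta w)$, $b_0(v,w)=-\frac12[(v_x,w)-(v,w_x)]$, $b(\psi;v,w)=(\Delta\psi,\,v_yw_x-v_xw_y)$. The semi-discrete problem is: find $\psi_h(t)\in S_h^0$, $t>0$, with $\psi_h(0)=\psi_{0,h}\in S_h^0$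 such that $$(\partial_t\nabla\psi_h,\nabla\chi)+\nu a(\psi_h,\chi)+b(\psi_h;\psi_h,\chi)+\mu b_0(\psi_h,\chi)=\mu(F,\chi)\quad\forall\chi\in S_h^0 .$$ Absorbing means: for every $R>0$ there is $t^\star(R)>0$ such that if $\|\nabla\psi_{0,h}\|\le R$ then $\psi_h(t)\in B_\rho(0)$ for all $t\ge t^\star(R)$. *)

(* Defs.v *)
From HB Require Import structures.
From mathcomp Require Import all_boot all_order all_algebra.
From mathcomp Require Import all_classical all_reals all_analysis.

Set Implicit Arguments.
Unset Strict Implicit.
Unset Printing Implicit Defensive.

Import Order.TTheory GRing.Theory Num.Theory.
Import numFieldNormedType.Exports.

Local Open Scope classical_set_scope.
Local Open Scope ring_scope.

(* The plane is [R * R]. The library norm there is the sup norm; it is used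
   only through the topology. Lengths and angles use [dot2] and [enorm]. *)

Section Plane.
Context {R : realType}.
Implicit Types (x y n : R * R) (f : R * R -> R) (Omega : set (R * R)).

Definition dot2 x y : R := x.1 * y.1 + x.2 * y.2.
Definition enorm x : R := Num.sqrt (dot2 x x).

Definition leb2 := ((@lebesgue_measure R) \x (@lebesgue_measure R))%E.

Definition dx f : R * R -> R := 'D_((1, 0) : R * R) f.
Definition dy f : R * R -> R := 'D_((0, 1) : R * R) f.

Definition pderiv (a b : nat) f : R * R -> R := iter a dx (iter b dy f).

Definition bounded_domain Omega :=
  [/\ open Omega, connected Omega, Omega !=set0 & bounded_set Omega].

Definition bdry Omega : set (R * R) := closure Omega `\` Omega.

(* [n] is the unit outward normal of the open set [Omega] at the boundary
   point [x] when, near [x] and up to cones of arbitrarily small opening around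
   the line orthogonal to [n], [Omega] is the half-plane [dot2 (y - x) n < 0].
   For a Lipschitz boundary this holds exactly where the local graph is
   differentiable, e.g. everywhere except at the corners of a polygon. *)
Definition outward_normal Omega x n :=
  [/\ bdry Omega x, enorm n = 1 &
    forall eps : R, 0 < eps -> \forall y \near x,
      (dot2 (y - x) n < - (eps * enorm (y - x)) -> Omega y) /\
      (eps * enorm (y - x) < dot2 (y - x) n -> ~ Omega y)].

End Plane.

Section Sobolev.
Context {R : realType}.
Variable Omega : set (R * R).
Implicit Types (f g u v w phi : R * R -> R).

Definition L2 f := measurable_fun Omega f /\
  leb2.-integrable Omega (fun z => (f z ^+ 2)%:E).

Definition ip f g : R := \int[leb2]_(z in Omega) (f z * g z).
Definition norm2 f : R := Num.sqrt (ip f f).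

(* C^oo functions with compact support in Omega. *)
Definition test_function phi :=
  (forall a b z, differentiable (pderiv a b phi) z) /\
  exists K, [/\ compact K, K `<=` Omega & forall z, ~ K z -> phi z = 0].

Definition weak_deriv (a b : nat) u g := L2 g /\
  forall phi, test_function phi ->
    ip u (pderiv a b phi) = (-1) ^+ (a + b) * ip g phi.

(* A representative of the weak derivative, which is unique almost everywhere;
   junk value 0 when there is none in L^2. *)
Definition wD (a b : nat) u : R * R -> R :=
  xget (cst 0) [set g | weak_deriv a b u g].

Definition Hspace (m : nat) u := L2 u /\
  forall a b, (a + b <= m)%N -> exists g, weak_deriv a b u g.

(* H^m_0, the closure of the test functions in H^m. Functions are identified
   almost everywhere on [Omega]: values off [Omega] are irrelevant. *)
Definition H0space (m : nat) u := Hspace m u /\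
  forall eps : R, 0 < eps -> exists2 phi, test_function phi &
    forall a b, (a + b <= m)%N ->
      norm2 (fun z => wD a b u z - pderiv a b phi z) < eps.

Definition wlap u : R * R -> R := fun z => wD 2 0 u z + wD 0 2 u z.

(* Weak form in H^1_0 of -Delta phi = lam phi, phi = 0 on the boundary. *)
Definition dirichlet_eigenvalue (lam : R) := exists phi,
  [/\ H0space 1 phi, 0 < norm2 phi &
    forall w, H0space 1 w ->
      ip (wD 1 0 phi) (wD 1 0 w) + ip (wD 0 1 phi) (wD 0 1 w)
      = lam * ip phi w].

Definition min_dirichlet_eigenvalue (lam : R) :=
  dirichlet_eigenvalue lam /\
  forall lam', dirichlet_eigenvalue lam' -> lam <= lam'.

(* An element of H^-2 is a functional whose values matter on H^2_0 only.
   Boundedness makes it compatible with almost everywhere equality. *)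
Definition Hm2 (F : (R * R -> R) -> R) :=
  (forall (c : R) u v, H0space 2 u -> H0space 2 v ->
     F (fun z => c * u z + v z) = c * F u + F v) /\
  exists C : R, forall v, H0space 2 v -> `|F v| <= C * norm2 (wlap v).

Definition Hm2_norm (F : (R * R -> R) -> R) : R :=
  sup [set `|F v| / norm2 (wlap v) |
        v in [set v | H0space 2 v /\ 0 < norm2 (wlap v)]].

End Sobolev.

Section FiniteElements.
Context {R : realType}.
Variable Omega : set (R * R).

Definition diam (K : set (R * R)) : R :=
  sup [set r | exists x y, [/\ K x, K y & r = enorm (x - y)]].

(* Cells are closed, with connected nonempty interiors, as in Ciarlet; their
   boundary is only required to be negligible, so that triangles,
   quadrilaterals and curved cells are all covered. *)
Definition mesh_partition (N : nat) (T : 'I_N -> set (R * R)) :=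
  [/\ closure Omega = \bigcup_i T i,
      forall i, [/\ (T i)° !=set0, connected (T i)°, closure (T i)° = T i &
                    leb2.-negligible (T i `\` (T i)°)] &
      forall i j, i != j -> (T i)° `&` (T j)° = set0].

Definition mesh_size (N : nat) (T : 'I_N -> set (R * R)) : R :=
  \big[Num.max/0]_(i < N) diam (T i).

Definition shape_regular (N : nat) (T : 'I_N -> set (R * R)) (sigma : R) :=
  forall i, exists x (r : R), [/\ 0 < r, diam (T i) <= sigma * r &
    forall y, enorm (y - x) <= r -> T i y].

Definition is_C1 (v : R * R -> R) := forall z, Omega z ->
  [/\ differentiable v z, {for z, continuous (dx v)} &
      {for z, continuous (dy v)}].

Definition piecewise_poly (N : nat) (T : 'I_N -> set (R * R)) (k : nat)
    (v : R * R -> R) :=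
  forall i, exists c : nat -> nat -> R, forall z, Omega z -> T i z ->
    v z = \sum_(a < k.+1) \sum_(b < k.+1 | (a + b <= k)%N)
            c a b * z.1 ^+ a * z.2 ^+ b.

Definition C1_fe_space (N : nat) (T : 'I_N -> set (R * R)) (k : nat)
    (Sh : set (R * R -> R)) :=
  [/\ Sh (cst 0),
      forall (c : R) v w, Sh v -> Sh w -> Sh (fun z => c * v z + w z) &
      forall v, Sh v -> is_C1 v /\ piecewise_poly T k v].

(* Boundary values of [v] and of its normal derivative are limits from inside
   [Omega]. *)
Definition fe_space0 (Sh : set (R * R -> R)) : set (R * R -> R) :=
  [set v | [/\ Sh v,
     forall x, bdry Omega x -> v @ within Omega (nbhs x) --> (0 : R) &
     forall x n, outward_normal Omega x n ->
       'D_n v @ within Omega (nbhs x) --> (0 : R)]].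

(* In these forms, first derivatives of C^1 functions are the classical ones
   and the Laplacian is the weak one. *)
Definition form_a (v w : R * R -> R) : R := ip Omega (wlap Omega v) (wlap Omega w).

Definition form_b0 (v w : R * R -> R) : R :=
  - (2^-1 * (ip Omega (dx v) w - ip Omega v (dx w))).

Definition form_b (psi v w : R * R -> R) : R :=
  ip Omega (wlap Omega psi) (fun z => dy v z * dx w z - dx v z * dy w z).

Definition grad_norm (v : R * R -> R) : R :=
  Num.sqrt (ip Omega (dx v) (dx v) + ip Omega (dy v) (dy v)).

(* Curves in a finite-dimensional space of functions on [Omega], in coordinates:
   continuous on [0, +oo[ and differentiable on ]0, +oo[. *)
Definition differentiable_curve (V : set (R * R -> R))
    (psi : R -> R * R -> R) :=
  exists n (e : 'I_n -> R * R -> R) (c : 'I_n -> R -> R),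
  [/\ forall i, V (e i),
      forall i, {within `[0, +oo[, continuous (c i)},
      forall i t, 0 < t -> derivable (c i) t 1 &
      forall t z, 0 <= t -> Omega z -> psi t z = \sum_(i < n) c i t * e i z].

Definition semidiscrete_solution (nu mu : R) (Sh : set (R * R -> R))
    (F : (R * R -> R) -> R) (psi0 : R * R -> R) (psi : R -> R * R -> R) :=
  [/\ forall z, Omega z -> psi 0 z = psi0 z,
      forall t, 0 <= t -> fe_space0 Sh (psi t),
      differentiable_curve (fe_space0 Sh) psi &
      forall t chi, 0 < t -> fe_space0 Sh chi ->
        ip Omega (fun z => derive1 (fun s => dx (psi s) z) t) (dx chi)
        + ip Omega (fun z => derive1 (fun s => dy (psi s) z) t) (dy chi)
        + nu * form_a (psi t) chi + form_b (psi t) (psi t) chi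
        + mu * form_b0 (psi t) chi
        = mu * F chi].

Definition fe_ball (Sh : set (R * R -> R)) (rho : R) : set (R * R -> R) :=
  [set v | fe_space0 Sh v /\ grad_norm v <= rho].

Definition absorbing (nu mu : R) (Sh : set (R * R -> R))
    (F : (R * R -> R) -> R) (B : set (R * R -> R)) :=
  forall r : R, 0 < r -> exists2 tstar : R, 0 < tstar &
    forall psi0 psi, fe_space0 Sh psi0 -> grad_norm psi0 <= r ->
      semidiscrete_solution nu mu Sh F psi0 psi ->
      forall t, tstar <= t -> B (psi t).

End FiniteElements.

(* Main.v *)
(* Testing the scheme with psi_h itself annihilates both convection forms, so
   y = ||grad psi_h||^2 satisfies y' + 2 nu ||Delta psi_h||^2 = 2 mu (F, psi_h), and
   Young's inequality gives y' + nu ||Delta psi_h||^2 <= (mu^2 / nu) ||F||_{-2}^2.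
   Since lambda1 ||grad v||^2 <= ||Delta v||^2 on H^2_0, Gronwall's lemma yields
   y(t) <= K + exp(- nu lambda1 t) y(0) with K = mu^2 ||F||^2 / (nu^2 lambda1) < rho^2.

   The hypothesis on lambda1 only says that it is the least eigenvalue, so the
   Poincare inequality needs an eigenvalue at the infimum of the Rayleigh quotient.
   On a grid of squares of side l, the Poincare inequality with averages bounds
   ||phi||^2 by finitely many squared averages plus l^2 ||grad phi||^2. Along a
   minimizing sequence the averages cluster, and by the parallelogram identity
   the sequence then has a subsequence that is Cauchy in H^1. Its limit is an
   eigenfunction. Weak derivatives are identified through the fundamental lemma
   of the calculus of variations, with test functions built from exp(-1/x). *)
From HB Require Import structures.
Require Import Defs.
From mathcomp Require Import all_boot all_order all_algebra.
From mathcomp Require Import all_classical all_reals all_analysis.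
From mathcomp Require Import measurable_realfun ring lra.
Import Order.TTheory GRing.Theory Num.Theory.
Import numFieldNormedType.Exports.
Local Open Scope classical_set_scope.
Local Open Scope ring_scope.

Set Implicit Arguments.
Unset Strict Implicit.
Unset Printing Implicit Defensive.

(** * Square-integrable functions *)

(** Functions are not identified almost everywhere, and [wD] is an arbitrarily chosen
    representative, so equality almost everywhere is carried as [norm2] of a difference being 0.
    Discrete functions are differentiated classically, while H^2_0 speaks of [wD], and a classical
    gradient is not known beforehand to be square integrable. The fundamental lemma is therefore
    proved under local integrability only. Compactness is used as an inequality for test functions.
    These extend by zero, so a grid on a surrounding square serves for every bounded open set. What
    counts is that the factor of the energy can be made small: the L^2 norm of a difference of
    near-minimizers can then be absorbed. The step from the eigenvalue to the Laplacian is
    Cauchy-Schwarz: ||grad v||^4 = (Delta v, v)^2 <= ||Delta v||^2 ||v||^2 <= ||Delta v||^2 ||grad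
    v||^2 / lambda1. The condition 0 < alpha < nu lambda1 / 2 also makes lambda1 positive. The gap
    rho^2 - K is the room left for the decaying exponential, and it fixes an entry time that depends
    on the initial datum only through its bound. *)

Local Notation plane R := (measurableTypeR R * measurableTypeR R)%type.

Section L2algebra.
Context {R : realType}.
Variable Omega : set (R * R).
Hypothesis mO : measurable (Omega : set (plane R)).
Implicit Types f g h : R * R -> R.
Local Notation ip := (ip Omega).
Local Notation norm2 := (norm2 Omega).
Local Notation L2 := (L2 Omega).

Lemma L2E f : L2 f <->
  measurable_fun (Omega : set (plane R)) (f : plane R -> R) /\
  leb2.-integrable Omega (EFin \o (fun z => f z ^+ 2)).
Proof. by []. Qed.

(** The majorant is [f ^+ 2 + g ^+ 2]: the square of |f| - |g| is nonnegative, so 2 |f| |g| <= f^2 +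
    g^2. *)
Lemma L2_mul f g : L2 f -> L2 g ->
  leb2.-integrable Omega (EFin \o (fun z => f z * g z)).
Proof.
move=> /L2E[mf If] /L2E[mg Ig].
have := integrableD mO If Ig; apply: le_integrable => //.
  by apply/measurable_EFinP; exact: measurable_funM.
move=> z _ /=; rewrite lee_fin [leRHS]ger0_norm ?addr_ge0 ?sqr_ge0//.
rewrite normrM.
have := sqr_ge0 (`|f z| - `|g z|); rewrite sqrrB !real_normK ?num_real//.
have : 0 <= `|f z| * `|g z| by rewrite mulr_ge0.
rewrite -mulr_natl; lra.
Qed.

Lemma L2_lin (c : R) f g : L2 f -> L2 g -> L2 (fun z => c * f z + g z).
Proof.
move=> Lf Lg; have If := L2_mul Lf Lf; have Ig := L2_mul Lg Lg.
have Ifg := L2_mul Lf Lg; split.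
  by apply: measurable_funD; [apply: measurable_funM|]; [|case: Lf|case: Lg].
have := integrableD mO (integrableD mO (integrableZl mO (c ^+ 2) If)
  (integrableZl mO (c *+ 2) Ifg)) Ig.
apply: eq_integrable => // z _ /=.
by rewrite -!EFinM -!EFinD; congr EFin; rewrite -mulr_natl; ring.
Qed.

Lemma ipC f g : ip f g = ip g f.
Proof. by apply: eq_Rintegral => z _; rewrite mulrC. Qed.

Lemma eq_ip f f' g g' : {in Omega, f =1 f'} -> {in Omega, g =1 g'} ->
  ip f g = ip f' g'.
Proof. by move=> ff gg; apply: eq_Rintegral => z zO; rewrite ff// gg. Qed.

Lemma ip_linl (c : R) f g h : L2 f -> L2 g -> L2 h ->
  ip (fun z => c * f z + g z) h = c * ip f h + ip g h.
Proof.
move=> Lf Lg Lh; rewrite /Defs.ip.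
rewrite -RintegralZl//; last exact: L2_mul.
rewrite -RintegralD//; last 2 first.
- exact: (integrableZl mO c (L2_mul Lf Lh)).
- exact: L2_mul.
by apply: eq_Rintegral => z _; ring.
Qed.

Lemma ip_ge0 f : 0 <= ip f f.
Proof. by apply: Rintegral_ge0 => z _; rewrite -expr2 sqr_ge0. Qed.

Lemma norm2_ge0 f : 0 <= norm2 f. Proof. exact: sqrtr_ge0. Qed.

Lemma norm2_sq f : norm2 f ^+ 2 = ip f f.
Proof. by rewrite sqr_sqrtr// ip_ge0. Qed.

Lemma L20 : L2 (cst 0).
Proof.
split; first exact: measurable_cst.
apply: (eq_integrable mO (cst 0%E)); last exact: integrable0.
by move=> z _ /=; rewrite expr0n.
Qed.

Lemma eq_L2 f g : {in Omega, f =1 g} -> L2 f -> L2 g.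
Proof.
move=> fg [mf If]; split.
  by apply: eq_measurable_fun mf => z zO; rewrite fg.
by apply: eq_integrable If => // z zO; rewrite fg.
Qed.

Lemma L2Z (c : R) f : L2 f -> L2 (fun z => c * f z).
Proof.
move=> Lf; apply: eq_L2 (L2_lin c Lf L20) => z _ /=; by rewrite addr0.
Qed.

Lemma L2D f g : L2 f -> L2 g -> L2 (fun z => f z + g z).
Proof.
move=> Lf Lg; apply: eq_L2 (L2_lin 1 Lf Lg) => z _ /=; by rewrite mul1r.
Qed.

Lemma L2B f g : L2 f -> L2 g -> L2 (fun z => f z - g z).
Proof.
move=> Lf Lg; apply: eq_L2 (L2_lin (-1) Lg Lf) => z _ /=; by rewrite mulN1r addrC.
Qed.

Lemma ip0l g : ip (cst 0) g = 0.
Proof.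
rewrite /Defs.ip (eq_Rintegral _ (g := cst 0)) ?Rintegral0//.
by rewrite /Rintegral integral0.
by move=> z _; rewrite mul0r.
Qed.

Lemma ipZl (c : R) f g : L2 f -> L2 g -> ip (fun z => c * f z) g = c * ip f g.
Proof.
move=> Lf Lg; have := ip_linl c Lf L20 Lg; rewrite ip0l addr0 => <-.
by apply: eq_ip => z _ //=; rewrite addr0.
Qed.

Lemma ipDl f g h : L2 f -> L2 g -> L2 h ->
  ip (fun z => f z + g z) h = ip f h + ip g h.
Proof.
move=> Lf Lg Lh; have := ip_linl 1 Lf Lg Lh; rewrite mul1r => <-.
by apply: eq_ip => z _ //=; rewrite mul1r.
Qed.

Lemma ipBl f g h : L2 f -> L2 g -> L2 h ->
  ip (fun z => f z - g z) h = ip f h - ip g h.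
Proof.
move=> Lf Lg Lh; have := ip_linl (-1) Lg Lf Lh; rewrite mulN1r addrC => <-.
by apply: eq_ip => z _ //=; rewrite mulN1r addrC.
Qed.

Lemma ipDr f g h : L2 f -> L2 g -> L2 h ->
  ip h (fun z => f z + g z) = ip h f + ip h g.
Proof. by move=> *; rewrite ipC ipDl// ![ip h _]ipC. Qed.

Lemma ipBr f g h : L2 f -> L2 g -> L2 h ->
  ip h (fun z => f z - g z) = ip h f - ip h g.
Proof. by move=> *; rewrite ipC ipBl// ![ip h _]ipC. Qed.

Lemma ipZr (c : R) f g : L2 f -> L2 g -> ip g (fun z => c * f z) = c * ip g f.
Proof. by move=> *; rewrite ipC ipZl// ipC. Qed.

Lemma ip_sqr_lin (c : R) f g : L2 f -> L2 g ->
  ip (fun z => c * f z + g z) (fun z => c * f z + g z) =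
  c ^+ 2 * ip f f + 2 * c * ip f g + ip g g.
Proof.
move=> Lf Lg; have Lcf := L2Z c Lf.
rewrite ip_linl//; last exact: L2_lin.
rewrite !ipDr// !ipZr// [ip g f]ipC; ring.
Qed.

(** Discriminant argument: [t ^+ 2 * a + 2 * t * b + c] is the squared norm of t f + g, hence
    nonnegative for every [t], and its value at the vertex [- b / a] is (a c - b^2) / a. *)
Lemma ip_CS f g : L2 f -> L2 g -> (ip f g) ^+ 2 <= ip f f * ip g g.
Proof.
move=> Lf Lg; set a := ip f f; set b := ip f g; set c := ip g g.
have H t : 0 <= t ^+ 2 * a + 2 * t * b + c by rewrite -ip_sqr_lin// ip_ge0.
have a0 : 0 <= a := ip_ge0 f.
have [a_eq0|a_neq0] := eqVneq a 0.
  have [->|b0] := eqVneq b 0; first by rewrite a_eq0 mul0r expr0n.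
  (* With [a = 0] the expression is affine in [t], and this [t] would give it the value -1. *)
  have := H (- (c + 1) / (2 * b)); rewrite a_eq0.
  have -> : (- (c + 1) / (2 * b)) ^+ 2 * 0 + 2 * (- (c + 1) / (2 * b)) * b + c
            = -1 by field.
  lra.
have a_gt0 : 0 < a by rewrite lt_neqAle eq_sym a_neq0.
have := H (- b / a).
have -> : (- b / a) ^+ 2 * a + 2 * (- b / a) * b + c = (a * c - b ^+ 2) / a.
  by field.
by rewrite pmulr_lge0 ?invr_gt0// subr_ge0.
Qed.

Lemma ip_le_norm2 f g : L2 f -> L2 g -> `|ip f g| <= norm2 f * norm2 g.
Proof.
move=> Lf Lg; rewrite -(ler_pXn2r (n := 2)) ?nnegrE ?mulr_ge0 ?norm2_ge0//.
by rewrite real_normK ?num_real// exprMn !norm2_sq ip_CS.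
Qed.

Lemma norm2D f g : L2 f -> L2 g -> norm2 (fun z => f z + g z) <= norm2 f + norm2 g.
Proof.
move=> Lf Lg; rewrite -(ler_pXn2r (n := 2)) ?nnegrE ?addr_ge0 ?norm2_ge0//.
rewrite norm2_sq sqrrD !norm2_sq ipDl//; last exact: L2D.
rewrite !ipDr// [ip g f]ipC -mulr_natl.
have := ler_norm (ip f g); have := ip_le_norm2 Lf Lg; lra.
Qed.

Lemma eq_norm2 f g : {in Omega, f =1 g} -> norm2 f = norm2 g.
Proof. by move=> fg; rewrite /Defs.norm2; congr Num.sqrt; exact: eq_ip. Qed.

Lemma norm2_distC f g : norm2 (fun z => f z - g z) = norm2 (fun z => g z - f z).
Proof.
congr Num.sqrt; rewrite /Defs.ip; apply: eq_Rintegral => z _; ring.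
Qed.

Lemma norm2_triB f g h : L2 f -> L2 g -> L2 h ->
  norm2 (fun z => f z - h z) <=
  norm2 (fun z => f z - g z) + norm2 (fun z => g z - h z).
Proof.
move=> Lf Lg Lh.
rewrite (@eq_norm2 _ (fun z => (f z - g z) + (g z - h z))).
  by apply: norm2D; exact: L2B.
by move=> z _; ring.
Qed.

Lemma norm2_dist f g : L2 f -> L2 g ->
  `|norm2 f - norm2 g| <= norm2 (fun z => f z - g z).
Proof.
move=> Lf Lg; have := norm2D (L2B Lf Lg) Lg.
rewrite (@eq_norm2 (fun z => f z - g z + g z) f); last by move=> z _; ring.
have := norm2D (L2B Lg Lf) Lf.
rewrite (@eq_norm2 (fun z => g z - f z + f z) g); last by move=> z _; ring.
rewrite (norm2_distC g f) ler_norml; lra.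
Qed.

(** Together with [ip_sub0], this allows one representative of a weak derivative to be exchanged for
    another. *)
Lemma norm2_sub0 f g : L2 f -> L2 g -> norm2 (fun z => f z - g z) = 0 ->
  norm2 f = norm2 g.
Proof.
move=> Lf Lg e; have := norm2_dist Lf Lg; rewrite e normr_le0 subr_eq0.
by move/eqP.
Qed.

Lemma ip_sub0 f g h : L2 f -> L2 g -> L2 h -> norm2 (fun z => f z - g z) = 0 ->
  ip f h = ip g h.
Proof.
move=> Lf Lg Lh e; apply/eqP; rewrite -subr_eq0 -ipBl// -normr_le0.
by apply: le_trans (ip_le_norm2 (L2B Lf Lg) Lh) _; rewrite e mul0r.
Qed.

Lemma ip_cvg (fn gn : nat -> R * R -> R) f g :
  (forall n, L2 (fn n)) -> (forall n, L2 (gn n)) -> L2 f -> L2 g ->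
  (fun n => norm2 (fun z => fn n z - f z)) @ \oo --> (0 : R) ->
  (fun n => norm2 (fun z => gn n z - g z)) @ \oo --> (0 : R) ->
  (fun n => ip (fn n) (gn n)) @ \oo --> ip f g.
Proof.
move=> Lfn Lgn Lf Lg cf cg.
have B n : `|ip (fn n) (gn n) - ip f g| <=
   norm2 (fun z => fn n z - f z) * norm2 (fun z => gn n z - g z) +
   norm2 (fun z => fn n z - f z) * norm2 g +
   norm2 f * norm2 (fun z => gn n z - g z).
  (* A product of two errors plus two terms linear in one error: only the norms of the fixed limits
     remain as factors, so no uniform bound on the sequences is required. *)
  have -> : ip (fn n) (gn n) - ip f g =
    ip (fun z => fn n z - f z) (fun z => gn n z - g z) +
    ip (fun z => fn n z - f z) g + ip f (fun z => gn n z - g z).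
    have := L2B (Lfn n) Lf; have := L2B (Lgn n) Lg => ? ?.
    by rewrite !(ipBl (Lfn n) Lf)// !ipBr//; ring.
  apply: le_trans (ler_normD _ _) _; apply: lerD; last first.
    by apply: ip_le_norm2 => //; exact: L2B.
  apply: le_trans (ler_normD _ _) _; apply: lerD;
    by apply: ip_le_norm2 => //; exact: L2B.
apply/cvgrPdist_le => e e0.
have Z : (fun n => norm2 (fun z => fn n z - f z) * norm2 (fun z => gn n z - g z) +
   norm2 (fun z => fn n z - f z) * norm2 g +
   norm2 f * norm2 (fun z => gn n z - g z)) @ \oo --> (0 : R).
  rewrite -[X in _ --> X](_ : 0 * 0 + 0 * norm2 g + norm2 f * 0 = 0); last by ring.
  apply: cvgD; last by apply: cvgMr.
  by apply: cvgD; [exact: cvgM|exact: cvgMl].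
move/cvgrPdist_le : Z => /(_ _ e0); apply: filterS => n.
rewrite sub0r normrN distrC; apply: le_trans.
exact: le_trans (B n) (ler_norm _).
Qed.

Lemma norm2_cvg (fn : nat -> R * R -> R) f :
  (forall n, L2 (fn n)) -> L2 f ->
  (fun n => norm2 (fun z => fn n z - f z)) @ \oo --> (0 : R) ->
  (fun n => norm2 (fn n)) @ \oo --> norm2 f.
Proof.
move=> Lfn Lf c; apply/cvgrPdist_le => e e0.
move/cvgrPdist_le : c => /(_ _ e0); apply: filterS => n.
rewrite sub0r normrN distrC; apply: le_trans.
exact: le_trans (norm2_dist (Lfn n) Lf) (ler_norm _).
Qed.

End L2algebra.

(** * Plane measure *)

Section PlaneMeasure.
Context {R : realType}.
Implicit Types (Omega : set (R * R)) (f : R * R -> R) (a b c d : R).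

Definition obox a b c d : set (R * R) := `]a, b[%classic `*` `]c, d[%classic.
Definition cbox a b c d : set (R * R) := `[a, b]%classic `*` `[c, d]%classic.

Lemma obox_measurable a b c d : measurable (obox a b c d : set (plane R)).
Proof. by apply: measurableX. Qed.

Lemma cbox_measurable a b c d : measurable (cbox a b c d : set (plane R)).
Proof. by apply: measurableX. Qed.

Lemma cbox_compact a b c d : compact (cbox a b c d).
Proof. by apply: compact_setX; exact: segment_compact. Qed.

Lemma obox_sub a b c d : obox a b c d `<=` cbox a b c d.
Proof.
move=> [x y] [] /=; rewrite !in_itv /= => /andP[? ?] /andP[? ?].
by split; rewrite /= in_itv /=; apply/andP; split; exact: ltW.
Qed.

Lemma rat_box_nbhs (z : R * R) (e : R) : 0 < e -> exists q : rat * rat * (rat * rat),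
  obox (ratr q.1.1) (ratr q.1.2) (ratr q.2.1) (ratr q.2.2) z /\
  cbox (ratr q.1.1) (ratr q.1.2) (ratr q.2.1) (ratr q.2.2) `<=` ball z e.
Proof.
move=> e0; case: z => x y.
have lt x1 : x1 - e < x1 by rewrite ltrBlDr ltrDl.
have gt x1 : x1 < x1 + e by rewrite ltrDl.
have [q1] := rat_in_itvoo (lt x); have [q2] := rat_in_itvoo (gt x).
have [q3] := rat_in_itvoo (lt y); have [q4] := rat_in_itvoo (gt y).
rewrite !in_itv /= => /andP[h1 h2] /andP[h3 h4] /andP[h5 h6] /andP[h7 h8].
exists ((q1, q2), (q3, q4)); split => /=.
  by split; rewrite /= in_itv /=; apply/andP; split.
move=> [u v] [] /=; rewrite !in_itv /= => /andP[? ?] /andP[? ?].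
by split; rewrite /ball /= ltr_distlC; apply/andP; split; lra.
Qed.

(** The second condition does not involve [z], so the set is either the open box or empty, and all
    rational quadruples can index the union. Asking for the closed box inside [Omega] leaves room
    for test functions supported in it. *)
Definition inner_rat_box Omega (q : rat * rat * (rat * rat)) : set (R * R) :=
  [set z | obox (ratr q.1.1) (ratr q.1.2) (ratr q.2.1) (ratr q.2.2) z /\
    cbox (ratr q.1.1) (ratr q.1.2) (ratr q.2.1) (ratr q.2.2) `<=` Omega].

Lemma open_bigcup_rat_box Omega : open Omega ->
  Omega = \bigcup_q inner_rat_box Omega q.
Proof.
move=> oO; rewrite eqEsubset; split=> [z Oz|z [q _ [bz sub]]]; last first.
  exact/sub/obox_sub.
have /nbhs_ballP[e /= e0 be] : nbhs z Omega by exact: open_nbhs_nbhs.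
have [q [bz sub]] := rat_box_nbhs z e0.
by exists q => //; split=> //; exact: subset_trans sub be.
Qed.

Lemma inner_rat_box_measurable Omega q :
  measurable (inner_rat_box Omega q : set (plane R)).
Proof.
rewrite /inner_rat_box; have [sub|nsub] := pselect
  (cbox (ratr q.1.1) (ratr q.1.2) (ratr q.2.1) (ratr q.2.2) `<=` Omega).
  rewrite (_ : [set _ | _] =
    obox (ratr q.1.1) (ratr q.1.2) (ratr q.2.1) (ratr q.2.2)).
    exact: obox_measurable.
  by apply/seteqP; split=> z => [[]|].
rewrite (_ : [set _ | _] = set0); first exact: measurable0.
by apply/seteqP; split=> z // [].
Qed.

(** Measurability refers to the product sigma-algebra and openness to the product topology; a
    countable cover by rational boxes links the two. *)
Lemma open_plane_measurable Omega : open Omega -> measurable (Omega : set (plane R)).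
Proof.
move=> oO; rewrite (open_bigcup_rat_box oO).
apply: countable_bigcupT_measurable => [|q]; first exact: countableP.
exact: inner_rat_box_measurable.
Qed.

Lemma measurable_fun_continuous_on Omega f : open Omega ->
  (forall z, Omega z -> {for z, continuous f}) ->
  measurable_fun (Omega : set (plane R)) (f : plane R -> R).
Proof.
move=> oO cf; apply: (measurability _ (RGenOInfty.measurableE R)) => // _ [_ [x ->] <-].
apply: open_plane_measurable; rewrite openE => z [Oz fz].
apply: filterI; first exact: open_nbhs_nbhs.
by apply: (cf z Oz); apply: open_nbhs_nbhs; split.
Qed.

Lemma bounded_sub_cbox Omega : bounded_set Omega ->
  exists M : R, 0 < M /\ Omega `<=` obox (- M) M (- M) M.
Proof.
move=> [M [_ HM]].
have h : `|M| + 1 > M by rewrite (le_lt_trans (ler_norm M))// ltrDl.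
exists (`|M| + 2); split; first by have := normr_ge0 M; lra.
move=> [x y] /(HM _ h); rewrite /= prod_normE ge_max => /andP[].
rewrite /= !ler_norml => /andP[? ?] /andP[? ?].
by split; rewrite /= in_itv /=; apply/andP; split; lra.
Qed.

Lemma leb2_box_lty a b c d : (leb2 (cbox a b c d : set (plane R)) < +oo)%E.
Proof.
rewrite /leb2 product_measure1E//= !lebesgue_measure_itv/=.
by rewrite lte_mul_pinfty//; case: ifP; rewrite ?ltry// lee_fin; rewrite ?lte_fin; lra.
Qed.

Lemma leb2_bounded Omega : bounded_set Omega -> measurable (Omega : set (plane R)) ->
  (leb2 (Omega : set (plane R)) < +oo)%E.
Proof.
move=> /bounded_sub_cbox[M [_ sub]] mO.
apply: le_lt_trans (leb2_box_lty (- M) M (- M) M).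
apply: le_measure; rewrite ?inE//; first exact: cbox_measurable.
exact: subset_trans sub (@obox_sub _ _ _ _).
Qed.

End PlaneMeasure.

(** * Slices, compact supports and vanishing integrals of derivatives *)

Section Calculus.
Context {R : realType}.
Implicit Types (Omega K : set (R * R)) (f g u phi : R * R -> R).
Local Notation leb := (@lebesgue_measure R).

Lemma integral_deriv (F f : R -> R) (a b : R) : a < b ->
  (forall x : R, is_derive x (1 : R) F (f x)) -> continuous f ->
  (\int[leb]_(x in `[a, b]) (f x)%:E)%E = (F b - F a)%:E.
Proof.
move=> ab dF cf; have cF x : {for x, continuous F}.
  apply: differentiable_continuous; apply/derivable1_diffP.
  by have := dF x => -[].
rewrite (continuous_FTC2 (F := F))// ?EFinB//.
- exact: continuous_subspaceT.
- split => [x _| |].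
  + by have := dF x => -[].
  + exact/cvg_at_right_filter/cF.
  + exact/cvg_at_left_filter/cF.
- by move=> x _; rewrite derive1E; exact: derive_val.
Qed.

(** Both difference quotients are the same function of [h]; partial derivatives thus become
    derivatives in one variable along lines. *)
Lemma is_derive_slice_x g x y : derivable g (x, y) (1, 0) ->
  is_derive (x : R) (1 : R) (fun s => g (s, y)) (dx g (x, y)).
Proof.
have E : (fun h : R => h^-1 *: ((g \o shift (x, y)) (h *: ((1, 0) : R * R)) - g (x, y))) =
         (fun h : R => h^-1 *: (((fun s => g (s, y)) \o shift x) (h *: (1 : R)) - g (x, y))).
  apply/funext => h /=; congr (_ *: (g (_, _) - _)).
  by rewrite (_ : _ + _ = h * 0 + y)// mulr0 add0r.
rewrite /derivable E => dg; split => //.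
by rewrite /dx /derive E.
Qed.

Lemma is_derive_slice_y g x y : derivable g (x, y) (0, 1) ->
  is_derive (y : R) (1 : R) (fun s => g (x, s)) (dy g (x, y)).
Proof.
have E : (fun h : R => h^-1 *: ((g \o shift (x, y)) (h *: ((0, 1) : R * R)) - g (x, y))) =
         (fun h : R => h^-1 *: (((fun s => g (x, s)) \o shift y) (h *: (1 : R)) - g (x, y))).
  apply/funext => h /=; congr (_ *: (g (_, _) - _)).
  by rewrite (_ : _ + _ = h * 0 + x)// mulr0 add0r.
rewrite /derivable E => dg; split => //.
by rewrite /dy /derive E.
Qed.

Lemma continuous_slice_x g y : continuous g -> continuous (fun s => g (s, y)).
Proof.
move=> cg x; apply: (@continuous_comp _ _ _ (fun s => (s, y)) g); last exact: cg.
exact: (@cvg_pair _ _ _ (nbhs x) (nbhs x) (nbhs y) _ _ _ id (cst y) cvg_id (cvg_cst y)).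
Qed.

Lemma continuous_slice_y g x : continuous g -> continuous (fun s => g (x, s)).
Proof.
move=> cg y; apply: (@continuous_comp _ _ _ (fun s => (x, s)) g); last exact: cg.
exact: (@cvg_pair _ _ _ (nbhs y) (nbhs x) (nbhs y) _ _ _ (cst x) id (cvg_cst x) cvg_id).
Qed.

Lemma plane_compact_closed K : compact K -> closed K.
Proof. by move=> cK; apply: compact_closed => //; exact: norm_hausdorff. Qed.

Lemma near_offK K z : compact K -> ~ K z -> \forall y \near z, ~ K y.
Proof.
move=> /plane_compact_closed/closed_openC oK nK.
by apply: open_nbhs_nbhs; split.
Qed.

Lemma derive_offK K g (v : R * R) : compact K -> (forall z, ~ K z -> g z = 0) ->
  forall z, ~ K z -> 'D_v g z = 0.
Proof.
move=> cK g0 z nK; rewrite (@near_eq_derive _ _ _ g (cst 0)); first exact: derive_cst.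
by near=> y; rewrite /= g0//; near: y; exact: near_offK.
Unshelve. all: by end_near. Qed.

Lemma offK_bounded K g : compact K -> (forall z, ~ K z -> g z = 0) ->
  continuous g -> exists M : R, forall z, `|g z| <= M.
Proof.
move=> cK g0 cg; have : compact (g @` K).
  by apply: continuous_compact => //; exact: continuous_subspaceT.
move=> /compact_bounded [M [_ HM]]; exists (`|M| + 1) => z.
have [Kz|nKz] := pselect (K z).
  apply: HM; last by exists z.
  by rewrite (le_lt_trans (ler_norm M))// ltrDl.
by rewrite g0// normr0 addr_ge0.
Qed.

Lemma continuous_plane_measurable g : continuous g ->
  measurable_fun setT (g : plane R -> R).
Proof. by move=> cg; exact: (@measurable_fun_continuous_on _ setT g openT (fun z _ => cg z)). Qed.

Lemma bounded_meas_integrable (D : set (plane R)) (g : plane R -> R) (M : R) :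
  measurable D -> (leb2 D < +oo)%E -> measurable_fun D g ->
  (forall z, D z -> `|g z| <= M) -> leb2.-integrable D (EFin \o g).
Proof.
move=> mD fD mg gM; apply: measurable_bounded_integrable => //.
exists M; split; first exact: num_real.
by move=> x Mx z /gM /le_trans; apply; exact: ltW.
Qed.

Lemma offK_integrable K g (D : set (plane R)) : measurable D ->
  compact K -> (forall z, ~ K z -> g z = 0) ->
  continuous g -> leb2.-integrable D (EFin \o (g : plane R -> R)).
Proof.
move=> mD cK g0 cg; apply: (integrableS measurableT) => //.
have [M gM] := offK_bounded cK g0 cg.
have [L [L0 KL]] := bounded_sub_cbox (compact_bounded cK).
have mB := cbox_measurable (- L) L (- L) L.
have mg := continuous_plane_measurable cg.
have : leb2.-integrable (cbox (- L) L (- L) L : set (plane R)) (EFin \o g).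
  apply: (@bounded_meas_integrable _ g M) => //; first exact: leb2_box_lty.
  exact: measurable_funTS.
move=> /(integrable_mkcond _ mB); apply: eq_integrable => // z _.
rewrite patchE; case: ifPn => //; rewrite notin_setE => nB.
by rewrite /= g0// => /KL/obox_sub.
Qed.

(** By Fubini the inner integral runs along horizontal lines, where the fundamental theorem of
    calculus evaluates it. *)
Lemma int_dx0 K g : compact K -> (forall z, ~ K z -> g z = 0) ->
  (forall z, derivable g z (1, 0)) -> continuous (dx g) ->
  \int[leb2]_z dx g z = 0.
Proof.
move=> cK g0 dg cdg; rewrite /Rintegral.
have dg0 z : ~ K z -> dx g z = 0.
  by move=> nK; exact: (derive_offK _ cK g0 nK).
have := offK_integrable measurableT cK dg0 cdg.
move=> /integral21_prod_meas1 <-.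
have [L [L0 KL]] := bounded_sub_cbox (compact_bounded cK).
rewrite (eq_integral (cst 0%E)) ?integral0// => y _.
change (\int[leb]_x (dx g (x, y))%:E = 0)%E.
rewrite (@eq_integral _ (measurableTypeR R) _ _ _
  ((fun x => (dx g (x, y))%:E) \_ `[- L, L])); last first.
  move=> x _; rewrite patchE; case: ifPn => //; rewrite notin_setE => nB.
  by rewrite dg0// => /KL/obox_sub[].
have dg_slice s : is_derive (s : R) (1 : R) (fun s => g (s, y)) (dx g (s, y)).
  exact: is_derive_slice_x.
have LL : - L < L by lra.
rewrite -integral_mkcond (integral_deriv LL dg_slice (@continuous_slice_x _ _ cdg)).
(* [K] lies in an open box, so both end points, with first coordinates [L] and [- L], are outside
   [K]. *)
rewrite !g0 ?subrr//.
  by move=> /KL[] /=; rewrite in_itv /= ltxx.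
by move=> /KL[] /=; rewrite in_itv /= ltxx andbF.
Qed.

Lemma int_dy0 K g : compact K -> (forall z, ~ K z -> g z = 0) ->
  (forall z, derivable g z (0, 1)) -> continuous (dy g) ->
  \int[leb2]_z dy g z = 0.
Proof.
move=> cK g0 dg cdg; rewrite /Rintegral.
have dg0 z : ~ K z -> dy g z = 0.
  by move=> nK; exact: (derive_offK _ cK g0 nK).
have := offK_integrable measurableT cK dg0 cdg.
move=> /integral12_prod_meas1 <-.
have [L [L0 KL]] := bounded_sub_cbox (compact_bounded cK).
rewrite (eq_integral (cst 0%E)) ?integral0// => x _.
change (\int[leb]_y (dy g (x, y))%:E = 0)%E.
rewrite (@eq_integral _ (measurableTypeR R) _ _ _
  ((fun y => (dy g (x, y))%:E) \_ `[- L, L])); last first.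
  move=> y _; rewrite patchE; case: ifPn => //; rewrite notin_setE => nB.
  by rewrite dg0// => /KL/obox_sub[].
have dg_slice s : is_derive (s : R) (1 : R) (fun s => g (x, s)) (dy g (x, s)).
  exact: is_derive_slice_y.
have LL : - L < L by lra.
rewrite -integral_mkcond (integral_deriv LL dg_slice (@continuous_slice_y _ _ cdg)).
rewrite !g0 ?subrr//.
  by move=> /KL[] _ /=; rewrite in_itv /= ltxx.
by move=> /KL[] _ /=; rewrite in_itv /= ltxx andbF.
Qed.

End Calculus.

(** * Test functions and integration by parts *)

Section TestFunctions.
Context {R : realType}.
Variable Omega : set (R * R).
Hypothesis oO : open Omega.
Implicit Types (K : set (R * R)) (f g u phi psi : R * R -> R).
Local Notation leb := (@lebesgue_measure R).
Local Notation ip := (ip Omega).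
Local Notation L2 := (L2 Omega).

Let mO : measurable (Omega : set (plane R)) := open_plane_measurable oO.

Lemma pderivSx a b phi : pderiv a.+1 b phi = dx (pderiv a b phi).
Proof. by []. Qed.

Lemma pderivSy b phi : pderiv 0 b.+1 phi = dy (pderiv 0 b phi).
Proof. by []. Qed.

(** One compact set serves for all orders: its complement is open, so a function that vanishes there
    has derivatives that vanish there. *)
Lemma test_support phi : test_function Omega phi -> exists K,
  [/\ compact K, K `<=` Omega & forall a b z, ~ K z -> pderiv a b phi z = 0].
Proof.
move=> [_ [K [cK KO phi0]]]; exists K; split => // a b.
have H b' z : ~ K z -> pderiv 0 b' phi z = 0.
  elim: b' z => [|n IH] z nK; first exact: phi0.
  exact: (derive_offK _ cK IH nK).
elim: a => [|n IH] z nK; first exact: H.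
exact: (derive_offK _ cK IH nK).
Qed.

Lemma test_diff phi a b z : test_function Omega phi -> differentiable (pderiv a b phi) z.
Proof. by case. Qed.

Lemma test_continuous phi a b : test_function Omega phi -> continuous (pderiv a b phi).
Proof. by move=> tp z; apply: differentiable_continuous; exact: test_diff. Qed.

Lemma pderiv_lin (c : R) phi psi a b : test_function Omega phi -> test_function Omega psi ->
  pderiv a b (fun z => c * phi z + psi z) =
  (fun z => c * pderiv a b phi z + pderiv a b psi z).
Proof.
move=> tp tq; have L f g (v z : R * R) : differentiable f z -> differentiable g z ->
    'D_v (fun z => c * f z + g z) z = c * 'D_v f z + 'D_v g z.
  move=> df dg; have /diff_derivable Df := df; have /diff_derivable Dg := dg.
  have := @deriveD _ _ _ (c \*: f) g z v; rewrite deriveZ//; apply => //.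
  exact: derivableZ.
have H b' : pderiv 0 b' (fun z => c * phi z + psi z) =
  (fun z => c * pderiv 0 b' phi z + pderiv 0 b' psi z).
  elim: b' => // n IH; rewrite pderivSy IH; apply/funext => z.
  by apply: L; exact: test_diff.
elim: a => [//|n IH]; rewrite pderivSx IH; apply/funext => z.
by apply: L; exact: test_diff.
Qed.

Lemma test_lin (c : R) phi psi : test_function Omega phi -> test_function Omega psi ->
  test_function Omega (fun z => c * phi z + psi z).
Proof.
move=> tp tq; split => [a b z|].
  rewrite pderiv_lin//.
  apply: differentiableD; last exact: test_diff.
  by apply: differentiableZ; exact: test_diff.
have [K [cK KO p0]] := test_support tp; have [L [cL LO q0]] := test_support tq.
exists (K `|` L); split; [exact: compactU|by rewrite subUset|].
move=> z /not_orP[nK nL].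
by have /= -> := p0 0%N 0%N z nK; have /= -> := q0 0%N 0%N z nL; rewrite mulr0 addr0.
Qed.

(** [f] is controlled on [Omega] only. Around a point off [K] the product is identically 0, which
    gives continuity on the whole plane. *)
Lemma mul_test_continuous f phi K : compact K -> K `<=` Omega ->
  (forall z, ~ K z -> phi z = 0) -> continuous phi ->
  (forall z, Omega z -> {for z, continuous f}) ->
  continuous (fun z => f z * phi z).
Proof.
move=> cK KO p0 cp cf z; have [Kz|nK] := pselect (K z).
  by apply: cvgM; [apply: cf; exact: KO|exact: cp].
have e : \forall y \near z, 0 = f y * phi y.
  by near=> y; rewrite p0 ?mulr0//; near: y; exact: near_offK.
apply: (cvg_trans (near_eq_cvg e)).
by rewrite p0// mulr0; exact: cvg_cst.
Unshelve. all: by end_near. Qed.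

Lemma Rintegral_offK (f : R * R -> R) K : K `<=` Omega -> (forall z, ~ K z -> f z = 0) ->
  \int[leb2]_(z in Omega) f z = \int[leb2]_z f z.
Proof.
move=> KO f0; rewrite Rintegral_mkcond; apply: eq_Rintegral => z _.
rewrite patchE; case: ifPn => //; rewrite notin_setE => nO.
by rewrite f0// => /KO.
Qed.

Lemma derivable_offK K g (v : R * R) z : compact K -> (forall z, ~ K z -> g z = 0) ->
  ~ K z -> derivable g z v.
Proof.
move=> cK g0 nK; apply: (@near_eq_derivable _ _ _ (cst 0) g); last exact: derivable_cst.
by near=> y; rewrite /= g0//; near: y; exact: near_offK.
Unshelve. all: by end_near. Qed.

Section ibp.
Variables (u phi : R * R -> R) (K : set (R * R)) (v : R * R).
Hypotheses (cK : compact K) (KO : K `<=` Omega).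
Hypothesis p0 : forall z, ~ K z -> phi z = 0.
Hypothesis dphi : forall z, differentiable phi z.
Hypothesis cdphi : continuous ('D_v phi).
Hypothesis du : forall z, Omega z -> differentiable u z.
Hypothesis cdu : forall z, Omega z -> {for z, continuous ('D_v u)}.

Let cphi : continuous phi.
Proof. by move=> z; exact: differentiable_continuous. Qed.

Let cu z : Omega z -> {for z, continuous u}.
Proof. by move=> Oz; apply: differentiable_continuous; exact: du. Qed.

Let dp0 z : ~ K z -> 'D_v phi z = 0.
Proof. exact: derive_offK. Qed.

Lemma derivable_mul_test z : derivable (fun z => u z * phi z) z v.
Proof.
have [Kz|nK] := pselect (K z).
  by apply: derivableM; apply: diff_derivable => //; apply: du; exact: KO.
by apply: derivable_offK nK => // y nK; rewrite p0// mulr0.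
Qed.

Lemma derive_mul_test :
  'D_v (fun z => u z * phi z) = (fun z => 'D_v u z * phi z + u z * 'D_v phi z).
Proof.
apply/funext => z; have [Kz|nK] := pselect (K z).
  rewrite deriveM; last 2 first.
  - by apply: diff_derivable; apply: du; exact: KO.
  - exact: diff_derivable.
  by rewrite addrC; congr (_ + _); rewrite mulrC.
rewrite (derive_offK _ cK) ?p0 ?dp0 ?mulr0 ?addr0// => y nK'.
by rewrite p0// mulr0.
Qed.

Let C1 : continuous (fun z => 'D_v u z * phi z).
Proof. exact: mul_test_continuous cK KO p0 cphi cdu. Qed.

Let C2 : continuous (fun z => u z * 'D_v phi z).
Proof. exact: mul_test_continuous cK KO dp0 cdphi cu. Qed.

Lemma continuous_derive_mul_test : continuous ('D_v (fun z => u z * phi z)).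
Proof.
by rewrite derive_mul_test => z; apply: cvgD; [exact: C1|exact: C2].
Qed.

(** Kept for an arbitrary direction [v]; that the left-hand side vanishes comes from [int_dx0] and
    [int_dy0] in the two coordinate directions. *)
Lemma ibp_split : \int[leb2]_z ('D_v (fun z => u z * phi z) z) =
  ip ('D_v u) phi + ip u ('D_v phi).
Proof.
rewrite derive_mul_test RintegralD//.
- rewrite /Defs.ip !(@Rintegral_offK _ K)// => z nK.
  + first [by rewrite p0// mulr0|by rewrite dp0// mulr0].
  + first [by rewrite p0// mulr0|by rewrite dp0// mulr0].
- apply: (@offK_integrable _ K) => //.
  + by move=> z nK; first [rewrite p0// mulr0; done|rewrite dp0// mulr0; done].
- apply: (@offK_integrable _ K) => //.
  + by move=> z nK; first [rewrite p0// mulr0; done|rewrite dp0// mulr0; done].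
Qed.

End ibp.

Lemma ibp_x u phi : test_function Omega phi ->
  (forall z, Omega z -> differentiable u z) ->
  (forall z, Omega z -> {for z, continuous (dx u)}) ->
  ip (dx u) phi = - ip u (dx phi).
Proof.
move=> tp du cdu; have [K [cK KO p0]] := test_support tp.
have dp := fun z => test_diff 0 0 z tp.
have cdp := @test_continuous _ 1 0 tp.
have h : forall z, ~ K z -> phi z = 0 := p0 0%N 0%N.
apply/eqP; rewrite -addr_eq0 -(ibp_split cK KO h dp cdp du cdu).
apply/eqP; apply: (int_dx0 cK).
- by move=> z nK; rewrite h// mulr0.
- exact: (derivable_mul_test (v := (1, 0)) cK KO h dp du).
- exact: (continuous_derive_mul_test cK KO h dp cdp du cdu).
Qed.

Lemma ibp_y u phi : test_function Omega phi ->
  (forall z, Omega z -> differentiable u z) ->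
  (forall z, Omega z -> {for z, continuous (dy u)}) ->
  ip (dy u) phi = - ip u (dy phi).
Proof.
move=> tp du cdu; have [K [cK KO p0]] := test_support tp.
have dp := fun z => test_diff 0 0 z tp.
have cdp := @test_continuous _ 0 1 tp.
have h : forall z, ~ K z -> phi z = 0 := p0 0%N 0%N.
apply/eqP; rewrite -addr_eq0 -(ibp_split cK KO h dp cdp du cdu).
apply/eqP; apply: (int_dy0 cK).
- by move=> z nK; rewrite h// mulr0.
- by move=> z; exact: (derivable_mul_test cK KO h dp du).
- exact: (continuous_derive_mul_test cK KO h dp cdp du cdu).
Qed.

Hypothesis bO : bounded_set Omega.

Lemma bounded_L2 f (M : R) : measurable_fun (Omega : set (plane R)) (f : plane R -> R) ->
  (forall z, Omega z -> `|f z| <= M) -> L2 f.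
Proof.
move=> mf fM; split => //.
apply: (@bounded_meas_integrable _ _ (fun z => f z ^+ 2) (M ^+ 2)) => //.
- exact: leb2_bounded.
- exact: measurable_funX.
- move=> z Oz; rewrite normrX lerXn2r ?nnegrE ?fM//.
  exact: le_trans (fM z Oz).
Qed.

Lemma test_L2 phi a b : test_function Omega phi -> L2 (pderiv a b phi).
Proof.
move=> tp; have [K [cK KO p0]] := test_support tp.
have [M HM] := offK_bounded cK (p0 a b) (@test_continuous _ a b tp).
apply: (@bounded_L2 _ M) => //.
by apply: measurable_fun_continuous_on => // z _; exact: test_continuous.
Qed.

End TestFunctions.

(** * The fundamental lemma of the calculus of variations *)

Section Bumps.
Context {R : realType}.
Implicit Types (P Q p q r : {poly R}) (x y a b c d : R).

(** For [P = 1] this is exp(-1/y) extended by 0. The polynomial factor in 1/y makes the family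
    stable under differentiation. *)
Definition expinv P y : R := if 0 < y then P.[y^-1] * expR (- y^-1) else 0.

(** Induction on [P] with [m] general, because a factor 'X is traded for one more power of [t].
    Monomials are bounded by a single term of the exponential series. With t = 1/y this says that
    [expinv P] is flat at 0. *)
Lemma poly_exp_decay P m : exists2 C : R, 0 <= C &
  forall t, 0 < t -> `|P.[t]| * t ^+ m * expR (- t) <= C.
Proof.
have mono n t : 0 < t -> t ^+ n.+1 * expR (- t) <= (n.+1)`!%:R.
  move=> t0; rewrite expRN ler_pdivrMr ?expR_gt0// mulrC -ler_pdivrMr; last first.
    by rewrite ltr0n fact_gt0.
  by apply: le_trans (expR_ge1Dxn n (ltW t0)); rewrite lerDr.
elim/poly_ind: P m => [|P c IH] m.
  by exists 0 => // t t0; rewrite horner0 normr0 !mul0r.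
have [C C0 HC] := IH m.+1.
have [C' C'0 HC'] : exists2 C : R, 0 <= C & forall t, 0 < t -> t ^+ m * expR (- t) <= C.
  case: m {IH HC} => [|n]; last by exists (n.+1)`!%:R => //; exact: mono.
  exists 1 => // t t0; rewrite mul1r expRN invf_le1 ?expR_gt0//.
  by rewrite -expR0 ler_expR ltW.
exists (C + `|c| * C') => [|t t0]; first by rewrite addr_ge0// mulr_ge0.
rewrite hornerMXaddC; have t0' := ltW t0.
apply: le_trans (lerD (HC t t0) (ler_wpM2l (normr_ge0 c) (HC' t t0))).
rewrite exprS (_ : _ + `|c| * _ = (`|P.[t]| * t + `|c|) * (t ^+ m * expR (- t))).
  rewrite -[leLHS]mulrA; apply: ler_wpM2r.
    by rewrite mulr_ge0 ?exprn_ge0 ?expR_ge0.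
  by rewrite (le_trans (ler_normD _ _))// normrM (gtr0_norm t0).
by ring.
Qed.

(** For positive [y] the chain rule gives y^-2 (P - P')(1/y) exp(-1/y), which is [expinv] of the
    polynomial shown; the extension by 0 is the only delicate point. *)
Lemma is_derive_expinv P y :
  is_derive (y : R) (1 : R) (expinv P) (expinv ('X^2 * (P - P^`())) y).
Proof.
have [y0|y0|y0] := ltgtP 0 y.
- have : is_derive (y : R) (1 : R) (fun z : R => P.[z^-1] * expR (- z^-1))
      (expinv ('X^2 * (P - P^`())) y).
    have yN0 : y != 0 by rewrite gt_eqF.
    have D1 : is_derive (y : R) (1 : R) (fun z : R => z^-1) (- y ^- 2).
      have := @is_deriveV _ (id : R -> R) y 1 1 yN0 (is_derive_id _ _).
      by rewrite /GRing.scale /= mulr1.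
    have D2 : is_derive (y : R) (1 : R) (fun z : R => - z^-1) (y ^- 2).
      by have := is_deriveN D1; rewrite opprK.
    have D3 := @is_derive1_comp _ (horner P) (fun z : R => z^-1) y _ _
      (is_derive_poly P y^-1) D1.
    have D4 := @is_derive1_comp _ expR (fun z : R => - z^-1) y _ _
      (is_derive_expR _) D2.
    have := is_deriveM D3 D4.
    rewrite /expinv y0 => D5; apply: (is_derive_eq D5).
    rewrite /GRing.scale /= hornerM hornerXn hornerD hornerN exprVn; ring.
  apply: near_eq_is_derive; near=> z.
  by rewrite /expinv ifT//; near: z; exact: lt_nbhsr.
- have : is_derive (y : R) (1 : R) (cst (0 : R)) (0 : R) by exact: is_derive_cst.
  rewrite {2}/expinv ltNge (ltW y0) /=.
  apply: near_eq_is_derive; near=> z.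
  rewrite /expinv ifF//; apply/negbTE; rewrite -leNgt ltW//; near: z.
  exact: lt_nbhsl.
- rewrite -y0 {2}/expinv ltxx.
  have [C C0 HC] := poly_exp_decay P 2.
  (* Decay with exponent 2 makes [expinv P] quadratically small at 0, so the difference quotient is
     at most C |h|. *)
  have B h : `|expinv P h| <= C * h ^+ 2.
    rewrite /expinv; case: ifPn => h0; last by rewrite normr0 mulr_ge0// sqr_ge0.
    have := HC h^-1; rewrite invr_gt0 => /(_ h0).
    rewrite normrM (gtr0_norm (expR_gt0 _)) exprVn mulrAC.
    by rewrite ler_pdivrMr ?exprn_gt0.
  have cv : (fun h : R => h^-1 *: ((expinv P \o shift 0) (h *: (1 : R)) - expinv P 0))
      @ 0^' --> (0 : R).
    apply/cvgrPdist_le => e e0; near=> h.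
    have hN0 : h != 0 by near: h; exact: nbhs_dnbhs_neq.
    rewrite sub0r normrN /= addr0 /GRing.scale /= mulr1 {2}/expinv ltxx subr0.
    rewrite normrM normfV ler_pdivrMl ?normr_gt0//.
    apply: le_trans (B h) _.
    have -> : h ^+ 2 = `|h| * `|h| by rewrite -expr2 real_normK// num_real.
    rewrite mulrCA ler_wpM2l//.
    have : `|h| <= e / (C + 1).
      near: h; apply: dnbhs0_le; rewrite divr_gt0//; lra.
    rewrite ler_pdivlMr; last lra.
    by have := normr_ge0 h; nra.
  apply: DeriveDef; first by apply/cvg_ex; exists 0.
  exact/cvg_lim.
Unshelve. all: by end_near. Qed.

(* Closed under differentiation, which gives the bumps derivatives of every order. *)
Inductive bump_class : (R -> R) -> Prop :=
| BumpBase r P q : bump_class (fun x => r.[x] * expinv P q.[x])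
| BumpAdd f g : bump_class f -> bump_class g -> bump_class (fun x => f x + g x).

Lemma bump_class_derive (f : R -> R) : bump_class f -> exists f', bump_class f' /\
  forall x, is_derive (x : R) (1 : R) f (f' x).
Proof.
elim=> [r P q|f1 g1 _ [f' [Bf Df]] _ [g' [Bg Dg]]]; last first.
  exists (fun x => f' x + g' x); split; first exact: BumpAdd.
  by move=> x; have := Df x; have := Dg x => ? ?; exact: is_deriveD.
exists (fun x => r^`().[x] * expinv P q.[x] +
   (r * q^`()).[x] * expinv ('X^2 * (P - P^`())) q.[x]); split.
  by apply: BumpAdd; exact: BumpBase.
move=> x; have D1 := @is_derive1_comp _ (expinv P) (horner q) x _ _
      (is_derive_expinv P q.[x]) (is_derive_poly q x).
have := is_deriveM (is_derive_poly r x) D1.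
move=> D5; apply: (is_derive_eq D5); rewrite /GRing.scale /= hornerM; ring.
Qed.

Lemma bump_class_diff (f : R -> R) x : bump_class f -> differentiable f x.
Proof.
move=> /bump_class_derive[f' [_ D]]; apply/derivable1_diffP.
by have := D x => -[].
Qed.

Lemma differentiable_fst (z : R * R) : differentiable (fst : R * R -> R) z.
Proof.
have lin : linear (fst : R * R -> R) by [].
pose f : {linear (R * R)%type -> R} :=
  HB.pack (fst : R * R -> R) (GRing.isLinear.Build R (R * R)%type R *:%R fst lin).
apply: (@linear_differentiable R (R * R)%type R f).
by move=> x; exact: cvg_fst.
Qed.
Lemma differentiable_snd (z : R * R) : differentiable (snd : R * R -> R) z.
Proof.
have lin : linear (snd : R * R -> R) by [].
pose f : {linear (R * R)%type -> R} :=
  HB.pack (snd : R * R -> R) (GRing.isLinear.Build R (R * R)%type R *:%R snd lin).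
apply: (@linear_differentiable R (R * R)%type R f).
by move=> x; exact: cvg_snd.
Qed.

Definition tensor (f g : R -> R) (z : R * R) : R := f z.1 * g z.2.

Lemma tensor_diff (f g : R -> R) z : bump_class f -> bump_class g ->
  differentiable (tensor f g) z.
Proof.
move=> Bf Bg; apply: differentiableM.
- apply: (@differentiable_comp _ _ _ _ fst f); last exact: bump_class_diff.
  exact: differentiable_fst.
- apply: (@differentiable_comp _ _ _ _ snd g); last exact: bump_class_diff.
  exact: differentiable_snd.
Qed.

(** Each partial derivative acts on one factor and stays in the class, so every mixed derivative is
    again a product of differentiable functions. *)
Lemma tensor_pderiv (f g : R -> R) i j : bump_class f -> bump_class g ->
  exists f' g', [/\ bump_class f', bump_class g' &
    pderiv i j (tensor f g) = tensor f' g'].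
Proof.
move=> Bf Bg.
have [g' [Bg' E]] : exists g', bump_class g' /\
    pderiv 0 j (tensor f g) = tensor f g'.
  elim: j => [|j [g' [Bg' E]]]; first by exists g.
  have [g'' [Bg'' D]] := bump_class_derive Bg'.
  exists g''; split => //; rewrite pderivSy E; apply/funext => -[x y].
  have /diff_derivable T := @tensor_diff f g' (x, y) Bf Bg'.
  have := is_derive_slice_y (T _); case => _ <-; rewrite /tensor /=.
  by have := D y => Dy; rewrite deriveZ//= (derive_val (is_derive := Dy)).
elim: i => [|i [f' [g'' [Bf' Bg'' E']]]]; first by exists f, g'.
have [f'' [Bf'' D]] := bump_class_derive Bf'.
exists f'', g''; split => //; rewrite pderivSx E'; apply/funext => -[x y].
have /diff_derivable T := @tensor_diff f' g'' (x, y) Bf' Bg''.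
have := is_derive_slice_x (T _); case => _ <-; rewrite /tensor /=.
have Dx := D x; rewrite (_ : (fun s => _) = g'' y \*: f').
  by rewrite deriveZ//= (derive_val (is_derive := Dx)) /GRing.scale /= mulrC.
by apply/funext => s /=; rewrite mulrC.
Qed.

(** On []a, b[] this is exp(-1/((n+1)(x-a)(b-x))). The factor n+1 drives the exponent to 0, so the
    bumps tend pointwise to the indicator of the interval while staying below 1. *)
Definition bump1 a b (n : nat) x : R := expinv 1 (n.+1%:R * ((x - a) * (b - x))).

Lemma bump1_class a b n : bump_class (bump1 a b n).
Proof.
rewrite (_ : bump1 a b n = fun x => (1 : {poly R}).[x] *
  expinv 1 (n.+1%:R%:P * (('X - a%:P) * (b%:P - 'X))).[x]); first exact: BumpBase.
apply/funext => x; rewrite /bump1 hornerC mul1r.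
by rewrite !(hornerM, hornerC, hornerD, hornerN, hornerX).
Qed.

Lemma bump1_itv a b n x : 0 <= bump1 a b n x <= 1.
Proof.
rewrite /bump1 /expinv; case: ifPn => h; last by rewrite lexx ler01.
rewrite hornerC mul1r expR_ge0 expRN invf_le1 ?expR_gt0//.
by rewrite -[leLHS]expR0 ler_expR invr_ge0 ltW.
Qed.

Lemma bump1_out a b n x : a < b -> x \notin `]a, b[ -> bump1 a b n x = 0.
Proof.
move=> ab; rewrite in_itv /= negb_and -!leNgt => H; rewrite /bump1 /expinv ifF//.
apply/negbTE; rewrite -leNgt pmulr_rle0//.
by case/orP: H => ?; nra.
Qed.

Lemma bump1_cvg a b x : x \in `]a, b[ -> bump1 a b n x @[n --> \oo] --> (1 : R).
Proof.
rewrite in_itv /= => /andP[ax xb]; set t := (x - a) * (b - x).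
have t0 : 0 < t by rewrite mulr_gt0// subr_gt0.
have -> : (fun n => bump1 a b n x) = (fun n => expR (- (t^-1 * n.+1%:R^-1))).
  apply/funext => n; rewrite /bump1 /expinv mulr_gt0 ?ltr0n// hornerC mul1r.
  by rewrite invfM mulrC.
rewrite -[X in _ --> X]expR0; apply: continuous_cvg; first exact: continuous_expR.
rewrite -[X in _ --> X]oppr0; apply: cvgN; rewrite -[X in _ --> X](mulr0 t^-1).
by apply: cvgMr; exact: cvg_harmonic.
Qed.

Definition bump2 a b c d (n : nat) : R * R -> R := tensor (bump1 a b n) (bump1 c d n).

Lemma bump2_out a b c d n z : a < b -> c < d -> ~ obox a b c d z ->
  bump2 a b c d n z = 0.
Proof.
move=> ab cd nz; rewrite /bump2 /tensor.
have [z1|z1] := boolP (z.1 \in `]a, b[); last by rewrite bump1_out// mul0r.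
have [z2|z2] := boolP (z.2 \in `]c, d[); last by rewrite (bump1_out _ _ z2)// mulr0.
by exfalso; apply: nz; split; rewrite /= ?z1 ?z2.
Qed.

Lemma bump2_itv a b c d n z : 0 <= bump2 a b c d n z <= 1.
Proof.
have /andP[? ?] := bump1_itv a b n z.1; have /andP[? ?] := bump1_itv c d n z.2.
by rewrite /bump2 /tensor mulr_ge0//= mulr_ile1.
Qed.

Lemma bump2_cvg a b c d z : obox a b c d z -> bump2 a b c d n z @[n --> \oo] --> (1 : R).
Proof.
move=> [/= z1 z2]; rewrite -[X in _ --> X]mulr1.
by apply: cvgM; exact: bump1_cvg.
Qed.

Lemma bump2_test Omega a b c d n : a < b -> c < d -> cbox a b c d `<=` Omega ->
  test_function Omega (bump2 a b c d n).
Proof.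
move=> ab cd sub; split => [i j z|].
  have [f' [g' [Bf Bg ->]]] := tensor_pderiv i j (bump1_class a b n) (bump1_class c d n).
  exact: tensor_diff.
exists (cbox a b c d); split => //; first exact: cbox_compact.
by move=> z nz; apply: bump2_out => // /obox_sub.
Qed.

End Bumps.

(** * Integrals that vanish on a generating class *)

Section NullDynkin.
Context {R : realType}.
Variables (f : plane R -> R).
Local Notation "'nul' D" := (\int[leb2]_(x in D) (f x)%:E = 0)%E (at level 10).

Lemma null_dynkin d' (T' : measurableType d') (p : plane R -> T')
    (G : set (set T')) (D : set (plane R)) :
  measurable_fun setT p -> @measurable _ T' = <<s G >> -> setI_closed G ->
  measurable D -> leb2.-integrable D (EFin \o f) -> nul D ->
  (forall A, G A -> nul (D `&` p @^-1` A)) ->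
  forall A, measurable A -> nul (D `&` p @^-1` A).
Proof.
move=> mp GE GI mD If D0 G0.
have mDp A : measurable A -> measurable (D `&` p @^-1` A).
  by move=> mA; apply: measurableI => //; rewrite -[_ @^-1` _]setTI; exact: mp.
have IDp A : measurable A -> leb2.-integrable (D `&` p @^-1` A) (EFin \o f).
  by move=> mA; apply: integrableS If => //; exact: mDp.
rewrite GE; apply: (dynkin_induction (P := fun A => nul (D `&` p @^-1` A))) => //.
- by rewrite preimage_setT setIT.
- move=> A mA A0.
  have mAC := measurableC mA.
  have DE : D = (D `&` p @^-1` A) `|` (D `&` p @^-1` (~` A)).
    by rewrite -setIUr preimage_setC setUv setIT.
  move: D0; rewrite {1}DE integral_setU ?A0 ?add0e//; [exact: mDp|exact: mDp| |].
  + by rewrite -DE; exact: measurable_int If.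
  + by apply/disj_set2P; rewrite setIACA setIid preimage_setC setICr setI0.
- move=> F mF tF F0; rewrite preimage_bigcup setI_bigcupr integral_bigcup//.
  + by rewrite eseries0// => i _ _; exact: F0.
  + apply/trivIsetP => i j _ _ ij; rewrite setIACA setIid -preimage_setI.
    by move/trivIsetP : tF => ->//; rewrite preimage_set0 setI0.
  + by move=> k; exact: mDp.
  + by rewrite -setI_bigcupr -preimage_bigcup; apply: IDp; exact: bigcup_measurable.
Qed.

End NullDynkin.

(** * From test functions to vanishing almost everywhere *)

Section FundamentalLemma.
Context {R : realType}.
Variable Omega : set (R * R).
Hypothesis oO : open Omega.
Variable f : R * R -> R.
Local Notation leb := (@lebesgue_measure R).

Hypothesis If : forall a b c d : R, cbox a b c d `<=` Omega ->
  leb2.-integrable (cbox a b c d : set (plane R)) (EFin \o f).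
Hypothesis f_test : forall phi, test_function Omega phi -> ip Omega f phi = 0.

Local Notation "'nul' D" := (\int[leb2]_(x in D) (f x)%:E = 0)%E (at level 10).

Let If' (a b c d : R) : cbox a b c d `<=` Omega ->
  leb2.-integrable (obox a b c d : set (plane R)) (EFin \o f).
Proof.
move=> sub; apply: integrableS (If sub); [exact: cbox_measurable|exact: obox_measurable|].
exact: obox_sub.
Qed.

(** The bumps of the box are test functions tending to its indicator, and |f| dominates the
    products. *)
Lemma null_obox (a b c d : R) : cbox a b c d `<=` Omega -> nul (obox a b c d).
Proof.
move=> sub; have mQ := obox_measurable a b c d.
have [ab|ba] := ltP a b; last first.
  rewrite (_ : obox a b c d = set0) ?integral_set0//.
  apply/seteqP; split => // z [] /=; rewrite in_itv /= => /andP[h1 h2] _.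
  by have := lt_le_trans (lt_trans h1 h2) ba; rewrite ltxx.
have [cd|dc] := ltP c d; last first.
  rewrite (_ : obox a b c d = set0) ?integral_set0//.
  apply/seteqP; split => // z [] /= _; rewrite in_itv /= => /andP[h1 h2].
  by have := lt_le_trans (lt_trans h1 h2) dc; rewrite ltxx.
pose b_ n := bump2 a b c d n.
have tb n : test_function Omega (b_ n) by exact: bump2_test.
have mf : measurable_fun (obox a b c d : set (plane R)) (EFin \o f).
  exact: measurable_int (If' sub).
have mb n : measurable_fun (obox a b c d : set (plane R)) (b_ n : plane R -> R).
  apply: measurable_funTS; apply: continuous_plane_measurable.
  exact: (@test_continuous _ _ _ 0 0 (tb n)).
have I0 n : (\int[leb2]_(z in obox a b c d) (f z * b_ n z)%:E = 0)%E.
  have I1 : leb2.-integrable (obox a b c d : set (plane R))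
      (EFin \o (fun z => f z * b_ n z)).
    apply: le_integrable (If' sub) => //.
      by apply/measurable_EFinP; apply: measurable_funM => //; exact/measurable_EFinP.
    move=> z _ /=; rewrite lee_fin normrM ler_piMr//.
    by have /andP[? ?] := bump2_itv a b c d n z; rewrite ger0_norm.
  rewrite -[LHS]fineK; last exact: integrable_fin_num.
  congr EFin; rewrite -[RHS](f_test (tb n)).
  rewrite -[LHS]/(Rintegral leb2 (obox a b c d) (fun z => f z * b_ n z)) /ip.
  rewrite [LHS]Rintegral_mkcond [RHS]Rintegral_mkcond; apply: eq_Rintegral => z _.
  rewrite !patchE; case: ifPn => h1; case: ifPn => h2 //.
  - by move: h1 h2; rewrite inE notin_setE => /obox_sub/sub.
  - by move: h1; rewrite notin_setE => h1; rewrite /b_ bump2_out// mulr0.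
have h1 n : measurable_fun (obox a b c d : set (plane R)) (fun z => (f z * b_ n z)%:E).
  by apply/measurable_EFinP; apply: measurable_funM => //; exact/measurable_EFinP.
have h2 : {ae leb2, forall z, obox a b c d z ->
    (f z * b_ n z)%:E @[n --> \oo] --> (EFin \o f) z}.
  apply: aeW => z Qz; apply: cvg_EFin; first by near=> n.
  rewrite -[X in _ --> X]mulr1; apply: cvgMr.
  exact: bump2_cvg.
have h3 : {ae leb2, forall z n, obox a b c d z ->
    (`|(f z * b_ n z)%:E| <= (abse \o (EFin \o f)) z)%E}.
  apply: aeW => z n Qz /=; rewrite lee_fin normrM ler_piMr//.
  by have /andP[? ?] := bump2_itv a b c d n z; rewrite ger0_norm.
have [_ _] := dominated_convergence mQ h1 mf h2 (integrable_abse (If' sub)) h3.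
have -> : [sequence (\int[leb2]_(x in obox a b c d) (f x * b_ n x)%:E)%E]_n = cst 0%E.
  by apply/funext => n; exact: I0.
move=> /cvg_lim <-//.
by rewrite lim_cst.
Unshelve. all: by end_near. Qed.

Let GI : setI_closed (@RGenOInfty.G R).
Proof.
move=> _ _ [x ->] [y ->]; exists (Num.max x y).
by apply/seteqP; split => z /=; rewrite !in_itv /= !andbT gt_max => /andP.
Qed.

(** Cutting by a ray of the generating class only raises the lower end, so the result is again a box
    to which [null_obox] applies. *)
Lemma obox_fst (a b c d x : R) :
  obox a b c d `&` fst @^-1` `]x, +oo[%classic = obox (Num.max a x) b c d.
Proof.
apply/seteqP; split => -[u v] /=; rewrite /obox /= !in_itv /= andbT gt_max.
  by move=> [[/= /andP[-> ->] ?] ->].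
by move=> [/= /andP[/andP[-> ->] ->]].
Qed.

Lemma obox_snd (a b c d x : R) :
  obox a b c d `&` snd @^-1` `]x, +oo[%classic = obox a b (Num.max c x) d.
Proof.
apply/seteqP; split => -[u v] /=; rewrite /obox /= !in_itv /= andbT gt_max.
  by move=> [[/= ? /andP[-> ->]] ->].
by move=> [/= ? /andP[/andP[-> ->] ->]].
Qed.

Lemma cbox_shrink (a b c d x y : R) : cbox (Num.max a x) b (Num.max c y) d `<=` cbox a b c d.
Proof.
move=> [u v] [] /=; rewrite /cbox /= !in_itv /= !ge_max.
by move=> /andP[/andP[-> _] ->] /andP[/andP[-> _] ->].
Qed.

(** Three rounds of [null_dynkin]: from rays to Borel sets in the first coordinate, then in the
    second, then from rectangles to the product sigma-algebra. *)
Lemma null_obox_measurable (a b c d : R) (E : set (plane R)) : cbox a b c d `<=` Omega ->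
  measurable E -> nul (obox a b c d `&` E).
Proof.
move=> sub mE; have mR := RGenOInfty.measurableE R.
(* The maximum is carried along because the second round cuts the box by rays in the other
   coordinate; [c' = c] gives back the original box. *)
have S1 (c' : R) A : measurable (A : set (measurableTypeR R)) ->
    nul (obox a b (Num.max c c') d `&` fst @^-1` A).
  have sub' (x y : R) : cbox (Num.max a x) b (Num.max c y) d `<=` Omega.
    exact: subset_trans (@cbox_shrink _ _ _ _ _ _) sub.
  have sub'' (y : R) : cbox a b (Num.max c y) d `<=` Omega.
    by have := sub' a y; rewrite maxxx.
  apply: (null_dynkin (G := @RGenOInfty.G R)) => //.
  - exact: obox_measurable.
  - exact: If'.
  - exact: null_obox.
  - by move=> _ [x ->]; rewrite obox_fst; apply: null_obox.
have S2 A B : measurable (A : set (measurableTypeR R)) ->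
    measurable (B : set (measurableTypeR R)) ->
    nul (obox a b c d `&` fst @^-1` A `&` snd @^-1` B).
  move=> mA; have mD : measurable (obox a b c d `&` fst @^-1` A : set (plane R)).
    apply: measurableI; first exact: obox_measurable.
    by rewrite -[_ @^-1` _]setTI; exact: measurable_fst.
  apply: (null_dynkin (G := @RGenOInfty.G R)) => //.
  - by apply: integrableS (If' sub) => //; exact: obox_measurable.
  - by have := S1 c A mA; rewrite maxxx.
  - by move=> _ [x ->]; rewrite setIAC obox_snd; exact: S1.
apply: (null_dynkin (p := id) _ (measurable_prod_measurableType _ _)) mE => //.
- move=> _ _ [A mA [B mB <-]] [A' mA' [B' mB' <-]].
  exists (A `&` A'); first exact: measurableI.
  by exists (B `&` B'); [exact: measurableI|rewrite setXI].
- exact: obox_measurable.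
- exact: If'.
- exact: null_obox.
- move=> _ [A mA [B mB <-]]; rewrite (_ : _ `&` _ =
    obox a b c d `&` fst @^-1` A `&` snd @^-1` B); first exact: S2.
  by apply/seteqP; split => z /=; [case=> ? []|case=> -[]].
Qed.

(** A function whose integral vanishes on all measurable subsets of a box is 0 almost everywhere in
    it, and countably many boxes exhaust [Omega]. *)
Lemma fundamental_lemma_ae : {ae leb2, forall z, Omega z -> f z = 0}.
Proof.
have H (q : rat * rat * (rat * rat)) :
    {ae leb2, forall z, inner_rat_box Omega q z -> f z = 0}.
  have [sub|nsub] := pselect
    (cbox (ratr q.1.1) (ratr q.1.2) (ratr q.2.1) (ratr q.2.2) `<=` Omega); last first.
    by apply: aeW => z [].
  have : ae_eq leb2 (obox (ratr q.1.1) (ratr q.1.2) (ratr q.2.1) (ratr q.2.2))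
      (EFin \o f) (cst 0%E).
    apply: integral_ae_eq.
    - exact: obox_measurable.
    - exact: If'.
    - exact: measurable_cst.
    - move=> E EQ mE; rewrite integral0.
      by have := null_obox_measurable sub mE; rewrite setIidr.
  by apply: filterS => z h [bz _]; apply/EFin_inj/h.
(* The countable union is indexed by natural numbers through the coding of rational quadruples;
   numbers that encode none contribute the empty set. *)
have : leb2.-negligible (\bigcup_n (if unpickle n is Some q then
    ~` [set z | inner_rat_box Omega q z -> f z = 0] else set0)).
  apply: negligible_bigcup => n; case: unpickle => [q|]; first exact: H.
  exact: negligible_set0.
apply: negligibleS => z /= /not_implyP[Oz fz].
move: Oz; rewrite {1}(open_bigcup_rat_box oO) => -[q _ bq].
exists (pickle q); first exact: I.
by rewrite pickleK => h; apply: fz; exact: h.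
Qed.

End FundamentalLemma.

(** * Weak derivatives: uniqueness and comparison with classical ones *)

Section WeakDerivatives.
Context {R : realType}.
Variable Omega : set (R * R).
Hypotheses (oO : open Omega) (bO : bounded_set Omega).
Implicit Types (f g u v phi : R * R -> R).
Local Notation ip := (ip Omega).
Local Notation norm2 := (norm2 Omega).
Local Notation L2 := (L2 Omega).
Local Notation test := (test_function Omega).
Local Notation wD := (wD Omega).
Local Notation weak_deriv := (weak_deriv Omega).

Let mO : measurable (Omega : set (plane R)) := open_plane_measurable oO.

Lemma L2_cst (c : R) : L2 (cst c).
Proof. by apply: (@bounded_L2 _ _ oO bO _ `|c|) => //; exact: measurable_cst. Qed.

Lemma L2_integrable f : L2 f -> leb2.-integrable (Omega : set (plane R)) (EFin \o f).
Proof.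
move=> Lf; have := L2_mul mO Lf (L2_cst 1); apply: eq_integrable => // z _ /=.
by rewrite mulr1.
Qed.

Lemma ae0_ip0 f g : measurable_fun (Omega : set (plane R)) (f : plane R -> R) ->
  measurable_fun (Omega : set (plane R)) (g : plane R -> R) ->
  {ae leb2, forall z, Omega z -> f z = 0} -> ip f g = 0.
Proof.
move=> mf mg f0; rewrite /Defs.ip /Rintegral.
rewrite (ae_eq_integral (cst 0%E)) ?integral0//.
- by apply/measurable_EFinP; exact: measurable_funM.
- by move: f0; apply: negligibleS => z; apply: contra_not => /= f0 Oz; rewrite f0// mul0r.
Qed.

Lemma fundamental_lemma_L2 f : L2 f -> (forall phi, test phi -> ip f phi = 0) ->
  norm2 f = 0.
Proof.
move=> Lf f_test; have [mf _] := Lf.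
have : {ae leb2, forall z, Omega z -> f z = 0}.
  apply: fundamental_lemma_ae => // a b c d sub.
  by apply: integrableS (L2_integrable Lf) => //; exact: cbox_measurable.
by move=> /(ae0_ip0 mf mf) f0; rewrite /Defs.norm2 f0 sqrtr0.
Qed.

Lemma weak_deriv_unique a b u g h : weak_deriv a b u g -> weak_deriv a b u h ->
  norm2 (fun z => g z - h z) = 0.
Proof.
move=> [Lg Hg] [Lh Hh]; apply: fundamental_lemma_L2 => [|phi tp].
  exact: L2B.
have Lp : L2 phi := test_L2 oO bO 0 0 tp.
rewrite (ipBl mO)//; apply/eqP; rewrite subr_eq0; apply/eqP.
have : (-1) ^+ (a + b) * ip g phi = (-1) ^+ (a + b) * ip h phi.
  by rewrite -Hg// -Hh.
by move/mulfI; apply; rewrite signr_eq0.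
Qed.

Lemma wDP a b u : (exists g, weak_deriv a b u g) -> weak_deriv a b u (wD a b u).
Proof. by move=> /xgetPex; apply. Qed.

Lemma mul_test_integrable f phi : (forall z, Omega z -> {for z, continuous f}) ->
  test phi -> leb2.-integrable (Omega : set (plane R)) (EFin \o (fun z => f z * phi z)).
Proof.
move=> cf tp; have [K [cK KO p0]] := test_support tp.
have p00 : forall z, ~ K z -> phi z = 0 := p0 0%N 0%N.
have cp : continuous phi := @test_continuous _ _ _ 0 0 tp.
apply: (@offK_integrable _ K) => //.
  by move=> z nK; rewrite p00// mulr0.
exact: mul_test_continuous cK KO p00 cp cf.
Qed.

Lemma ae_L2 f g : measurable_fun (Omega : set (plane R)) (f : plane R -> R) ->
  L2 g -> {ae leb2, forall z, Omega z -> f z - g z = 0} -> L2 f.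
Proof.
move=> mf [mg Ig] fg; split => //; move/integrableP : Ig => [_ Ig].
apply/integrableP; split; first by apply/measurable_EFinP; exact: measurable_funX.
apply: le_lt_trans Ig; rewrite le_eqVlt; apply/orP; left; apply/eqP.
apply: ae_eq_integral => //.
- apply: measurableT_comp => //; apply/measurable_EFinP; exact: measurable_funX.
- apply: measurableT_comp => //; apply/measurable_EFinP; exact: measurable_funX.
- move: fg; apply: negligibleS => z; apply: contra_not => /= + Oz => /(_ Oz)/eqP.
  by rewrite subr_eq0 => /eqP ->.
Qed.

(** [g] is merely continuous in [Omega] and may a priori grow at the boundary. It is bounded on
    closed boxes inside, which suffices for [fundamental_lemma_ae]; square integrability is then
    inherited from the weak derivative. *)
Lemma classical_weak_deriv (a b : nat) u g :
  (exists h, weak_deriv a b u h) ->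
  (forall z, Omega z -> {for z, continuous g}) ->
  (forall phi, test phi -> ip u (pderiv a b phi) = (-1) ^+ (a + b) * ip g phi) ->
  L2 g /\ norm2 (fun z => g z - wD a b u z) = 0.
Proof.
move=> /wDP[Lw Hw] cg Hg; set w := wD a b u in Lw Hw *.
have mg : measurable_fun (Omega : set (plane R)) (g : plane R -> R).
  exact: measurable_fun_continuous_on.
have [mw _] := Lw.
have mgw : measurable_fun (Omega : set (plane R)) ((fun z => g z - w z) : plane R -> R).
  exact: measurable_funB.
have gw0 : {ae leb2, forall z, Omega z -> g z - w z = 0}.
  apply: (@fundamental_lemma_ae _ Omega oO (fun z => g z - w z)) => [x1 x2 y1 y2 sub|phi tp].
    have mQ := cbox_measurable x1 x2 y1 y2.
    apply: (integrableB mQ (f := EFin \o g) (g := EFin \o w)); last first.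
      by apply: integrableS (L2_integrable Lw).
    have : compact (g @` cbox x1 x2 y1 y2).
      apply: continuous_compact; last exact: cbox_compact.
      apply: continuous_in_subspaceT => z; rewrite inE => /sub; exact: cg.
    move=> /compact_bounded [M [_ HM]].
    apply: (@bounded_meas_integrable _ _ g (`|M| + 1)) => //.
    - exact: leb2_box_lty.
    - exact: measurable_funS mg.
    - move=> z Qz; apply: HM; last by exists z.
      by rewrite (le_lt_trans (ler_norm M))// ltrDl.
  have Lp : L2 phi := test_L2 oO bO 0 0 tp.
  have : ip g phi = ip w phi.
    have := Hg _ tp; rewrite Hw// => /mulfI -> //.
    by rewrite signr_eq0.
  rewrite /Defs.ip => /eqP; rewrite -subr_eq0 -RintegralB//.
  - move=> /eqP <-; apply: eq_Rintegral => z _; ring.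
  - exact: mul_test_integrable.
  - exact: L2_mul.
split; first exact: ae_L2 mg Lw gw0.
by rewrite /Defs.norm2 (ae0_ip0 mgw mgw gw0) sqrtr0.
Qed.

Lemma C1_weak_dx v : is_C1 Omega v -> (exists h, weak_deriv 1 0 v h) ->
  L2 (dx v) /\ norm2 (fun z => dx v z - wD 1 0 v z) = 0.
Proof.
move=> C1 W; apply: classical_weak_deriv => // [z /C1[]//|phi tp].
rewrite expr1 mulN1r ibp_x// ?opprK// => z /C1[]//.
Qed.

Lemma C1_weak_dy v : is_C1 Omega v -> (exists h, weak_deriv 0 1 v h) ->
  L2 (dy v) /\ norm2 (fun z => dy v z - wD 0 1 v z) = 0.
Proof.
move=> C1 W; apply: classical_weak_deriv => // [z /C1[]//|phi tp].
rewrite expr1 mulN1r ibp_y// ?opprK// => z /C1[]//.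
Qed.

End WeakDerivatives.

(** * Completeness of L^2 *)

Section Completeness.
Context {R : realType}.
Variable Omega : set (R * R).
Hypotheses (oO : open Omega) (bO : bounded_set Omega).
Local Notation ip := (ip Omega).
Local Notation norm2 := (norm2 Omega).
Local Notation L2 := (L2 Omega).

Let mO : measurable (Omega : set (plane R)) := open_plane_measurable oO.

Variable u : nat -> R * R -> R.
Hypothesis Lu : forall n, L2 (u n).
Hypothesis u_cauchy : forall n, norm2 (fun z => u n.+1 z - u n z) <= 2^-1 ^+ n.

Let g n z := u n.+1 z - u n z.
Let Lg n : L2 (g n). Proof. exact: L2B. Qed.
Let mu_ n : measurable_fun (Omega : set (plane R)) (u n : plane R -> R).
Proof. by case: (Lu n). Qed.
Let mg n : measurable_fun (Omega : set (plane R)) (g n : plane R -> R).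
Proof. by case: (Lg n). Qed.
Let mag n : measurable_fun (Omega : set (plane R)) (fun z : plane R => `|g n z|%:E).
Proof. by apply/measurable_EFinP; exact: measurableT_comp. Qed.

(** Cauchy-Schwarz against the constant 1, which is square integrable because [Omega] is bounded. *)
Let L2_norm1 h : L2 h -> (\int[leb2]_(z in Omega) `|h z|%:E <= (norm2 h * norm2 (cst 1))%:E)%E.
Proof.
move=> Lh; have La : L2 (fun z => `|h z|).
  have [mh Ih] := Lh; split; first exact: measurableT_comp.
  by apply: eq_integrable Ih => // z _; rewrite real_normK// num_real.
have L1 : L2 (cst 1) := L2_cst oO bO 1.
have -> : norm2 h = norm2 (fun z => `|h z|).
  congr Num.sqrt; apply: eq_Rintegral => z _.
  by rewrite -!expr2 real_normK// num_real.
rewrite -[leLHS]fineK; last first.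
  by apply: integrable_fin_num => //; exact: (L2_integrable oO bO La).
rewrite lee_fin; apply: le_trans (ip_le_norm2 mO La L1).
apply: le_trans (ler_norm _); rewrite le_eqVlt; apply/orP; left; apply/eqP.
by apply: eq_Rintegral => z _; rewrite mulr1.
Qed.

Let sum_half n : \sum_(0 <= k < n) 2^-1 ^+ k <= 2 :> R.
Proof.
suff : \sum_(0 <= k < n) 2^-1 ^+ k = 2 - 2 * 2^-1 ^+ n :> R.
  by move=> ->; rewrite lerBlDr lerDl mulr_ge0// exprn_ge0.
elim: n => [|n IH]; first by rewrite big_geq// expr0; ring.
by rewrite big_nat_recr//= IH exprS; field.
Qed.

(** Riesz-Fischer: the sum of the |g n| has integral at most 2 ||1||, so it is finite almost
    everywhere, and there the telescoping series converges absolutely. *)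
Lemma ae_cvg : {ae leb2, forall z, Omega z -> cvgn (u ^~ z)}.
Proof.
pose S z := (\sum_(n <oo) `|g n z|%:E)%E.
have IS : leb2.-integrable (Omega : set (plane R)) S.
  apply/integrableP; split.
    by apply: ge0_emeasurable_sum.
  under eq_integral do rewrite gee0_abs ?nneseries_ge0//.
  rewrite integral_nneseries//.
  apply: (@le_lt_trans _ _ (2 * norm2 (cst 1))%:E); last exact: ltry.
  apply: lime_le; first by apply: is_cvg_nneseries => n _ _; exact: integral_ge0.
  apply: nearW => n; apply: (@le_trans _ _
    (\sum_(0 <= k < n) (2^-1 ^+ k * norm2 (cst 1))%:E)%E).
    apply: lee_sum => k _; apply: le_trans (L2_norm1 (Lg k)) _.
    by rewrite lee_fin; apply: ler_wpM2r; [exact: norm2_ge0|exact: u_cauchy].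
  rewrite sumEFin lee_fin -mulr_suml; apply: ler_wpM2r; first exact: norm2_ge0.
  exact: sum_half.
have := integrable_ae mO IS; apply: negligibleS => z; apply: contra_not => /= H Oz.
have {H} Sfin := H Oz.
have cs : cvgn (series (telescope (u ^~ z))).
  apply: normed_cvg; apply: nondecreasing_is_cvgn.
    apply: nondecreasing_series => n _ _ /=; exact: normr_ge0.
  exists (fine (S z)) => _ [n _ <-].
  rewrite -lee_fin fineK// /series /= -sumEFin.
  exact: nneseries_lim_ge.
rewrite (_ : u ^~ z = (fun n => u 0%N z + series (telescope (u ^~ z)) n)).
  by apply: is_cvgD => //; exact: is_cvg_cst.
by apply/funext => n; rewrite -eq_sum_telescope.
Qed.

(** The upper limit is measurable and defined everywhere; it equals the limit at almost every
    point. *)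
Let f (z : R * R) : R := fine (limn_esup (fun n => (u n z)%:E)).

Let mf : measurable_fun (Omega : set (plane R)) (f : plane R -> R).
Proof.
apply: measurableT_comp => //.
by apply: measurable_fun_limn_esup => n; exact/measurable_EFinP.
Qed.

Let u_cauchy_shift n k : norm2 (fun z => u n z - u (n + k)%N z) <= 2 * 2^-1 ^+ n.
Proof.
(* The sharper bound, with the tail of the geometric series subtracted, is what passes through the
   induction on [k]. *)
suff : norm2 (fun z => u n z - u (n + k)%N z) <= 2 * 2^-1 ^+ n - 2 * 2^-1 ^+ (n + k).
  by move/le_trans; apply; rewrite lerBlDr lerDl mulr_ge0// exprn_ge0.
elim: k => [|k IH].
  rewrite addn0 subrr (@eq_norm2 _ _ _ (cst 0)); last by move=> z _ /=; rewrite subrr.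
  by rewrite /Defs.norm2 ip0l sqrtr0.
have := norm2_triB mO (Lu n) (Lu (n + k)) (Lu (n + k.+1)).
move=> /le_trans; apply.
have := u_cauchy (n + k); rewrite norm2_distC addnS.
have -> : 2^-1 ^+ (n + k) = 2 * 2^-1 ^+ (n + k).+1 :> R by rewrite exprS; field.
move: IH; have -> : 2^-1 ^+ (n + k) = 2 * 2^-1 ^+ (n + k).+1 :> R by rewrite exprS; field.
lra.
Qed.

(** Fatou's lemma applied to the squares of u n - u m as m grows, with the uniform bound of
    [u_cauchy_shift]. *)
Let fatou_bound n :
  (\int[leb2]_(z in Omega) ((u n z - f z) ^+ 2)%:E <= ((2 * 2^-1 ^+ n) ^+ 2)%:E)%E.
Proof.
pose F m z := ((u n z - u m z) ^+ 2)%:E.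
have mF m : measurable_fun (Omega : set (plane R)) (F m : plane R -> \bar R).
  by apply/measurable_EFinP; apply: measurable_funX; exact: measurable_funB.
have F0 m z : Omega z -> (0 <= F m z)%E by move=> _; rewrite lee_fin sqr_ge0.
have bF k : (\int[leb2]_(z in Omega) F (n + k)%N z <= ((2 * 2^-1 ^+ n) ^+ 2)%:E)%E.
  have LB : L2 (fun z => u n z - u (n + k)%N z) by exact: L2B.
  rewrite -[leLHS]fineK; last first.
    by have [_ IB] := LB; exact: integrable_fin_num.
  rewrite lee_fin; apply: (@le_trans _ _ (norm2 (fun z => u n z - u (n + k)%N z) ^+ 2)).
    rewrite norm2_sq le_eqVlt; apply/orP; left; apply/eqP.
    by apply: eq_Rintegral => z _; rewrite expr2.
  rewrite lerXn2r ?nnegrE ?norm2_ge0 ?u_cauchy_shift//.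
have -> : (\int[leb2]_(z in Omega) ((u n z - f z) ^+ 2)%:E =
           \int[leb2]_(z in Omega) limn_einf (F ^~ z))%E.
  apply: ae_eq_integral => //.
  - by apply/measurable_EFinP; apply: measurable_funX; exact: measurable_funB.
  - rewrite (_ : (fun z => _) = (fun z => - limn_esup (-%E \o F ^~ z))%E); last first.
      by apply/funext => z; rewrite limn_esupN oppeK.
    apply: measurableT_comp => //.
    apply: (measurable_fun_limn_esup (f := fun m z => - F m z)%E) => m.
    exact: (measurableT_comp (@oppe_measurable R setT) (mF m)).
  - have := ae_cvg; apply: negligibleS => z; apply: contra_not => /= H Oz.
    have /cvg_ex[l /= ul] := H Oz.
    have fl : f z = l.
      have /cvg_limn_einf_sup[_ e] : (u m z)%:E @[m --> \oo] --> l%:E.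
        by apply: cvg_EFin => //; near=> m.
      by rewrite /f e.
    have /cvg_limn_einf_sup[-> _] // : F ^~ z @ \oo --> ((u n z - l) ^+ 2)%:E.
      apply: cvg_EFin; first by near=> m.
      rewrite /= expr2 /F; under eq_fun do rewrite /= expr2.
      by apply: cvgM; apply: cvgB => //; exact: cvg_cst.
    by rewrite fl.
apply: le_trans (fatou _ mO mF F0) _; rewrite limn_einf_lim.
apply: lime_le; first exact: is_cvg_einfs.
near=> m; apply: ereal_inf_le.
exists (\int[leb2]_(z in Omega) F (n + m)%N z)%E; last exact: bF.
by exists (n + m)%N => //=; rewrite leq_addl.
Unshelve. all: by end_near. Qed.

Lemma L2_complete : exists2 h, L2 h &
  (fun n => norm2 (fun z => u n z - h z)) @ \oo --> (0 : R).
Proof.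
have LB n : L2 (fun z => u n z - f z).
  have mB : measurable_fun (Omega : set (plane R)) ((fun z => u n z - f z) : plane R -> R).
    exact: measurable_funB.
  split => //; apply/integrableP; split.
    by apply/measurable_EFinP; exact: measurable_funX.
  under eq_integral do rewrite gee0_abs ?lee_fin ?sqr_ge0//.
  by apply: le_lt_trans (fatou_bound n) _; exact: ltry.
exists f.
  have := L2B mO (Lu 0) (LB 0%N); apply: eq_L2 => // z _; ring.
have B n : norm2 (fun z => u n z - f z) <= 2 * 2^-1 ^+ n.
  rewrite -(ler_pXn2r (n := 2)) ?nnegrE ?norm2_ge0//.
  rewrite norm2_sq -lee_fin; apply: le_trans (fatou_bound n).
  rewrite -[leRHS]fineK; last by have [_ IB] := LB n; exact: integrable_fin_num.
  rewrite lee_fin le_eqVlt; apply/orP; left; apply/eqP.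
  by apply: eq_Rintegral => z _; rewrite expr2.
apply: (squeeze_cvgr (f := cst 0) (h := fun n => 2 * 2^-1 ^+ n)).
- by apply: nearW => n; rewrite norm2_ge0 B.
- exact: cvg_cst.
- rewrite -[X in _ --> X](mulr0 2); apply: cvgMr.
  apply: cvg_expr; rewrite ger0_norm//; lra.
Qed.

End Completeness.

(** * Rellich compactness *)

Section Oscillation.
Context {R : realType}.
Local Notation leb := (@lebesgue_measure R).

(** Cauchy-Schwarz for the integral of [f], read off from the nonnegative integral of (f - t)^2 with
    [t] the mean slope on [[x, y]]; the interval is then enlarged to length [l]. *)
Lemma oscillation_lt (F f : R -> R) (a l x y : R) :
  (forall s, is_derive (s : R) (1 : R) F (f s)) -> continuous f ->
  a <= x -> x < y -> y < a + l ->
  (F y - F x) ^+ 2 <= l * \int[leb]_(s in `[a, a + l[) f s ^+ 2.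
Proof.
move=> dF cf ax xy ya; set d := F y - F x.
have cf2 : continuous (fun s => f s ^+ 2).
  by move=> s; apply: cvgM; exact: cf.
have Ic (g : R -> R) u v : continuous g -> leb.-integrable `[u, v] (EFin \o g).
  move=> cg; apply: continuous_compact_integrable; first exact: segment_compact.
  exact: continuous_subspaceT.
have I2 : leb.-integrable `[a, a + l[ (EFin \o (fun s => f s ^+ 2)).
  apply: integrableS (Ic _ a (a + l) cf2) => // s /=.
  by rewrite !in_itv /= => /andP[-> /ltW].
have If : \int[leb]_(s in `[x, y]) f s = d.
  by rewrite /Rintegral (integral_deriv xy dF cf).
have lxy : fine (leb `[x, y]%classic) = y - x.
  by rewrite lebesgue_measure_itv /= lte_fin xy.
set t := d / (y - x); set S := \int[leb]_(s in `[x, y]) f s ^+ 2.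
have yx : 0 < y - x by rewrite subr_gt0.
have : 0 <= \int[leb]_(s in `[x, y]) ((f s ^+ 2 - (2 * t) * f s) + t ^+ 2).
  apply: Rintegral_ge0 => s _.
  rewrite (_ : _ + _ = (f s - t) ^+ 2) ?sqr_ge0//; ring.
have c1 : continuous (fun s => (2 * t) * f s).
  by move=> s; apply: cvgMr; exact: cf.
have c2 : continuous (fun s => f s ^+ 2 - (2 * t) * f s).
  by move=> s; apply: cvgB; [exact: cf2|exact: c1].
rewrite RintegralD//; [|exact: Ic|by apply: Ic => s; exact: cvg_cst].
rewrite RintegralB//; [|exact: Ic|exact: Ic].
rewrite RintegralZl//; last exact: Ic.
rewrite Rintegral_cst// lxy If -/S => H.
have HS : d ^+ 2 <= (y - x) * S.
  rewrite -ler_pdivrMl//.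
  have -> : (y - x)^-1 * d ^+ 2 = 2 * t * d - t ^+ 2 * (y - x).
    by rewrite /t; field; rewrite gt_eqF.
  lra.
apply: le_trans HS _; apply: ler_pM => //.
- exact: ltW.
- by apply: Rintegral_ge0 => s _; exact: sqr_ge0.
- by rewrite lerBlDr; apply: (le_trans (ltW ya)); rewrite addrC lerD2l.
- have sub : `[x, y]%classic `<=` `[a, a + l[%classic.
    move=> s /=; rewrite !in_itv /= => /andP[xs sy].
    by rewrite (le_trans ax xs) (le_lt_trans sy ya).
  rewrite /S [leRHS]Rintegral_mkcond [leLHS]Rintegral_mkcond.
  apply: le_Rintegral => //.
  + by have := (integrable_mkcond _ _).1 (Ic _ x y cf2); rewrite restrict_EFin; apply.
  + by have := (integrable_mkcond _ _).1 I2; rewrite restrict_EFin; apply.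
  + move=> s _; rewrite !patchE; case: ifPn => [|_].
      by rewrite inE => /sub; rewrite -inE => ->.
    by case: ifPn => // _; exact: sqr_ge0.
Qed.

Lemma oscillation (F f : R -> R) (a l x y : R) :
  (forall s, is_derive (s : R) (1 : R) F (f s)) -> continuous f ->
  x \in `[a, a + l[ -> y \in `[a, a + l[ ->
  (F x - F y) ^+ 2 <= l * \int[leb]_(s in `[a, a + l[) f s ^+ 2.
Proof.
move=> dF cf; rewrite !in_itv /= => /andP[ax xl] /andP[ay yl].
have [xy|yx|->] := ltgtP x y.
- by rewrite -sqrrN opprB; exact: oscillation_lt xy yl.
- exact: oscillation_lt yx xl.
- rewrite subrr expr0n /= mulr_ge0//; last by apply: Rintegral_ge0 => s _; exact: sqr_ge0.
  lra.
Qed.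

End Oscillation.

(** * Half-open boxes and Tonelli's theorem *)

Section HalfOpenBoxes.
Context {R : realType}.
Implicit Types (a b c d l : R) (g : R * R -> R).
Local Notation leb := (@lebesgue_measure R).

(** Half-open in both coordinates, so that adjacent cells of a grid are disjoint and tile a square
    exactly. *)
Definition hbox a b c d : set (plane R) := `[a, b[%classic `*` `[c, d[%classic.

Lemma hbox_measurable a b c d : measurable (hbox a b c d).
Proof. exact: measurableX. Qed.

Lemma hbox_sub_cbox a b c d : hbox a b c d `<=` cbox a b c d.
Proof.
move=> [x y] [] /=; rewrite !in_itv /= => /andP[? ?] /andP[? ?].
by split; rewrite /= in_itv /=; apply/andP; split => //; exact: ltW.
Qed.

Lemma hbox_finite a b c d : (leb2 (hbox a b c d) < +oo)%E.
Proof.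
apply: le_lt_trans (leb2_box_lty a b c d).
apply: le_measure; rewrite ?inE//; [exact: hbox_measurable|exact: cbox_measurable|].
exact: hbox_sub_cbox.
Qed.

Lemma leb2_hbox a c l : 0 < l -> leb2 (hbox a (a + l) c (c + l)) = (l ^+ 2)%:E.
Proof.
move=> l0; rewrite /leb2 product_measure1E//= !lebesgue_measure_itv/= !lte_fin.
by rewrite !ltrDl l0 -!EFinB -EFinM expr2 addrAC subrr add0r addrAC subrr add0r.
Qed.

Lemma Rintegral_hbox_cst a c l (r : R) : 0 < l ->
  \int[leb2]_(z in hbox a (a + l) c (c + l)) r = r * l ^+ 2.
Proof.
move=> l0; have mE := hbox_measurable a (a + l) c (c + l).
rewrite (Rintegral_cst _ mE); congr (_ * _).
transitivity (fine (leb2 (hbox a (a + l) c (c + l)))); first by [].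
by rewrite leb2_hbox.
Qed.

Lemma continuous_hbox_integrable g a b c d : continuous g ->
  leb2.-integrable (hbox a b c d) (EFin \o g).
Proof.
move=> cg; have : compact (g @` cbox a b c d).
  by apply: continuous_compact; [exact: continuous_subspaceT|exact: cbox_compact].
move=> /compact_bounded [M [_ HM]].
apply: (@bounded_meas_integrable _ _ g (`|M| + 1)).
- exact: hbox_measurable.
- exact: hbox_finite.
- by apply: measurable_funTS; exact: continuous_plane_measurable.
- move=> z /hbox_sub_cbox Qz; apply: HM; last by exists z.
  by rewrite (le_lt_trans (ler_norm M))// ltrDl.
Qed.

Lemma hbox_restrict_x (F : plane R -> \bar R) a b c d x y :
  (F \_ (hbox a b c d)) (x, y) =
  ((fun y => ((fun x => F (x, y)) \_ `[a, b[) x) \_ `[c, d[) y.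
Proof.
rewrite !patchE; case: ifPn => [|]; rewrite ?inE ?notin_setE.
  by move=> [/= h1 h2]; rewrite !mem_set.
move=> h; case: ifPn => //; rewrite inE => h2; case: ifPn => //; rewrite inE => h1.
by exfalso; apply: h; split.
Qed.

Lemma tonelli_hbox_yx (F : plane R -> \bar R) a b c d :
  measurable_fun setT F -> (forall z, (0 <= F z)%E) ->
  (\int[leb2]_(z in hbox a b c d) F z =
   \int[leb]_(y in `[c, d[) \int[leb]_(x in `[a, b[) F (x, y))%E.
Proof.
move=> mF F0; have mFr : measurable_fun setT (F \_ (hbox a b c d)).
  apply: (measurable_restrictT _ (hbox_measurable a b c d)).1.
  exact: measurable_funTS mF.
rewrite integral_mkcond fubini_tonelli2//; last by move=> z; rewrite patchE; case: ifPn.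
rewrite [RHS]integral_mkcond; apply: eq_integral => y _.
rewrite /fubini_G /= patchE; case: ifPn => yJ.
  rewrite [RHS]integral_mkcond; apply: eq_integral => x _.
  by rewrite hbox_restrict_x patchE yJ.
rewrite (eq_integral (cst 0%E)) ?integral0// => x _.
by rewrite hbox_restrict_x patchE (negbTE yJ).
Qed.

Lemma tonelli_hbox_xy (F : plane R -> \bar R) a b c d :
  measurable_fun setT F -> (forall z, (0 <= F z)%E) ->
  (\int[leb2]_(z in hbox a b c d) F z =
   \int[leb]_(x in `[a, b[) \int[leb]_(y in `[c, d[) F (x, y))%E.
Proof.
move=> mF F0; have mFr : measurable_fun setT (F \_ (hbox a b c d)).
  apply: (measurable_restrictT _ (hbox_measurable a b c d)).1.
  exact: measurable_funTS mF.
rewrite integral_mkcond fubini_tonelli1//; last by move=> z; rewrite patchE; case: ifPn.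
rewrite [RHS]integral_mkcond; apply: eq_integral => x _.
rewrite /fubini_F /= patchE; case: ifPn => xI.
  rewrite [RHS]integral_mkcond; apply: eq_integral => y _.
  by rewrite hbox_restrict_x !patchE xI.
rewrite (eq_integral (cst 0%E)) ?integral0// => y _.
by rewrite hbox_restrict_x !patchE (negbTE xI) if_same.
Qed.

End HalfOpenBoxes.

(** * Integrals over the slices of a box *)

Section SliceIntegrals.
Context {R : realType}.
Variables (g : R * R -> R) (a b c d : R).
Hypotheses (cg : continuous g) (g0 : forall z, 0 <= g z) (ab : a < b) (cd : c < d).
Local Notation leb := (@lebesgue_measure R).

Let mg : measurable_fun setT ((EFin \o g) : plane R -> \bar R).
Proof. by apply/measurable_EFinP; exact: continuous_plane_measurable. Qed.

Let slice_fin (F : R -> R) u v : continuous F ->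
  (\int[leb]_(s in `[u, v[) (F s)%:E = (\int[leb]_(s in `[u, v[) F s)%:E)%E.
Proof.
move=> cF; rewrite /Rintegral fineK//; apply: integrable_fin_num => //.
have Ic : leb.-integrable `[u, v] (EFin \o F).
  apply: continuous_compact_integrable; first exact: segment_compact.
  exact: continuous_subspaceT.
apply: integrableS Ic => // s /=.
by rewrite !in_itv /= => /andP[-> /ltW].
Qed.

Let H y := \int[leb]_(s in `[a, b[) g (s, y).
Let V x := \int[leb]_(s in `[c, d[) g (x, s).

Let HE y : ((H y)%:E = \int[leb]_(s in `[a, b[) (g (s, y))%:E)%E.
Proof. by rewrite -slice_fin//; exact: continuous_slice_x. Qed.

Let VE x : ((V x)%:E = \int[leb]_(s in `[c, d[) (g (x, s))%:E)%E.
Proof. by rewrite -slice_fin//; exact: continuous_slice_y. Qed.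

(** Restricting [g] to a strip turns the slice integral into a full section integral, whose
    measurability is part of Tonelli's theorem. *)
Let mH' : measurable_fun setT (fun y : measurableTypeR R => (H y)%:E).
Proof.
pose S : set (plane R) := `[a, b[%classic `*` setT.
have mS : measurable S by apply: measurableX.
have mF : measurable_fun setT ((EFin \o g) \_ S).
  by apply: (measurable_restrictT _ mS).1; exact: measurable_funTS mg.
have F0 z : (0 <= ((EFin \o g) \_ S) z)%E by rewrite patchE; case: ifPn => //; rewrite lee_fin.
have HE' : (fun y => \int[leb]_x ((EFin \o g) \_ S) (x, y))%E = (fun y => (H y)%:E).
  apply/funext => y; rewrite HE [RHS]integral_mkcond.
  apply: eq_integral => x _ /=; rewrite !patchE.
  case: ifPn => [|]; rewrite ?inE ?notin_setE /S /=.
    by move=> [/= h _]; rewrite mem_set.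
  by move=> h; case: ifPn => //; rewrite inE /= => h'; exfalso; apply: h.
by rewrite -HE'; exact: (measurable_fun_fubini_tonelli_G (m1 := leb) _ mF F0).
Qed.

Let mH : measurable_fun setT ((fun z => (H z.2)%:E) : plane R -> \bar R).
Proof. by apply: (measurableT_comp mH'); exact: measurable_snd. Qed.

Let mV' : measurable_fun setT (fun x : measurableTypeR R => (V x)%:E).
Proof.
pose S : set (plane R) := setT `*` `[c, d[%classic.
have mS : measurable S by apply: measurableX.
have mF : measurable_fun setT ((EFin \o g) \_ S).
  by apply: (measurable_restrictT _ mS).1; exact: measurable_funTS mg.
have F0 z : (0 <= ((EFin \o g) \_ S) z)%E by rewrite patchE; case: ifPn => //; rewrite lee_fin.
have VE' : (fun x => \int[leb]_y ((EFin \o g) \_ S) (x, y))%E = (fun x => (V x)%:E).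
  apply/funext => x; rewrite VE [RHS]integral_mkcond.
  apply: eq_integral => y _ /=; rewrite !patchE.
  case: ifPn => [|]; rewrite ?inE ?notin_setE /S /=.
    by move=> [/= _ h]; rewrite mem_set.
  by move=> h; case: ifPn => //; rewrite inE /= => h'; exfalso; apply: h.
by rewrite -VE'; exact: (measurable_fun_fubini_tonelli_F (m2 := leb) _ mF F0).
Qed.

Let mV : measurable_fun setT ((fun z => (V z.1)%:E) : plane R -> \bar R).
Proof. by apply: (measurableT_comp mV'); exact: measurable_fst. Qed.

Let H0 y : 0 <= H y. Proof. by apply: Rintegral_ge0 => s _. Qed.
Let V0 x : 0 <= V x. Proof. by apply: Rintegral_ge0 => s _. Qed.

Let gfin : (\int[leb2]_(z in hbox a b c d) (g z)%:E = (\int[leb2]_(z in hbox a b c d) g z)%:E)%E.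
Proof.
rewrite /Rintegral fineK//; apply: integrable_fin_num; first exact: hbox_measurable.
exact: continuous_hbox_integrable.
Qed.

Let HintE : (\int[leb2]_(z in hbox a b c d) (H z.2)%:E =
  ((b - a) * \int[leb2]_(z in hbox a b c d) g z)%:E)%E.
Proof.
rewrite tonelli_hbox_yx//; last by move=> z; rewrite lee_fin.
rewrite EFinM -gfin tonelli_hbox_yx//.
rewrite -ge0_integralZl//; last 3 first.
- by apply: eq_measurable_fun (measurable_funTS mH') => y _; rewrite HE.
- by move=> y _; apply: integral_ge0 => x _; rewrite lee_fin.
- by rewrite lee_fin subr_ge0 ltW.
apply: eq_integral => y _; rewrite -HE.
transitivity (\int[leb]_(x in `[a, b[) cst (H y)%:E x)%E; first by [].
by rewrite integral_cst//= lebesgue_measure_itv /= lte_fin ab muleC.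
Qed.

Let VintE : (\int[leb2]_(z in hbox a b c d) (V z.1)%:E =
  ((d - c) * \int[leb2]_(z in hbox a b c d) g z)%:E)%E.
Proof.
rewrite tonelli_hbox_xy//; last by move=> z; rewrite lee_fin.
rewrite EFinM -gfin tonelli_hbox_xy//.
rewrite -ge0_integralZl//; last 3 first.
- by apply: eq_measurable_fun (measurable_funTS mV') => y _; rewrite VE.
- by move=> y _; apply: integral_ge0 => x _; rewrite lee_fin.
- by rewrite lee_fin subr_ge0 ltW.
apply: eq_integral => y _; rewrite -VE.
transitivity (\int[leb]_(x in `[c, d[) cst (V y)%:E x)%E; first by [].
by rewrite integral_cst//= lebesgue_measure_itv /= lte_fin cd muleC.
Qed.

Lemma integrable_slice_x :
  leb2.-integrable (hbox a b c d) (EFin \o (fun z => \int[leb]_(s in `[a, b[) g (s, z.2))).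
Proof.
apply/integrableP; split; first exact: measurable_funTS mH.
under eq_integral => z _ do rewrite gee0_abs ?lee_fin ?(H0 z.2)//.
by rewrite HintE ltry.
Qed.

(** The slice integral does not depend on the first coordinate, and integrating it in that
    coordinate produces the factor [b - a]. *)
Lemma Rintegral_slice_x :
  \int[leb2]_(z in hbox a b c d) (\int[leb]_(s in `[a, b[) g (s, z.2)) =
  (b - a) * \int[leb2]_(z in hbox a b c d) g z.
Proof. by rewrite [LHS]/Rintegral HintE. Qed.

Lemma integrable_slice_y :
  leb2.-integrable (hbox a b c d) (EFin \o (fun z => \int[leb]_(s in `[c, d[) g (z.1, s))).
Proof.
apply/integrableP; split; first exact: measurable_funTS mV.
under eq_integral => z _ do rewrite gee0_abs ?lee_fin ?(V0 z.1)//.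
by rewrite VintE ltry.
Qed.

Lemma Rintegral_slice_y :
  \int[leb2]_(z in hbox a b c d) (\int[leb]_(s in `[c, d[) g (z.1, s)) =
  (d - c) * \int[leb2]_(z in hbox a b c d) g z.
Proof. by rewrite [LHS]/Rintegral VintE. Qed.

End SliceIntegrals.

(** * The Poincare inequality with averages on a square *)

Section PoincareSquare.
Context {R : realType}.
Variables (phi : R * R -> R) (a c l : R).
Hypotheses (l0 : 0 < l) (cphi : continuous phi).
Hypotheses (dphix : forall z, derivable phi z (1, 0)) (cdx : continuous (dx phi)).
Hypotheses (dphiy : forall z, derivable phi z (0, 1)) (cdy : continuous (dy phi)).
Local Notation leb := (@lebesgue_measure R).

Local Notation E := (hbox a (a + l) c (c + l)).
Let X z := dx phi z ^+ 2.
Let Y z := dy phi z ^+ 2.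
Let H y := \int[leb]_(s in `[a, a + l[) X (s, y).
Let V x := \int[leb]_(s in `[c, c + l[) Y (x, s).
Local Notation "'intE' f" := (\int[leb2]_(z in E) f z) (at level 10, f at level 8).

Let cX : continuous X. Proof. by move=> z; apply: cvgM; exact: cdx. Qed.
Let cY : continuous Y. Proof. by move=> z; apply: cvgM; exact: cdy. Qed.

(** The path goes horizontally from [z] to (z'.1, z.2) and then vertically to [z']; [oscillation]
    bounds each leg, and (p + q)^2 <= 2 p^2 + 2 q^2 joins them. *)
Let pointwise z z' : E z -> E z' ->
  (phi z - phi z') ^+ 2 <= 2 * l * H z.2 + 2 * l * V z'.1.
Proof.
case: z => x y; case: z' => x' y' [/= Ix Jy] [/= Ix' Jy'].
have dX s : is_derive (s : R) (1 : R) (fun s => phi (s, y)) (dx phi (s, y)).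
  exact: is_derive_slice_x.
have dY s : is_derive (s : R) (1 : R) (fun s => phi (x', s)) (dy phi (x', s)).
  exact: is_derive_slice_y.
have := oscillation dX (@continuous_slice_x _ _ _ cdx) Ix Ix'.
have := oscillation dY (@continuous_slice_y _ _ _ cdy) Jy Jy'.
rewrite -/(V x') -/(H y).
have := sqr_ge0 ((phi (x, y) - phi (x', y)) - (phi (x', y) - phi (x', y'))).
set u := phi (x, y); set v := phi (x', y); set w := phi (x', y').
by rewrite !expr2; nra.
Qed.

Let mE : measurable E. Proof. exact: hbox_measurable. Qed.
Let Ic (g : R * R -> R) : continuous g -> leb2.-integrable E (EFin \o g).
Proof. exact: continuous_hbox_integrable. Qed.
Let Icst (r : R) : leb2.-integrable E (EFin \o cst r).
Proof. by apply: Ic => z; exact: cvg_cst. Qed.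
Let int_cst (r : R) : intE (cst r) = r * l ^+ 2.
Proof. exact: (Rintegral_hbox_cst a c r l0). Qed.
Let cphi2 : continuous (fun z => phi z ^+ 2).
Proof. by move=> z; apply: cvgM; exact: cphi. Qed.
Let al : a < a + l. Proof. by rewrite ltrDl. Qed.
Let cl : c < c + l. Proof. by rewrite ltrDl. Qed.
Let X0 z : 0 <= X z. Proof. exact: sqr_ge0. Qed.
Let Y0 z : 0 <= Y z. Proof. exact: sqr_ge0. Qed.
Let IH : leb2.-integrable E (EFin \o (fun z => H z.2)).
Proof. exact: integrable_slice_x. Qed.
Let IV : leb2.-integrable E (EFin \o (fun z => V z.1)).
Proof. exact: integrable_slice_y. Qed.
Let HE : intE (fun z => H z.2) = l * intE X.
Proof.
have -> : intE (fun z => H z.2) = (a + l - a) * intE X := Rintegral_slice_x c (c + l) cX X0 al.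
by congr (_ * _); ring.
Qed.
Let VE : intE (fun z => V z.1) = l * intE Y.
Proof.
have -> : intE (fun z => V z.1) = (c + l - c) * intE Y := Rintegral_slice_y a (a + l) cY Y0 cl.
by congr (_ * _); ring.
Qed.

Let Zl (r : R) (g : R * R -> R) : leb2.-integrable E (EFin \o g) ->
  leb2.-integrable E (EFin \o (fun z => r * g z)).
Proof.
by move=> Ig; have := integrableZl mE r Ig; apply: eq_integrable => // z _; rewrite /= EFinM.
Qed.
Let Il (g h : R * R -> R) : leb2.-integrable E (EFin \o g) ->
  leb2.-integrable E (EFin \o h) ->
  leb2.-integrable E (EFin \o (fun z => g z + h z)).
Proof.
by move=> Ig Ih; have := integrableD mE Ig Ih; apply: eq_integrable => // z _; rewrite /= EFinD.
Qed.

Let D (r : R) (g h : R * R -> R) : leb2.-integrable E (EFin \o g) ->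
  leb2.-integrable E (EFin \o h) ->
  intE (fun z => g z + r * h z) = intE g + r * intE h.
Proof.
move=> Ig Ih; apply: etrans (RintegralD mE Ig (Zl r Ih)) _.
by congr (_ + _); exact: RintegralZl.
Qed.

Let le_subst (x y x' y' : R) : x = x' -> y = y' -> x <= y -> x' <= y'.
Proof. by move=> -> ->. Qed.

(** [pointwise] integrated over [z'] in the square, whose area is l^2. *)
Let once z : E z ->
  l ^+ 2 * phi z ^+ 2 + (- 2 * intE phi) * phi z + intE (fun z => phi z ^+ 2) <=
  2 * l ^+ 3 * H z.2 + 2 * l ^+ 2 * intE Y.
Proof.
move=> Ez; have I1 := Ic cphi; have I2 := Ic cphi2.
have eL : intE (fun z' => (cst (phi z ^+ 2) z' + 1 * phi z' ^+ 2) + (- 2 * phi z) * phi z') =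
    phi z ^+ 2 * l ^+ 2 + 1 * intE (fun z => phi z ^+ 2) + (- 2 * phi z) * intE phi.
  apply: etrans (D _ (Il (Icst _) (Zl 1 I2)) I1) _; congr (_ + _).
  by apply: etrans (D _ (Icst _) I2) _; congr (_ + _); exact: int_cst.
have eR : intE (fun z' => cst (2 * l * H z.2) z' + (2 * l) * V z'.1) =
    2 * l * H z.2 * l ^+ 2 + 2 * l * (l * intE Y).
  apply: etrans (D _ (Icst _) IV) _; congr (_ + _ * _); [exact: int_cst|exact: VE].
have : intE (fun z' => (cst (phi z ^+ 2) z' + 1 * phi z' ^+ 2) + (- 2 * phi z) * phi z') <=
    intE (fun z' => cst (2 * l * H z.2) z' + (2 * l) * V z'.1).
  apply: le_Rintegral => //.
  - by apply: Il; [apply: Il => //|]; exact: Zl.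
  - by apply: Il => //; exact: Zl.
  - move=> z' Ez' /=; have := pointwise Ez Ez'; rewrite sqrrB -mulr_natl; lra.
move=> /(le_subst eL eR); set A := intE phi; set B := intE _; set Y' := intE Y.
lra.
Qed.

(** Integrating once more, now over [z], gives 2 l^2 B - 2 A^2 <= 2 l^4 (X' + Y'). The integrals are
    passed as real variables so that the last step is plain arithmetic. *)
Let twice (A B X' Y' : R) : intE phi = A -> intE (fun z => phi z ^+ 2) = B ->
  intE (fun z => H z.2) = l * X' ->
  (forall z, E z -> l ^+ 2 * phi z ^+ 2 + (- 2 * A) * phi z + B <=
    2 * l ^+ 3 * H z.2 + 2 * l ^+ 2 * Y') ->
  B <= (l^-1 * A) ^+ 2 + l ^+ 2 * (X' + Y').
Proof.
move=> eA eB eH once'; have I1 := Ic cphi; have I2 := Ic cphi2.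
have eL : intE (fun z => (cst B z + l ^+ 2 * phi z ^+ 2) + (- 2 * A) * phi z) =
    B * l ^+ 2 + l ^+ 2 * B + (- 2 * A) * A.
  apply: etrans (D _ (Il (Icst _) (Zl (l ^+ 2) I2)) I1) _; congr (_ + _ * _); last exact: eA.
  by apply: etrans (D _ (Icst _) I2) _; congr (_ + _ * _); [exact: int_cst|exact: eB].
have eR : intE (fun z => cst (2 * l ^+ 2 * Y') z + (2 * l ^+ 3) * H z.2) =
    2 * l ^+ 2 * Y' * l ^+ 2 + 2 * l ^+ 3 * (l * X').
  apply: etrans (D _ (Icst _) IH) _; congr (_ + _ * _); [exact: int_cst|exact: eH].
have : intE (fun z => (cst B z + l ^+ 2 * phi z ^+ 2) + (- 2 * A) * phi z) <=
    intE (fun z => cst (2 * l ^+ 2 * Y') z + (2 * l ^+ 3) * H z.2).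
  apply: (le_Rintegral mE).
  - exact: (Il (Il (Icst _) (Zl _ I2)) (Zl _ I1)).
  - exact: (Il (Icst _) (Zl _ IH)).
  - by move=> z /once' /=; lra.
move=> /(le_subst eL eR) H1.
have l20 : 0 < 2 * l ^+ 2 by rewrite mulr_gt0// exprn_gt0.
rewrite -(ler_pM2l l20); move: H1.
have -> : 2 * l ^+ 2 * ((l^-1 * A) ^+ 2 + l ^+ 2 * (X' + Y')) =
  2 * A ^+ 2 + 2 * l ^+ 4 * (X' + Y') by field; rewrite gt_eqF.
rewrite !exprS !expr0; lra.
Qed.

(** The factor [l ^+ 2] of the gradient is not sharp; it only has to become small with the side of
    the square. *)
Lemma poincare_square : intE (fun z => phi z ^+ 2) <=
  (l^-1 * intE phi) ^+ 2 +
  l ^+ 2 * (intE (fun z => dx phi z ^+ 2) + intE (fun z => dy phi z ^+ 2)).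
Proof. exact: (twice erefl erefl HE once). Qed.

End PoincareSquare.

(** * Additivity of the integral over a square grid *)

Section Grid.
Context {R : realType}.
Variable g : R * R -> R.
Hypothesis cg : continuous g.
Implicit Types (a b c d l : R).

Lemma hbox_split_x a b a' c d : a <= b -> b <= a' ->
  \int[leb2]_(z in hbox a a' c d) g z =
  \int[leb2]_(z in hbox a b c d) g z + \int[leb2]_(z in hbox b a' c d) g z.
Proof.
move=> ab ba'.
have E : hbox a a' c d = hbox a b c d `|` hbox b a' c d.
  apply/seteqP; split => -[x y] /=.
    move=> [] /=; rewrite !in_itv /= => /andP[ax xa'] yJ.
    by have [xb|bx] := ltP x b; [left|right]; split => //=; rewrite in_itv /= ?ax ?bx.
  by move=> [] [] /=; rewrite /hbox /= !in_itv /= => /andP[h1 h2] ->; split => //;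
    rewrite ?h1 ?h2 ?(lt_le_trans h2)// (le_trans ab).
rewrite E Rintegral_setU//; [exact: hbox_measurable|exact: hbox_measurable| |].
- by rewrite -E; exact: continuous_hbox_integrable.
- apply/disj_set2P/seteqP; split => -[x y] //= [] [] /= + _ [] /= + _.
  by rewrite !in_itv /= => /andP[_ xb] /andP[bx _]; move: xb; rewrite ltNge bx.
Qed.

Lemma hbox_split_y a b c d c' : c <= d -> d <= c' ->
  \int[leb2]_(z in hbox a b c c') g z =
  \int[leb2]_(z in hbox a b c d) g z + \int[leb2]_(z in hbox a b d c') g z.
Proof.
move=> cd dc'.
have E : hbox a b c c' = hbox a b c d `|` hbox a b d c'.
  apply/seteqP; split => -[x y] /=.
    move=> [] /=; rewrite !in_itv /= => xI /andP[cy yc'].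
    by have [yd|dy] := ltP y d; [left|right]; split => //=; rewrite in_itv /= ?cy ?dy.
  by move=> [] [] /=; rewrite /hbox /= !in_itv /= => -> /andP[h1 h2]; split => //;
    rewrite ?h1 ?h2 ?(lt_le_trans h2)// (le_trans cd).
rewrite E Rintegral_setU//; [exact: hbox_measurable|exact: hbox_measurable| |].
- by rewrite -E; exact: continuous_hbox_integrable.
- apply/disj_set2P/seteqP; split => -[x y] //= [] [] /= _ + [] /= _ +.
  by rewrite !in_itv /= => /andP[_ xb] /andP[bx _]; move: xb; rewrite ltNge bx.
Qed.

Lemma hbox_grid a c l m n : 0 <= l ->
  \int[leb2]_(z in hbox a (a + m%:R * l) c (c + n%:R * l)) g z =
  \sum_(i < m) \sum_(j < n) \int[leb2]_(z in
    hbox (a + i%:R * l) (a + i%:R * l + l) (c + j%:R * l) (c + j%:R * l + l)) g z.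
Proof.
move=> l0; have step (k : nat) : a + k.+1%:R * l = a + k%:R * l + l.
  by rewrite -addrA -[in X in _ + (_ + X)](mul1r l) -mulrDl -natr1.
have step' (k : nat) : c + k.+1%:R * l = c + k%:R * l + l.
  by rewrite -addrA -[in X in _ + (_ + X)](mul1r l) -mulrDl -natr1.
have empty a' b' : \int[leb2]_(z in hbox a' b' c (c + 0%:R * l)) g z = 0.
  rewrite mul0r addr0 (_ : hbox _ _ _ _ = set0) ?Rintegral_set0//.
  apply/seteqP; split => -[x y] // [] /= _; rewrite in_itv /= => /andP[h1 h2].
  by have := le_lt_trans h1 h2; rewrite ltxx.
have strip a' b' : \int[leb2]_(z in hbox a' b' c (c + n%:R * l)) g z =
    \sum_(j < n) \int[leb2]_(z in hbox a' b' (c + j%:R * l) (c + j%:R * l + l)) g z.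
  elim: n => [|n IH]; first by rewrite empty big_ord0.
  rewrite big_ord_recr /= -IH -step'; apply: hbox_split_y.
    by rewrite lerDl mulr_ge0.
  by rewrite step' lerDl.
elim: m => [|m IH].
  rewrite big_ord0 mul0r addr0 (_ : hbox _ _ _ _ = set0) ?Rintegral_set0//.
  apply/seteqP; split => -[x y] // [] /= + _; rewrite in_itv /= => /andP[h1 h2].
  by have := le_lt_trans h1 h2; rewrite ltxx.
rewrite big_ord_recr /= -IH -strip -step; apply: hbox_split_x.
  by rewrite lerDl mulr_ge0.
by rewrite step lerDl.
Qed.

End Grid.

(** * Rellich's inequality on a bounded open set *)

Section Rellich.
Context {R : realType}.
Variable Omega : set (R * R).
Hypotheses (oO : open Omega) (bO : bounded_set Omega).
Local Notation ip := (ip Omega).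
Local Notation L2 := (L2 Omega).
Local Notation test := (test_function Omega).

Let mO : measurable (Omega : set (plane R)) := open_plane_measurable oO.

Definition dirichlet_energy (phi : R * R -> R) : R :=
  ip (dx phi) (dx phi) + ip (dy phi) (dy phi).

Lemma Rintegral_widen (Q : set (plane R)) (f : R * R -> R) : Omega `<=` Q ->
  (forall z, ~ Omega z -> f z = 0) ->
  \int[leb2]_(z in Omega) f z = \int[leb2]_(z in Q) f z.
Proof.
move=> OQ f0; apply: etrans (Rintegral_mkcond _ _ _) _.
apply: etrans _ (esym (Rintegral_mkcond _ _ _)); apply: eq_Rintegral => z _.
rewrite !patchE; case: ifPn => [|]; rewrite ?inE ?notin_setE => zO.
  by rewrite mem_set//; exact: OQ.
by rewrite f0// if_same.
Qed.

Lemma test_offOmega phi a b z : test phi -> ~ Omega z -> pderiv a b phi z = 0.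
Proof.
by move=> /test_support[K [_ KO p0]] nO; apply: p0 => /KO.
Qed.

(** With the scale [l^-1] the squared inner product with [phi] is the area l^2 times the squared
    average of [phi] on the cell, the very term of [poincare_square]. *)
Definition cell_avg (l : R) (q : set (plane R)) : R * R -> R := cst l^-1 \_ q.

Lemma cell_avg_L2 l q : measurable q -> L2 (cell_avg l q).
Proof.
move=> mq; apply: (@bounded_L2 _ _ oO bO _ `|l^-1|).
  apply: measurable_funTS; apply: (measurable_restrictT _ mq).1.
  exact: measurable_cst.
by move=> z _; rewrite /cell_avg patchE; case: ifPn => //; rewrite normr0.
Qed.

Lemma ip_cell_avg phi l q : test phi -> measurable q ->
  ip phi (cell_avg l q) = l^-1 * \int[leb2]_(z in q) phi z.
Proof.
move=> tp mq; have p0 : forall z, ~ Omega z -> phi z = 0.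
  by move=> z; exact: (@test_offOmega _ 0 0 z tp).
have [K [cK KO pK]] := test_support tp.
apply: (@etrans _ _ (\int[leb2]_(z in q) (l^-1 * phi z))).
  apply: etrans (Rintegral_mkcond _ _ _) _.
  apply: etrans _ (esym (Rintegral_mkcond _ _ _)); apply: eq_Rintegral => z _.
  rewrite !patchE /cell_avg patchE; case: ifPn => [|]; rewrite ?inE ?notin_setE => zO.
    by case: ifPn => _; rewrite ?mulr0 1?mulrC.
  by rewrite p0// mulr0 if_same.
apply: (RintegralZl _ mq); apply: (@offK_integrable _ K) => //.
  exact: (pK 0%N 0%N).
exact: (@test_continuous _ _ _ 0 0 tp).
Qed.

(** [poincare_square] summed over a grid. A test function is 0 off [Omega], so the grid covers a
    whole surrounding square and cells that meet the boundary are treated like the others. *)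
Lemma rellich_inequality (e : R) : 0 < e -> exists m (w : 'I_m -> 'I_m -> R * R -> R),
  (forall i j, L2 (w i j)) /\
  forall phi, test phi ->
    ip phi phi <= \sum_(i < m) \sum_(j < m) ip phi (w i j) ^+ 2 +
                  e * dirichlet_energy phi.
Proof.
move=> e0; have [M [M0 OM]] := bounded_sub_cbox bO.
(* [m] exceeds (2M)^2 / e and is at least 1, so l^2 = (2M)^2 / m^2 is at most [e]. *)
pose m := (Num.bound ((2 * M) ^+ 2 / e)).+1; pose l := 2 * M / m%:R.
have m0 : 0 < m%:R :> R by rewrite ltr0n.
have l0 : 0 < l by rewrite divr_gt0// mulr_gt0.
have le_ : l ^+ 2 <= e.
  have h : (2 * M) ^+ 2 / e < m%:R.
    apply: lt_le_trans (archi_boundP _) _; last by rewrite ler_nat.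
    by rewrite divr_ge0 ?sqr_ge0 ?ltW.
  move: h; rewrite ltr_pdivrMr// => h.
  rewrite /l expr_div_n ler_pdivrMr ?exprn_gt0//; apply: (le_trans (ltW h)).
  rewrite mulrC ler_wpM2l ?(ltW e0)// expr2 ler_peMl ?(ltW m0)//.
  by rewrite ler1n.
have ml : - M + m%:R * l = M by rewrite /l; field; rewrite gt_eqF.
pose q (i j : nat) := hbox (- M + i%:R * l) (- M + i%:R * l + l)
                           (- M + j%:R * l) (- M + j%:R * l + l).
have mq i j : measurable (q i j) by exact: hbox_measurable.
exists m, (fun i j => cell_avg l (q i j)); split.
  by move=> i j; exact: cell_avg_L2.
move=> phi tp; have OQ : Omega `<=` hbox (- M) (- M + m%:R * l) (- M) (- M + m%:R * l).
  move=> z /OM; rewrite ml => -[] /=; rewrite !in_itv /= => /andP[? ?] /andP[? ?].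
  by split; rewrite /= in_itv /=; apply/andP; split => //; exact: ltW.
have c0 : continuous phi := @test_continuous _ _ _ 0 0 tp.
have cx : continuous (dx phi) := @test_continuous _ _ _ 1 0 tp.
have cy : continuous (dy phi) := @test_continuous _ _ _ 0 1 tp.
have sq_grid g : continuous g -> (forall z, ~ Omega z -> g z = 0) ->
    ip g g = \sum_(i < m) \sum_(j < m) \int[leb2]_(z in q i j) (g z ^+ 2).
  move=> cg g0; have cg2 : continuous (fun z => g z ^+ 2).
    by move=> z; apply: cvgM; exact: cg.
  apply: etrans (hbox_grid cg2 (- M) (- M) m m (ltW l0)).
  apply: etrans (Rintegral_widen OQ _).
    by apply: eq_Rintegral => z _; rewrite expr2.
  by move=> z nO; rewrite g0// expr0n.
rewrite (sq_grid _ c0); last by move=> z; exact: (@test_offOmega _ 0 0 z tp).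
have Dge0 : 0 <= dirichlet_energy phi by rewrite addr_ge0// ip_ge0.
apply: (@le_trans _ _ (\sum_(i < m) \sum_(j < m) ip phi (cell_avg l (q i j)) ^+ 2 +
   l ^+ 2 * dirichlet_energy phi)); last by rewrite lerD2l ler_wpM2r.
rewrite /dirichlet_energy (sq_grid _ cx); last by move=> z; exact: (@test_offOmega _ 1 0 z tp).
rewrite (sq_grid _ cy); last by move=> z; exact: (@test_offOmega _ 0 1 z tp).
rewrite -big_split /= mulr_sumr -big_split /=; apply: ler_sum => i _.
rewrite -big_split /= mulr_sumr -big_split /=; apply: ler_sum => j _.
have dz v z : derivable phi z v.
  by apply: diff_derivable; exact: (@test_diff _ _ phi 0 0 z tp).
rewrite (ip_cell_avg l tp (mq i j)).
exact: (poincare_square _ _ l0 c0 (dz _) cx (dz _) cy).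
Qed.

Lemma rellich (e : R) : 0 < e -> exists n (w : 'I_n -> R * R -> R),
  (forall i, L2 (w i)) /\
  forall phi, test phi ->
    ip phi phi <= \sum_(i < n) ip phi (w i) ^+ 2 + e * dirichlet_energy phi.
Proof.
move=> /rellich_inequality[m [w [Lw H]]].
exists #|{: 'I_m * 'I_m}|, (fun k => w (enum_val k).1 (enum_val k).2); split=> //.
move=> phi /H; rewrite pair_bigA /= => /le_trans; apply.
by rewrite lerD2r big_enum_val.
Qed.

End Rellich.

(** * Gronwall's lemma *)

Section Gronwall.
Context {R : realType}.

(** exp(k s) (y s - K) has a nonpositive derivative for s > 0; continuity up to 0 brings the initial
    value into the comparison. *)
Lemma gronwall (y y' : R -> R) (k K : R) :
  (forall t, 0 < t -> is_derive (t : R) (1 : R) y (y' t)) ->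
  (forall t, 0 < t -> y' t <= k * (K - y t)) ->
  {within `[0, +oo[, continuous y} ->
  forall t, 0 <= t -> y t <= K + expR (- (k * t)) * (y 0 - K).
Proof.
move=> dy yK cy t t0; pose z s := expR (k * s) * (y s - K).
have dz s : 0 < s -> is_derive (s : R) (1 : R) z (expR (k * s) * (y' s - k * (K - y s))).
  move=> s0; have Dy := dy s s0.
  have D1 : is_derive (s : R) (1 : R) (fun s => k * s) k.
    have D0 := is_deriveZ k (is_derive_id (s : R) (1 : R)).
    by apply: (is_derive_eq D0); rewrite /GRing.scale /= mulr1.
  have D2 := @is_derive1_comp _ expR (fun s : R => k * s) s _ _ (is_derive_expR _) D1.
  have D3 := is_deriveB Dy (is_derive_cst K s (1 : R)).
  apply: (is_derive_eq (is_deriveM D2 D3)).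
  by rewrite /GRing.scale /= !fctE /=; ring.
have H : z t <= z 0.
  apply: (@ler0_derive1_nincry _ z 0) => //.
  - by move=> s; rewrite in_itv /= andbT => s0; have [] := dz s s0.
  - move=> s; rewrite in_itv /= andbT => s0; rewrite derive1E.
    have [_ ->] := dz s s0; rewrite pmulr_rle0 ?expR_gt0// subr_le0; exact: yK.
  - move=> s; apply: cvgM; last by apply: cvgB; [exact: cy|exact: cvg_cst].
    have ce : continuous (fun s : R => expR (k * s)).
      move=> r; apply: continuous_comp; last exact: continuous_expR.
      by apply: cvgMr; exact: cvg_id.
    have cs : {within `[0, +oo[, continuous (fun s : R => expR (k * s))}.
      exact: continuous_subspaceT.
    exact: (cs s).
move: H; rewrite /z mulr0 expR0 mul1r => H.
rewrite -lerBlDl expRN mulrC ler_pdivlMr ?expR_gt0//.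
by rewrite mulrC.
Qed.

End Gronwall.

(** * Finite linear combinations *)

Section Span.
Context {R : realType}.
Variable Omega : set (R * R).
Hypothesis oO : open Omega.
Local Notation ip := (ip Omega).
Local Notation L2 := (L2 Omega).

Let mO : measurable (Omega : set (plane R)) := open_plane_measurable oO.

Lemma L2_sum (I : Type) (r : seq I) (a : I -> R) (f : I -> R * R -> R) :
  (forall i, L2 (f i)) -> L2 (fun z => \sum_(i <- r) a i * f i z).
Proof.
move=> Lf; elim: r => [|i r IH].
  by apply: eq_L2 (L20 mO) => // z _; rewrite big_nil.
by apply: eq_L2 (L2_lin mO (a i) (Lf i) IH) => // z _; rewrite big_cons.
Qed.

Lemma ip_suml (I : Type) (r : seq I) (a : I -> R) (f : I -> R * R -> R) h :
  (forall i, L2 (f i)) -> L2 h ->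
  ip (fun z => \sum_(i <- r) a i * f i z) h = \sum_(i <- r) a i * ip (f i) h.
Proof.
move=> Lf Lh; elim: r => [|i r IH].
  by rewrite big_nil -[RHS](ip0l Omega h); apply: eq_ip => // z _; rewrite big_nil.
rewrite big_cons -IH -(ip_linl mO (a i) (Lf i) (L2_sum r a Lf) Lh).
by apply: eq_ip => // z _; rewrite big_cons.
Qed.

Lemma ip_sumr (I : Type) (r : seq I) (a : I -> R) (f : I -> R * R -> R) h :
  (forall i, L2 (f i)) -> L2 h ->
  ip h (fun z => \sum_(i <- r) a i * f i z) = \sum_(i <- r) a i * ip h (f i).
Proof.
move=> Lf Lh; apply: etrans (ipC _ _ _) _.
apply: etrans (ip_suml r a Lf Lh) _; apply: eq_bigr => i _; congr (_ * _).
exact: ipC.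
Qed.

(** Functions are prescribed on [Omega] only; openness makes derivatives there depend on nothing
    else. *)
Lemma derive_eq_on (f g : R * R -> R) (v : R * R) :
  (forall z, Omega z -> f z = g z) -> forall z, Omega z -> 'D_v f z = 'D_v g z.
Proof.
move=> fg z Oz; apply: near_eq_derive.
by have := open_nbhs_nbhs (conj oO Oz); apply: filterS => y; exact: fg.
Qed.

Lemma derive_span n (a : 'I_n -> R) (e : 'I_n -> R * R -> R) (f : R * R -> R) (v : R * R) :
  (forall z, Omega z -> f z = \sum_(i < n) a i * e i z) ->
  (forall i z, Omega z -> differentiable (e i) z) ->
  forall z, Omega z -> 'D_v f z = \sum_(i < n) a i * 'D_v (e i) z.
Proof.
move=> fE de z Oz; rewrite (derive_eq_on v fE Oz).
have -> : (fun z => \sum_(i < n) a i * e i z) = \sum_(i < n) (a i \*: e i).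
  by apply/funext => y; rewrite fct_sumE.
rewrite derive_sum => [|i]; last first.
  by apply: derivableZ; apply: diff_derivable; exact: de.
by apply: eq_bigr => i _; rewrite deriveZ//; apply: diff_derivable; exact: de.
Qed.

Lemma dx_eq_on (f g : R * R -> R) :
  (forall z, Omega z -> f z = g z) -> forall z, Omega z -> dx f z = dx g z.
Proof. exact: derive_eq_on. Qed.

Lemma dx_span n (a : 'I_n -> R) (e : 'I_n -> R * R -> R) (f : R * R -> R) :
  (forall z, Omega z -> f z = \sum_(i < n) a i * e i z) ->
  (forall i z, Omega z -> differentiable (e i) z) ->
  forall z, Omega z -> dx f z = \sum_(i < n) a i * dx (e i) z.
Proof. exact: derive_span. Qed.

Lemma dy_eq_on (f g : R * R -> R) :
  (forall z, Omega z -> f z = g z) -> forall z, Omega z -> dy f z = dy g z.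
Proof. exact: derive_eq_on. Qed.

Lemma dy_span n (a : 'I_n -> R) (e : 'I_n -> R * R -> R) (f : R * R -> R) :
  (forall z, Omega z -> f z = \sum_(i < n) a i * e i z) ->
  (forall i z, Omega z -> differentiable (e i) z) ->
  forall z, Omega z -> dy f z = \sum_(i < n) a i * dy (e i) z.
Proof. exact: derive_span. Qed.

End Span.

(** * Quadratic forms along differentiable curves *)

Section QuadraticForm.
Context {R : realType}.
Variables (n : nat) (G : 'I_n -> 'I_n -> R).
Hypothesis Gsym : forall i j, G i j = G j i.

(** [G] will be the Gram matrix of the gradients of a spanning family. The energy of a curve is then
    a polynomial in its coordinates, and its time derivative needs no exchange with an integral. *)
Definition qform (a b : 'I_n -> R) : R := \sum_(i < n) a i * \sum_(j < n) b j * G i j.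

Lemma qform_sym a b : qform a b = qform b a.
Proof.
rewrite /qform; under eq_bigr do rewrite mulr_sumr.
rewrite exchange_big /=; apply: eq_bigr => j _; rewrite mulr_sumr.
by apply: eq_bigr => i _; rewrite (Gsym i j); ring.
Qed.

Lemma is_derive_qform (c : 'I_n -> R -> R) (t : R) :
  (forall i, derivable (c i) t 1) ->
  is_derive (t : R) (1 : R) (fun s => qform (c ^~ s) (c ^~ s))
    (2 * qform (fun i => derive1 (c i) t) (c ^~ t)).
Proof.
move=> dc; have Dc i : is_derive (t : R) (1 : R) (c i) (derive1 (c i) t).
  by rewrite derive1E; exact/derivableP.
have Dr i : is_derive (t : R) (1 : R) (fun s => \sum_(j < n) c j s * G i j)
    (\sum_(j < n) derive1 (c j) t * G i j).
  have -> : (fun s => \sum_(j < n) c j s * G i j) = \sum_(j < n) (G i j \*: c j).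
    by apply/funext => s; rewrite fct_sumE; apply: eq_bigr => j _; rewrite mulrC.
  have H0 := is_derive_sum (fun j => is_deriveZ (G i j) (Dc j)).
  apply: (is_derive_eq H0).
  by apply: eq_bigr => j _; rewrite /GRing.scale /= mulrC.
have -> : (fun s => qform (c ^~ s) (c ^~ s)) =
    \sum_(i < n) (fun s => c i s * \sum_(j < n) c j s * G i j).
  by apply/funext => s; rewrite fct_sumE.
have H : is_derive (t : R) (1 : R)
    (\sum_(i < n) (fun s => c i s * \sum_(j < n) c j s * G i j))
    (\sum_(i < n) (c i t * \sum_(j < n) derive1 (c j) t * G i j +
       (\sum_(j < n) c j t * G i j) * derive1 (c i) t)).
  exact: (is_derive_sum (fun i => is_deriveM (Dc i) (Dr i))).
apply: (is_derive_eq H); rewrite big_split /=.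
rewrite -/(qform (c ^~ t) (fun i => derive1 (c i) t)) qform_sym mulr_natl mulr2n; congr (_ + _).
by apply: eq_bigr => i _; rewrite mulrC.
Qed.

Lemma continuous_qform (A : set R) (c : 'I_n -> R -> R) :
  (forall i, {within A, continuous (c i)}) ->
  {within A, continuous (fun s => qform (c ^~ s) (c ^~ s))}.
Proof.
have csum (h : 'I_n -> R -> R) : (forall i, {within A, continuous (h i)}) ->
    {within A, continuous (fun s => \sum_(i < n) h i s)}.
  move=> ch; apply: continuous_big => [x|i _]; last exact: ch.
  by apply: cvgD; [exact: cvg_fst|exact: cvg_snd].
move=> cc; have cin i : {within A, continuous (fun s => \sum_(j < n) c j s * G i j)}.
  by apply: (csum (fun j s => c j s * G i j)) => j s; apply: cvgMl; exact: cc.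
by apply: csum => i s; apply: cvgM; [exact: cc|exact: cin].
Qed.

End QuadraticForm.

(** * The ground state of the Dirichlet Laplacian *)

(* Otherwise unification compares the directions (1, 0) and (0, 1) by unfolding
   the ring structure of R. *)
Local Opaque ip dx dy.

(** * Cluster points of bounded vectors *)

Section ConvergingSubsequence.
Context {R : realType}.

(** Compactness of a cube. The cluster point is stated through arbitrarily late visits, so that
    further conditions on the index can be imposed when it is chosen. *)
Lemma bounded_vectors_cluster (n : nat) (v : nat -> 'I_n -> R) (C : R) :
  (forall k i, `|v k i| <= C) -> exists p : 'I_n -> R,
  forall (e : R) N, 0 < e -> exists2 k, (N <= k)%N & forall i, `|v k i - p i| < e.
Proof.
move=> vC; have cC : compact [set r : 'rV[R]_n | forall i, `[- C, C]%classic (r ord0 i)].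
  by apply: (@rV_compact R n (fun=> `[- C, C]%classic)) => i; exact: segment_compact.
pose V k : 'rV[R]_n := \row_i v k i.
have [|p [_ Hp]] := cC (V @ \oo) _.
  by exists 0%N => // k _ i; rewrite /= in_itv /= mxE -ler_norml.
exists (fun i => p ord0 i) => e N e0.
have [|_ [[k Nk <-] kp]] := Hp (V @` [set k | (N <= k)%N]) (ball p e) _ (nbhsx_ballx _ _ e0).
  by exists N => // k /= Nk; exists k.
exists k => // i; have := kp.2 ord0 i.
by rewrite /ball /= mxE distrC.
Qed.

End ConvergingSubsequence.

(** * Minimizing sequences of the Dirichlet energy *)

Section Minimizer.
Context {R : realType}.
Variable Omega : set (R * R).
Hypotheses (oO : open Omega) (bO : bounded_set Omega).
Local Notation ip := (ip Omega).
Local Notation norm2 := (norm2 Omega).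
Local Notation L2 := (L2 Omega).
Local Notation test := (test_function Omega).
Local Notation energy := (dirichlet_energy Omega).
Local Notation wD := (wD Omega).
Implicit Types (phi psi u w : R * R -> R).

Let mO : measurable (Omega : set (plane R)) := open_plane_measurable oO.
Let L2t phi : test phi -> L2 phi. Proof. by move/(test_L2 oO bO 0 0). Qed.
Let L2x phi : test phi -> L2 (dx phi). Proof. by move/(test_L2 oO bO 1 0). Qed.
Let L2y phi : test phi -> L2 (dy phi). Proof. by move/(test_L2 oO bO 0 1). Qed.

Lemma dx_lin (c : R) phi psi : test phi -> test psi ->
  dx (fun z => c * phi z + psi z) = (fun z => c * dx phi z + dx psi z).
Proof. by move=> tp tq; exact: (pderiv_lin c 1 0 tp tq). Qed.

Lemma dy_lin (c : R) phi psi : test phi -> test psi ->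
  dy (fun z => c * phi z + psi z) = (fun z => c * dy phi z + dy psi z).
Proof. by move=> tp tq; exact: (pderiv_lin c 0 1 tp tq). Qed.

Definition energy2 phi psi : R := ip (dx phi) (dx psi) + ip (dy phi) (dy psi).

Let regroup (c a1 b1 d1 a2 b2 d2 : R) :
  (c ^+ 2 * a1 + 2 * c * b1 + d1) + (c ^+ 2 * a2 + 2 * c * b2 + d2) =
  c ^+ 2 * (a1 + a2) + 2 * c * (b1 + b2) + (d1 + d2).
Proof. ring. Qed.

Lemma energy_lin (c : R) phi psi : test phi -> test psi ->
  energy (fun z => c * phi z + psi z) =
  c ^+ 2 * energy phi + 2 * c * energy2 phi psi + energy psi.
Proof.
move=> tp tq; rewrite /dirichlet_energy dx_lin// dy_lin//.
exact: etrans (congr2 +%R (ip_sqr_lin mO c (L2x tp) (L2x tq))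
  (ip_sqr_lin mO c (L2y tp) (L2y tq))) (regroup _ _ _ _ _ _ _).
Qed.

Lemma energy_ge0 phi : 0 <= energy phi.
Proof. by rewrite addr_ge0// ip_ge0. Qed.

Lemma test_scale (c : R) phi : test phi -> test (fun z => c * phi z).
Proof.
move=> tp; rewrite (_ : (fun z => _) = (fun z => (c - 1) * phi z + phi z)).
  exact: test_lin.
by apply/funext => z; ring.
Qed.

Lemma energy_scale (c : R) phi : test phi ->
  energy (fun z => c * phi z) = c ^+ 2 * energy phi.
Proof.
move=> tp; rewrite (_ : (fun z => _) = (fun z => (c - 1) * phi z + phi z)).
  rewrite energy_lin// (_ : energy2 phi phi = energy phi)//.
  by move: (energy phi) => x; ring.
by apply/funext => z; ring.
Qed.

Variable phi0 : R * R -> R.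
Hypotheses (tphi0 : test phi0) (phi0_gt0 : 0 < ip phi0 phi0).

Let S : set R := [set energy phi | phi in [set phi | test phi /\ ip phi phi = 1]].

Definition ground_energy : R := inf S.
Local Notation lam := ground_energy.

Let normalize phi : test phi -> 0 < ip phi phi -> S (energy phi / ip phi phi).
Proof.
move=> tp p0; set c := (Num.sqrt (ip phi phi))^-1.
have c2 : c ^+ 2 = (ip phi phi)^-1 by rewrite exprVn sqr_sqrtr// ltW.
exists (fun z => c * phi z); last by rewrite energy_scale// c2 mulrC.
split; first exact: test_scale.
have Lp := L2t tp; have Lcp : L2 (fun z => c * phi z) by exact: L2Z.
by rewrite ipZl// ipZr// mulrA -expr2 c2 mulVf// gt_eqF.
Qed.

Let S_lb : has_lbound S.
Proof. by exists 0 => _ [phi _ <-]; exact: energy_ge0. Qed.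

Let S_inf : has_inf S.
Proof. by split => //; exists (energy phi0 / ip phi0 phi0); exact: normalize. Qed.

Lemma ground_energy_ge0 : 0 <= lam.
Proof.
apply: lb_le_inf; first by case: S_inf.
by move=> _ [phi _ <-]; exact: energy_ge0.
Qed.

Lemma ground_energy_le phi : test phi -> lam * ip phi phi <= energy phi.
Proof.
move=> tp; have := ip_ge0 Omega phi; rewrite le_eqVlt => /orP[/eqP <-|p0].
  by rewrite mulr0 energy_ge0.
rewrite -ler_pdivlMr//; apply: ge_inf; first by case: S_inf.
exact: normalize.
Qed.

Lemma minimizing_sequence : exists phi : nat -> R * R -> R, forall n,
  [/\ test (phi n), ip (phi n) (phi n) = 1 & energy (phi n) < lam + n.+1%:R^-1].
Proof.
have ex n : exists phi, [/\ test phi, ip phi phi = 1 & energy phi < lam + n.+1%:R^-1].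
  have n0 : 0 < n.+1%:R^-1 :> R by rewrite invr_gt0 ltr0n.
  by have [_ [phi [tp p1] <-] H] := inf_adherent n0 S_inf; exists phi.
by have [phi Hphi] := choice ex; exists phi.
Qed.

(* The parallelogram identity turns near-minimality into smallness of the
   energy of a difference, up to its L^2 norm. *)
Lemma near_minimizers phi psi d : test phi -> test psi ->
  ip phi phi = 1 -> ip psi psi = 1 ->
  energy phi <= lam + d -> energy psi <= lam + d ->
  energy (fun z => -1 * phi z + psi z) <=
  4 * d + lam * ip (fun z => -1 * phi z + psi z) (fun z => -1 * phi z + psi z).
Proof.
move=> tp tq p1 q1 ep eq.
have := ground_energy_le (test_lin 1 tp tq).
rewrite !energy_lin// !(ip_sqr_lin mO _ (L2t tp) (L2t tq)) p1 q1.
move: (energy phi) (energy psi) (energy2 phi psi) (ip phi psi) lam ep eq.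
move=> a b c x L; lra.
Qed.

(** The shape [c * phi + psi] with [c = -1] makes the lemmas on linear combinations of test
    functions apply as they stand. *)
Definition increment (phi : nat -> R * R -> R) (k : nat) (z : R * R) : R :=
  -1 * phi k z + phi k.+1 z.

Lemma minimizing_subsequence : exists phi : nat -> R * R -> R,
  [/\ forall k, test (phi k), forall k, ip (phi k) (phi k) = 1,
      (fun k => energy (phi k)) @ \oo --> lam &
      forall k, ip (increment phi k) (increment phi k) + energy (increment phi k)
        <= (2^-1 ^+ k) ^+ 2].
Proof.
have [phi Hphi] := minimizing_sequence.
have tphi n : test (phi n) by case: (Hphi n).
have phi1 n : ip (phi n) (phi n) = 1 by case: (Hphi n).
have ephi n : energy (phi n) < lam + n.+1%:R^-1 by case: (Hphi n).
(* This [e] makes both [e * lam] and [e] at most 1/2. *)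
have l0 := ground_energy_ge0; set e := (2 * (lam + 1))^-1.
have e0 : 0 < e by rewrite invr_gt0; lra.
have [m [w [Lw rel]]] := rellich oO bO e0.
have [p Hp] : exists p : 'I_m -> R, forall (e : R) N, 0 < e ->
    exists2 k, (N <= k)%N & forall i, `|ip (phi k) (w i) - p i| < e.
  apply: (@bounded_vectors_cluster _ _ _ (\sum_(i < m) norm2 (w i))) => k i.
  apply: le_trans (ip_le_norm2 mO (L2t (tphi k)) (Lw i)) _.
  rewrite /Defs.norm2 phi1 sqrtr1 mul1r -/(norm2 (w i)) (bigD1 i)//= lerDl.
  by apply: sumr_ge0 => j _; exact: norm2_ge0.
(* Threshold for the excess energy and for the moments. The estimates below give at most 12 [s k]
   times [m.+1%:R * (lam + 1)], which the factor 32 covers. *)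
pose s k : R := (2^-1 ^+ k) ^+ 2 / (32 * m.+1%:R * (lam + 1)).
have m1 : 1 <= m.+1%:R :> R by rewrite ler1n.
have D1 : 1 <= 32 * m.+1%:R * (lam + 1) by nra.
have h0 k : 0 < (2^-1 ^+ k) ^+ 2 :> R by rewrite !exprn_gt0.
have h1 k : 2^-1 ^+ k <= 1 :> R by apply: exprn_ile1 => //; lra.
have s0 k : 0 < s k by rewrite divr_gt0//; lra.
have s1 k : s k <= 1.
  rewrite ler_pdivrMr; last lra.
  by rewrite mul1r; apply: le_trans D1; rewrite exprn_ile1// ?exprn_ge0// h1.
have sS k : s k.+1 <= s k.
  rewrite ler_pM2r ?invr_gt0; last lra.
  rewrite lerXn2r ?nnegrE ?exprn_ge0// exprS ler_piMl ?exprn_ge0//; lra.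
pose Q (k n : nat) := (n.+1%:R^-1 <= s k) /\ forall i, `|ip (phi n) (w i) - p i| < s k.
have /choice[nk Hnk] : forall k, exists n, Q k n.
  move=> k; pose N := Num.bound (s k)^-1.
  have [n Nn Hn] := Hp (s k) N (s0 k); exists n; split => //.
  rewrite -[leRHS]invrK lef_pV2 ?posrE ?invr_gt0 ?ltr0n ?s0//.
  apply: le_trans (ltW (archi_boundP _)) _; first by rewrite invr_ge0 ltW.
  by rewrite ler_nat; exact: leq_trans Nn _.
exists (fun k => phi (nk k)); split => //.
  apply: (squeeze_cvgr (f := cst lam) (h := fun k => lam + s k)).
  - apply: nearW => k; rewrite (le_trans _ (ground_energy_le (tphi _))) ?phi1 ?mulr1//=.
    by rewrite (le_trans (ltW (ephi _)))// lerD2l; case: (Hnk k).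
  - exact: cvg_cst.
  - rewrite -[X in _ --> X]addr0; apply: cvgD; first exact: cvg_cst.
    rewrite -[X in _ --> X](mul0r (32 * m.+1%:R * (lam + 1))^-1); apply: cvgMl.
    rewrite -[X in _ --> X](mul0r (0 : R)); apply: cvgM;
      by apply: cvg_expr; rewrite ger0_norm//; lra.
move=> k; pose a := phi (nk k); pose b := phi (nk k.+1).
have ta : test a := tphi _; have tb : test b := tphi _.
pose f := increment (fun k => phi (nk k)) k; rewrite -/f.
have tf : test f by exact: (test_lin (-1) ta tb).
have ef : energy f <= 4 * s k + lam * ip f f.
  apply: (near_minimizers ta tb (phi1 _) (phi1 _));
    apply: (le_trans (ltW (ephi _))); rewrite lerD2l.
    by case: (Hnk k).
  by apply: le_trans (sS k); case: (Hnk k.+1).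
(* Both moments are within [s k] of [p i], since [s] decreases, so the square is below 4 (s k)^2,
   and [s k <= 1]. *)
have wf i : ip f (w i) ^+ 2 <= 4 * s k.
  have -> : ip f (w i) = (ip b (w i) - p i) - (ip a (w i) - p i).
    apply: etrans (ip_linl mO (-1) (L2t ta) (L2t tb) (Lw i)) _.
    by move: (ip a (w i)) (ip b (w i)) (p i) => x y z; ring.
  have := (Hnk k).2 i; have := lt_le_trans ((Hnk k.+1).2 i) (sS k).
  rewrite -/a -/b !ltr_norml; set x := _ - p i; set y := _ - p i => /andP[? ?] /andP[? ?].
  by have := s1 k; have := s0 k; rewrite expr2; nra.
have Sf : \sum_(i < m) ip f (w i) ^+ 2 <= m%:R * (4 * s k).
  apply: (@le_trans _ _ (\sum_(i < m) 4 * s k)); first exact: ler_sum.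
  by rewrite sumr_const card_ord -[X in X <= _]mulr_natl.
have := le_trans (rel _ tf) (lerD Sf (ler_wpM2l (ltW e0) ef)).
set x := ip f f => H.
have x0 : 0 <= x by exact: ip_ge0.
have elam : e * lam <= 2^-1 by rewrite /e mulrC ler_pdivrMr; lra.
have e12 : e <= 2^-1 by rewrite /e lef_pV2 ?posrE; lra.
have H2 : x <= 8 * m.+1%:R * s k.
  have E1 : e * (4 * s k) <= 2^-1 * (4 * s k) by rewrite ler_wpM2r//; have := s0 k; lra.
  have E2 : e * lam * x <= 2^-1 * x by rewrite ler_wpM2r.
  have {}H : x <= m%:R * (4 * s k) + (e * (4 * s k) + e * lam * x).
    by rewrite -mulrA -mulrDr.
  have := s0 k; rewrite -natr1; lra.
have -> : (2^-1 ^+ k) ^+ 2 = s k * (32 * m.+1%:R * (lam + 1)).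
  by rewrite /s divfK// gt_eqF// (lt_le_trans ltr01 D1).
have E3 : (lam + 1) * x <= (lam + 1) * (8 * m.+1%:R * s k) by rewrite ler_wpM2l//; lra.
apply: (@le_trans _ _ ((lam + 1) * x + 4 * s k)); first by move: ef; rewrite -/x; lra.
have E4 : s k <= s k * (m.+1%:R * (lam + 1)).
  rewrite ler_peMr ?(ltW (s0 k))//; nra.
move: E3 E4; set M := m.+1%:R; set L := lam + 1; set t := s k => E3 E4.
have -> : t * (32 * M * L) = 32 * (t * (M * L)) by ring.
have : L * (8 * M * t) = 8 * (t * (M * L)) by ring.
have : 0 < t by exact: s0.
lra.
Qed.

End Minimizer.

(** * The ground state as a limit in H^1 *)

Section GroundState.
Context {R : realType}.
Variable Omega : set (R * R).
Hypotheses (oO : open Omega) (bO : bounded_set Omega).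
Local Notation ip := (ip Omega).
Local Notation norm2 := (norm2 Omega).
Local Notation L2 := (L2 Omega).
Local Notation test := (test_function Omega).
Local Notation energy := (dirichlet_energy Omega).
Local Notation wD := (wD Omega).
Local Notation weak_deriv := (weak_deriv Omega).
Implicit Types (phi psi u w : R * R -> R).

Let mO : measurable (Omega : set (plane R)) := open_plane_measurable oO.
Let L2t phi : test phi -> L2 phi. Proof. by move/(test_L2 oO bO 0 0). Qed.
Let L2x phi : test phi -> L2 (dx phi). Proof. by move/(test_L2 oO bO 1 0). Qed.
Let L2y phi : test phi -> L2 (dy phi). Proof. by move/(test_L2 oO bO 0 1). Qed.

Definition L2_cvg (f : nat -> R * R -> R) (g : R * R -> R) :=
  (fun k => norm2 (fun z => f k z - g z)) @ \oo --> (0 : R).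

Lemma L2_cvg_cst g : L2_cvg (fun=> g) g.
Proof.
rewrite /L2_cvg (_ : (fun _ => _) = cst 0); first exact: cvg_cst.
apply/funext => k; rewrite (@eq_norm2 _ _ _ (cst 0)); last by move=> z _ /=; rewrite subrr.
by rewrite /Defs.norm2 ip0l sqrtr0.
Qed.

Definition H1_limit (phi : nat -> R * R -> R) (u g1 g2 : R * R -> R) :=
  [/\ forall k, test (phi k), [/\ L2 u, L2 g1 & L2 g2], L2_cvg phi u,
      L2_cvg (fun k => dx (phi k)) g1 & L2_cvg (fun k => dy (phi k)) g2].

Section Limits.
Variables (phi : nat -> R * R -> R) (u g1 g2 : R * R -> R).
Hypothesis lim : H1_limit phi u g1 g2.

Let tphi k : test (phi k). Proof. by case: lim. Qed.
Let Lu : L2 u. Proof. by case: lim => _ []. Qed.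
Let L1 : L2 g1. Proof. by case: lim => _ []. Qed.
Let L2' : L2 g2. Proof. by case: lim => _ []. Qed.

Lemma limit_ip psi : L2 psi -> (fun k => ip (phi k) psi) @ \oo --> ip u psi.
Proof.
move=> Lp; apply: (ip_cvg mO (gn := fun=> psi)) => //;
  [by move=> k; exact: L2t| |exact: L2_cvg_cst].
by case: lim.
Qed.

Lemma limit_ip_dx psi : L2 psi -> (fun k => ip (dx (phi k)) psi) @ \oo --> ip g1 psi.
Proof.
move=> Lp; apply: (ip_cvg mO (gn := fun=> psi)) => //;
  [by move=> k; exact: L2x| |exact: L2_cvg_cst].
by case: lim.
Qed.

Lemma limit_ip_dy psi : L2 psi -> (fun k => ip (dy (phi k)) psi) @ \oo --> ip g2 psi.
Proof.
move=> Lp; apply: (ip_cvg mO (gn := fun=> psi)) => //;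
  [by move=> k; exact: L2y| |exact: L2_cvg_cst].
by case: lim.
Qed.

Lemma limit_weak00 : weak_deriv 0 0 u u.
Proof. by split => // psi tp; rewrite expr0 mul1r. Qed.

(** For each test function both sides of the integration by parts for [phi k] converge, and limits
    are unique. *)
Lemma limit_weak10 : weak_deriv 1 0 u g1.
Proof.
split => // psi tp; rewrite expr1 mulN1r.
have e1 := limit_ip (L2x tp).
have e2 : (fun k => - ip (dx (phi k)) psi) @ \oo --> - ip g1 psi.
  exact: cvgN (limit_ip_dx (L2t tp)).
have e3 : (fun k => - ip (dx (phi k)) psi) = (fun k => ip (phi k) (dx psi)).
  apply/funext => k.
  rewrite (ibp_x tp) ?opprK// => z _; first exact: (test_diff 0 0 z (tphi k)).
  exact: (@test_continuous _ _ _ 1 0 (tphi k)).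
by rewrite e3 in e2; exact: (cvg_unique _ e1 e2).
Qed.

Lemma limit_weak01 : weak_deriv 0 1 u g2.
Proof.
split => // psi tp; rewrite expr1 mulN1r.
have e1 := limit_ip (L2y tp).
have e2 : (fun k => - ip (dy (phi k)) psi) @ \oo --> - ip g2 psi.
  exact: cvgN (limit_ip_dy (L2t tp)).
have e3 : (fun k => - ip (dy (phi k)) psi) = (fun k => ip (phi k) (dy psi)).
  apply/funext => k.
  rewrite (ibp_y tp) ?opprK// => z _; first exact: (test_diff 0 0 z (tphi k)).
  exact: (@test_continuous _ _ _ 0 1 (tphi k)).
by rewrite e3 in e2; exact: (cvg_unique _ e1 e2).
Qed.

Lemma limit_Hspace : Hspace Omega 1 u.
Proof.
split => // -[|[|a]] [|[|b]] //= _;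
  [by exists u; exact: limit_weak00|by exists g2; exact: limit_weak01|
   by exists g1; exact: limit_weak10].
Qed.

Lemma limit_wD10 : L2 (wD 1 0 u) /\ norm2 (fun z => wD 1 0 u z - g1 z) = 0.
Proof.
have H : weak_deriv 1 0 u (wD 1 0 u) by apply: wDP; exists g1; exact: limit_weak10.
by split; [case: H|exact: weak_deriv_unique H limit_weak10].
Qed.

Lemma limit_wD01 : L2 (wD 0 1 u) /\ norm2 (fun z => wD 0 1 u z - g2 z) = 0.
Proof.
have H : weak_deriv 0 1 u (wD 0 1 u) by apply: wDP; exists g2; exact: limit_weak01.
by split; [case: H|exact: weak_deriv_unique H limit_weak01].
Qed.

Let approx (e : R) (f : nat -> R * R -> R) w g : 0 < e -> L2 w -> L2 g ->
  (forall k, L2 (f k)) -> norm2 (fun z => w z - g z) = 0 -> L2_cvg f g ->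
  \forall k \near \oo, norm2 (fun z => w z - f k z) < e.
Proof.
move=> e0 Lw Lg Lf wg fg; have : \forall k \near \oo, norm2 (fun z => f k z - g z) < e.
  move/cvgrPdist_lt : fg => /(_ _ e0); apply: filterS => k.
  by rewrite sub0r normrN; apply: le_lt_trans; exact: ler_norm.
apply: filterS => k; apply: le_lt_trans.
apply: le_trans (norm2_triB mO Lw Lg (Lf k)) _.
by rewrite wg add0r norm2_distC.
Qed.

(** The sequence itself supplies the approximating test functions; uniqueness of weak derivatives
    exchanges [g1] and [g2] for the chosen [wD]. *)
Lemma limit_H0space : H0space Omega 1 u.
Proof.
split; first exact: limit_Hspace.
move=> e e0; have [_ _ c0 c1 c2] := lim.
have w00 : weak_deriv 0 0 u (wD 0 0 u) by apply: wDP; exists u; exact: limit_weak00.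
have [W1 W1'] := limit_wD10; have [W2 W2'] := limit_wD01.
have Lw0 : L2 (wD 0 0 u) by case: w00.
have A0 := approx e0 Lw0 Lu (fun k => L2t (tphi k))
  (weak_deriv_unique oO bO w00 limit_weak00) c0.
have A1 := approx e0 W1 L1 (fun k => L2x (tphi k)) W1' c1.
have A2 := approx e0 W2 L2' (fun k => L2y (tphi k)) W2' c2.
have [k _ /(_ _ (leqnn _)) [h0 [h1 h2]]] := filterI A0 (filterI A1 A2).
exists (phi k); first exact: tphi.
move=> a b; case: a => [|[|a]]; case: b => [|[|b]] ab; try (clear -ab; by move: ab).
- exact: h0.
- exact: h2.
- exact: h1.
Qed.

End Limits.

Lemma H0_approx m w : H0space Omega m w -> exists psi : nat -> R * R -> R,
  (forall k, test (psi k)) /\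
  forall a b, (a + b <= m)%N ->
    L2 (wD a b w) /\ L2_cvg (fun k => pderiv a b (psi k)) (wD a b w).
Proof.
move=> [[Lw Hw] app].
have ex (k : nat) : exists psi, test psi /\ forall a b, (a + b <= m)%N ->
    norm2 (fun z => wD a b w z - pderiv a b psi z) < k.+1%:R^-1.
  have k0 : 0 < k.+1%:R^-1 :> R by rewrite invr_gt0 ltr0n.
  by have [psi ? ?] := app _ k0; exists psi.
have [psi Hpsi] := choice ex; exists psi; split; first by move=> k; case: (Hpsi k).
move=> a b ab; split; first by have [] := wDP (Hw a b ab).
apply: (squeeze_cvgr (f := cst 0) (h := fun k => k.+1%:R^-1)).
- apply: nearW => k; rewrite norm2_ge0 norm2_distC ltW//.
  by case: (Hpsi k) => _; apply.
- exact: cvg_cst.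
- exact: cvg_harmonic.
Qed.

(** Even at order 0, [wD] is a chosen representative and may differ from [w] on a null set. *)
Lemma wD00 w : H0space Omega 1 w -> norm2 (fun z => w z - wD 0 0 w z) = 0.
Proof.
move=> [[Lw _] _]; have W : weak_deriv 0 0 w w by split => // psi tp; rewrite expr0 mul1r.
by apply: (weak_deriv_unique oO bO W); apply: wDP; exists w.
Qed.

Variable phi0 : R * R -> R.
Hypotheses (tphi0 : test phi0) (phi0_gt0 : 0 < ip phi0 phi0).
Local Notation lam := (ground_energy Omega).

Let sqr_bound (x y : R) : 0 <= x -> 0 <= y -> x ^+ 2 <= y ^+ 2 -> x <= y.
Proof. by move=> x0 y0; rewrite ler_pXn2r ?nnegrE. Qed.

(** The bound on the increments controls values and both partial derivatives, so [L2_complete]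
    applies to three sequences separately. *)
Lemma ground_state : exists (phi : nat -> R * R -> R) u g1 g2,
  [/\ H1_limit phi u g1 g2, forall k, ip (phi k) (phi k) = 1 &
      (fun k => energy (phi k)) @ \oo --> lam].
Proof.
have [phi [tphi phi1 ephi inc]] := minimizing_subsequence oO bO tphi0 phi0_gt0.
have h0 k : 0 <= 2^-1 ^+ k :> R by rewrite exprn_ge0.
have tinc k : test (increment phi k) by exact: (test_lin (-1) (tphi k) (tphi k.+1)).
have ipx k := ip_ge0 Omega (dx (increment phi k)).
have ipy k := ip_ge0 Omega (dy (increment phi k)).
have ip0 k := ip_ge0 Omega (increment phi k).
have [u Lu cu] : exists2 h, L2 h & L2_cvg phi h.
  apply: (L2_complete oO bO) => [k|k]; first exact: L2t.
  apply: sqr_bound; rewrite ?norm2_ge0//; apply: le_trans (inc k).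
  rewrite (@eq_norm2 _ _ _ (increment phi k)); last first.
    by move=> z _; rewrite /increment; ring.
  rewrite norm2_sq lerDl; exact: addr_ge0.
have [g1 Lg1 cg1] : exists2 h, L2 h & L2_cvg (fun k => dx (phi k)) h.
  apply: (L2_complete oO bO) => [k|k]; first exact: L2x.
  apply: sqr_bound; rewrite ?norm2_ge0//; apply: le_trans (inc k).
  rewrite (@eq_norm2 _ _ _ (dx (increment phi k))); last first.
    by move=> z _; rewrite /increment (dx_lin _ (tphi k) (tphi k.+1)); ring.
  rewrite norm2_sq /dirichlet_energy addrCA lerDl; exact: addr_ge0.
have [g2 Lg2 cg2] : exists2 h, L2 h & L2_cvg (fun k => dy (phi k)) h.
  apply: (L2_complete oO bO) => [k|k]; first exact: L2y.
  apply: sqr_bound; rewrite ?norm2_ge0//; apply: le_trans (inc k).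
  rewrite (@eq_norm2 _ _ _ (dy (increment phi k))); last first.
    by move=> z _; rewrite /increment (dy_lin _ (tphi k) (tphi k.+1)); ring.
  rewrite norm2_sq /dirichlet_energy addrA lerDr; exact: addr_ge0.
by exists phi, u, g1, g2.
Qed.

(** At [t = - B / (|A| + 1)] the expression would be negative unless [B] is 0; the denominator is
    positive whatever the sign of [A]. *)
Let quad0 (A B : R) : (forall t : R, 0 <= t ^+ 2 * A + 2 * t * B) -> B = 0.
Proof.
move=> H; apply/eqP; apply: contraT => B0.
have D0 : 0 < `|A| + 1 by rewrite ltr_wpDl.
have D : `|A| + 1 != 0 by rewrite gt_eqF.
have := H (- B / (`|A| + 1)).
have -> : (- B / (`|A| + 1)) ^+ 2 * A + 2 * (- B / (`|A| + 1)) * B =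
   B ^+ 2 * (A - 2 * (`|A| + 1)) / (`|A| + 1) ^+ 2 by field.
rewrite pmulr_lge0 ?invr_gt0 ?exprn_gt0// pmulr_rge0 ?exprn_even_gt0//.
have := ler_norm A; have := normr_ge0 A; lra.
Qed.

(** The limit is not a test function, so minimality is applied to t psi + phi k; letting k grow then
    removes the constant term and leaves a form to which [quad0] applies. *)
Lemma euler_lagrange (phi : nat -> R * R -> R) u g1 g2 psi : H1_limit phi u g1 g2 ->
  (forall k, ip (phi k) (phi k) = 1) ->
  (fun k => energy (phi k)) @ \oo --> lam -> test psi ->
  ip g1 (dx psi) + ip g2 (dy psi) = lam * ip u psi.
Proof.
move=> lim phi1 ephi tp; have tphi k : test (phi k) by case: lim.
apply/eqP; rewrite -subr_eq0; apply/eqP.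
apply: (quad0 (A := energy psi - lam * ip psi psi)) => t.
(* This is energy minus [lam] times the squared norm of t psi + phi k, expanded with ||phi k|| =
   1. *)
pose F k := t ^+ 2 * (energy psi - lam * ip psi psi) +
  2 * t * (ip (dx (phi k)) (dx psi) + ip (dy (phi k)) (dy psi) - lam * ip (phi k) psi) +
  (energy (phi k) - lam).
have F0 k : 0 <= F k.
  have := ground_energy_le oO bO tphi0 phi0_gt0 (test_lin t tp (tphi k)).
  rewrite (energy_lin oO bO _ tp (tphi k)) (ip_sqr_lin mO _ (L2t tp) (L2t (tphi k))) phi1.
  rewrite /F /energy2 [ip (dx psi) _]ipC [ip (dy psi) _]ipC [ip psi (phi k)]ipC.
  move: (energy psi) (energy (phi k)) (ip psi psi) (ip (phi k) psi) (ip (dx (phi k)) _)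
    (ip (dy (phi k)) _) lam => a b c d e f g; lra.
have cF : F @ \oo --> t ^+ 2 * (energy psi - lam * ip psi psi) +
   2 * t * (ip g1 (dx psi) + ip g2 (dy psi) - lam * ip u psi) + (lam - lam).
  apply: cvgD; last by apply: cvgB => //; exact: cvg_cst.
  apply: cvgD; first exact: cvg_cst.
  apply: cvgMr; apply: cvgB.
    by apply: cvgD; [exact: (limit_ip_dx lim (L2x tp))|exact: (limit_ip_dy lim (L2y tp))].
  by apply: cvgMr; exact: (limit_ip lim (L2t tp)).
have := cvgr_to_ge cF (nearW _ F0); rewrite subrr addr0; exact.
Qed.

(** The Euler-Lagrange equation extends to H^1_0 by density. The limit is nonzero because strong L^2
    convergence keeps the norm equal to 1. *)
Lemma ground_energy_eigenvalue : dirichlet_eigenvalue Omega lam.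
Proof.
have [phi [u [g1 [g2 [lim phi1 ephi]]]]] := ground_state.
have [tphi [Lu Lg1 Lg2] cu _ _] := lim.
exists u; split; first exact: limit_H0space lim.
  have : norm2 u = 1.
    have c1 : (fun k => norm2 (phi k)) @ \oo --> (1 : R).
      rewrite (_ : (fun k => norm2 (phi k)) = cst 1); first exact: cvg_cst.
      by apply/funext => k; rewrite /Defs.norm2 phi1 sqrtr1.
    exact: (cvg_unique _ (norm2_cvg mO (fun k => L2t (tphi k)) Lu cu) c1).
  by move=> ->.
move=> w Hw; have [psi [tpsi Hpsi]] := H0_approx Hw.
have [L00 c00] := Hpsi 0%N 0%N isT.
have [L10 c10] := Hpsi 1%N 0%N isT; have [L01 c01] := Hpsi 0%N 1%N isT.
have [LW1 W1] := limit_wD10 lim; have [LW2 W2] := limit_wD01 lim.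
have Lw : L2 w by case: Hw => -[].
apply: etrans (congr2 +%R (ip_sub0 mO LW1 Lg1 L10 W1) (ip_sub0 mO LW2 Lg2 L01 W2)) _.
have Ew : ip u w = ip u (wD 0 0 w).
  exact: etrans (ipC _ _ _) (etrans (ip_sub0 mO Lw L00 Lu (wD00 Hw)) (ipC _ _ _)).
apply: etrans _ (congr1 ( *%R lam) (esym Ew)).
have c1 : (fun k => ip g1 (dx (psi k))) @ \oo --> ip g1 (wD 1 0 w).
  exact: (ip_cvg mO (fun=> Lg1) (fun k => L2x (tpsi k)) Lg1 L10 (L2_cvg_cst g1) c10).
have c2 : (fun k => ip g2 (dy (psi k))) @ \oo --> ip g2 (wD 0 1 w).
  exact: (ip_cvg mO (fun=> Lg2) (fun k => L2y (tpsi k)) Lg2 L01 (L2_cvg_cst g2) c01).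
have c0 : (fun k => lam * ip u (psi k)) @ \oo --> lam * ip u (wD 0 0 w).
  apply: cvgMr.
  exact: (ip_cvg mO (fun=> Lu) (fun k => L2t (tpsi k)) Lu L00 (L2_cvg_cst u) c00).
have c3 : (fun k => lam * ip u (psi k)) @ \oo -->
    ip g1 (wD 1 0 w) + ip g2 (wD 0 1 w).
  rewrite (_ : (fun k => _) = (fun k => ip g1 (dx (psi k)) + ip g2 (dy (psi k)))).
    exact: cvgD c1 c2.
  by apply/funext => k; rewrite (euler_lagrange lim phi1 ephi (tpsi k)).
exact: (cvg_unique _ c3 c0).
Qed.

End GroundState.

(** * The Poincare inequality on H^2_0 *)

Section PoincareH2.
Context {R : realType}.
Variable Omega : set (R * R).
Hypotheses (oO : open Omega) (bO : bounded_set Omega).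
Variable lambda1 : R.
Hypothesis hlam : min_dirichlet_eigenvalue Omega lambda1.
Hypothesis lam0 : 0 <= lambda1.
Local Notation ip := (ip Omega).
Local Notation norm2 := (norm2 Omega).
Local Notation L2 := (L2 Omega).
Local Notation test := (test_function Omega).
Local Notation energy := (dirichlet_energy Omega).
Local Notation wD := (wD Omega).
Implicit Types (phi psi u v w : R * R -> R).

Let mO : measurable (Omega : set (plane R)) := open_plane_measurable oO.

Lemma poincare_test phi : test phi -> lambda1 * ip phi phi <= energy phi.
Proof.
move=> tp; have := ip_ge0 Omega phi; rewrite le_eqVlt => /orP[/eqP <-|p0].
  by rewrite mulr0 energy_ge0.
(* Here [phi] itself serves as the nonzero test function that makes the infimum meaningful; an
   eigenvalue there is at least [lambda1] by minimality. *)
apply: le_trans (ground_energy_le oO bO tp p0 tp).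
apply: ler_wpM2r; first exact: ltW.
by apply: (hlam.2); exact: (ground_energy_eigenvalue oO bO tp p0).
Qed.

Definition laplacian phi : R * R -> R := fun z => pderiv 2 0 phi z + pderiv 0 2 phi z.

Lemma laplacian_L2 phi : test phi -> L2 (laplacian phi).
Proof. by move=> tp; apply: L2D => //; exact: test_L2. Qed.

Lemma energy_laplacian phi : test phi -> energy phi = - ip (laplacian phi) phi.
Proof.
move=> tp; have Lp := test_L2 oO bO 0 0 tp.
have Lxx := test_L2 oO bO 2 0 tp; have Lyy := test_L2 oO bO 0 2 tp.
have ex : ip (pderiv 2 0 phi) phi = - ip (dx phi) (dx phi).
  apply: (ibp_x tp) => z _; first exact: (test_diff 1 0 z tp).
  exact: (@test_continuous _ _ _ 2 0 tp).
have ey : ip (pderiv 0 2 phi) phi = - ip (dy phi) (dy phi).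
  apply: (ibp_y tp) => z _; first exact: (test_diff 0 1 z tp).
  exact: (@test_continuous _ _ _ 0 2 tp).
have -> : ip (laplacian phi) phi = - ip (dx phi) (dx phi) + - ip (dy phi) (dy phi).
  exact: etrans (ipDl mO Lxx Lyy Lp) (congr2 +%R ex ey).
by rewrite -opprD opprK.
Qed.

(** The energy is -(Delta phi, phi), so Cauchy-Schwarz and [poincare_test] bound lambda1 times its
    square by ||Delta phi||^2 times itself; one factor is cancelled. *)
Lemma energy_le_laplacian phi : test phi ->
  lambda1 * energy phi <= ip (laplacian phi) (laplacian phi).
Proof.
move=> tp; have Lp := test_L2 oO bO 0 0 tp.
have := energy_ge0 Omega phi; rewrite le_eqVlt => /orP[/eqP <-|e0].
  by rewrite mulr0 ip_ge0.
have CS := ip_CS mO (laplacian_L2 tp) Lp; have P := poincare_test tp.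
rewrite -(ler_pM2r e0); have := energy_laplacian tp.
set b := ip (laplacian phi) phi in CS *; set a := ip (laplacian phi) _ in CS *.
have a0 : 0 <= a by exact: ip_ge0.
set c := ip phi phi in CS P *; set d := energy phi in P e0 * => db.
apply: (@le_trans _ _ (lambda1 * (a * c))).
  rewrite -mulrA ler_wpM2l// (le_trans _ CS)// db -expr2 sqrrN; exact: lexx.
by rewrite mulrCA ler_wpM2l.
Qed.

Lemma wlap_L2 v : H0space Omega 2 v -> L2 (wlap Omega v).
Proof.
move=> /H0_approx[psi [_ H]].
by apply: L2D => //; [case: (H 2%N 0%N isT)|case: (H 0%N 2%N isT)].
Qed.

Lemma poincare_H2 v : H0space Omega 2 v ->
  lambda1 * (ip (wD 1 0 v) (wD 1 0 v) + ip (wD 0 1 v) (wD 0 1 v)) <=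
  norm2 (wlap Omega v) ^+ 2.
Proof.
move=> Hv; have LD := wlap_L2 Hv; move: (Hv) => /H0_approx[psi [tpsi H]].
have [L10 c10] := H 1%N 0%N isT; have [L01 c01] := H 0%N 1%N isT.
have [L20 c20] := H 2%N 0%N isT; have [L02 c02] := H 0%N 2%N isT.
have P a b k := test_L2 oO bO a b (tpsi k).
have cE : (fun k => lambda1 * energy (psi k)) @ \oo -->
   lambda1 * (ip (wD 1 0 v) (wD 1 0 v) + ip (wD 0 1 v) (wD 0 1 v)).
  apply: cvgMr; apply: cvgD.
    exact: (ip_cvg mO (P 1%N 0%N) (P 1%N 0%N) L10 L10 c10 c10).
  exact: (ip_cvg mO (P 0%N 1%N) (P 0%N 1%N) L01 L01 c01 c01).
have cL : (fun k => norm2 (fun z => laplacian (psi k) z - wlap Omega v z)) @ \oo --> (0 : R).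
  have cs : (fun k => norm2 (fun z => pderiv 2 0 (psi k) z - wD 2 0 v z) +
      norm2 (fun z => pderiv 0 2 (psi k) z - wD 0 2 v z)) @ \oo --> (0 : R).
    by rewrite -[X in _ --> X]addr0; exact: cvgD c20 c02.
  apply: (squeeze_cvgr _ (cvg_cst 0) cs); apply: nearW => k; rewrite norm2_ge0 /=.
  apply: le_trans (norm2D mO (L2B mO (P 2%N 0%N k) L20) (L2B mO (P 0%N 2%N k) L02)).
  rewrite le_eqVlt; apply/orP; left; apply/eqP; apply: eq_norm2 => z _.
  by rewrite /laplacian /wlap; move: (pderiv 2 0 _ z) (pderiv 0 2 _ z) (wD 2 0 v z)
    (wD 0 2 v z) => a b c d; ring.
have LL k := laplacian_L2 (tpsi k).
have cI := ip_cvg mO LL LL LD LD cL cL.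
rewrite norm2_sq; apply: (ler_cvg_to cE cI).
by apply: nearW => k; exact: energy_le_laplacian.
Qed.

(** The scheme is written with classical gradients and [poincare_H2] with [wD]; their norms agree by
    the comparison of derivatives. *)
Lemma poincare_C1 v : is_C1 Omega v -> H0space Omega 2 v ->
  [/\ L2 (dx v), L2 (dy v) &
    lambda1 * (ip (dx v) (dx v) + ip (dy v) (dy v)) <= norm2 (wlap Omega v) ^+ 2].
Proof.
move=> C1 Hv; have [[Lv Hs] _] := Hv.
have [Lx ex] := C1_weak_dx oO bO C1 (Hs 1%N 0%N isT).
have [Ly ey] := C1_weak_dy oO bO C1 (Hs 0%N 1%N isT).
have [LX _] := wDP (Hs 1%N 0%N isT); have [LY _] := wDP (Hs 0%N 1%N isT).
have sq f g : norm2 f = norm2 g -> ip f f = ip g g.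
  by move=> fg; rewrite -!norm2_sq fg.
split; [exact: Lx|exact: Ly|].
apply: le_trans (poincare_H2 Hv); rewrite le_eqVlt; apply/orP; left; apply/eqP.
congr (_ * (_ + _)); apply: sq; [exact: norm2_sub0 ex|exact: norm2_sub0 ey].
Qed.

End PoincareH2.

(** * Decay of the energy *)

Section DualNorm.
Context {R : realType}.
Variable Omega : set (R * R).
Variable F : (R * R -> R) -> R.
Hypothesis hF : Hm2 Omega F.
Local Notation norm2 := (norm2 Omega).
Local Notation lap v := (wlap Omega v).

Let S : set R := [set `|F v| / norm2 (lap v) |
  v in [set v | H0space Omega 2 v /\ 0 < norm2 (lap v)]].

Let S_ub : has_ubound S.
Proof.
have [_ [C HC]] := hF; exists C => _ [v [Hv v0] <-].
by rewrite ler_pdivrMr//; exact: HC.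
Qed.

Lemma dual_norm_le v : H0space Omega 2 v -> F v <= Hm2_norm Omega F * norm2 (lap v).
Proof.
move=> Hv; apply: le_trans (ler_norm _) _.
have := norm2_ge0 Omega (lap v); rewrite le_eqVlt => /orP[/eqP v0|v0].
  (* Functions with [norm2 (lap v) = 0] are left out of the supremum; boundedness makes [F] vanish
     on them. *)
  by have [_ [C HC]] := hF; have := HC v Hv; rewrite -v0 !mulr0.
rewrite -ler_pdivrMr//; apply: ub_le_sup => //.
by exists v.
Qed.

Lemma dual_norm_gt0 : (exists v, H0space Omega 2 v /\ F v <> 0) -> 0 < Hm2_norm Omega F.
Proof.
move=> [v [Hv Fv]]; have Fv0 : 0 < `|F v| by rewrite normr_gt0; exact/eqP.
have v0 : 0 < norm2 (lap v).
  rewrite lt_neqAle norm2_ge0 andbT; apply/eqP => v0.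
  have [_ [C HC]] := hF; have := HC v Hv; rewrite -v0 mulr0 => h.
  by have := lt_le_trans Fv0 h; rewrite ltxx.
apply: (@lt_le_trans _ _ (`|F v| / norm2 (lap v))); first exact: divr_gt0.
by apply: ub_le_sup => //; exists v.
Qed.

End DualNorm.

(** * The energy inequality of the scheme *)

Section Decay.
Context {R : realType}.
Variables (Omega : set (R * R)) (Sh : set (R * R -> R)).
Variables (F : (R * R -> R) -> R) (nu mu lambda1 : R).
Hypotheses (oO : open Omega) (bO : bounded_set Omega).
Hypotheses (hnu : 0 < nu) (lam0 : 0 < lambda1).
Hypothesis hlam : min_dirichlet_eigenvalue Omega lambda1.
Hypothesis C1 : forall v, Sh v -> is_C1 Omega v.
Hypothesis hSh0 : forall v, fe_space0 Omega Sh v -> H0space Omega 2 v.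
Hypothesis hF : Hm2 Omega F.
Local Notation V := (fe_space0 Omega Sh).
Local Notation ip := (ip Omega).
Local Notation L2 := (L2 Omega).
Local Notation norm2 := (norm2 Omega).
Local Notation lap v := (wlap Omega v).
Local Notation normF := (Hm2_norm Omega F).

Let mO : measurable (Omega : set (plane R)) := open_plane_measurable oO.

Let C1V v : V v -> is_C1 Omega v.
Proof. by move=> [Sv _ _]; exact: C1. Qed.

Let diffV v z : V v -> Omega z -> differentiable v z.
Proof. by move=> Vv Oz; have [] := C1V Vv Oz. Qed.

Lemma grad_normE v : grad_norm Omega v ^+ 2 = ip (dx v) (dx v) + ip (dy v) (dy v).
Proof. by rewrite sqr_sqrtr// addr_ge0// ip_ge0. Qed.

Lemma eq_grad_norm v w : (forall z, Omega z -> v z = w z) ->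
  grad_norm Omega v = grad_norm Omega w.
Proof.
move=> vw; have ex : ip (dx v) (dx v) = ip (dx w) (dx w).
  by apply: eq_ip => z; rewrite inE; exact: dx_eq_on.
have ey : ip (dy v) (dy v) = ip (dy w) (dy w).
  by apply: eq_ip => z; rewrite inE; exact: dy_eq_on.
exact: (congr1 Num.sqrt (congr2 +%R ex ey)).
Qed.

Let bilinear n (a b : 'I_n -> R) (f : 'I_n -> R * R -> R) : (forall i, L2 (f i)) ->
  ip (fun z => \sum_(i < n) a i * f i z) (fun z => \sum_(j < n) b j * f j z) =
  qform (fun i j => ip (f i) (f j)) a b.
Proof.
move=> Lf; apply: etrans (ip_suml oO _ a Lf (L2_sum oO _ b Lf)) _.
by apply: eq_bigr => i _; congr (_ * _); exact: (ip_sumr oO _ b Lf (Lf i)).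
Qed.

Let qformD n (G1 G2 : 'I_n -> 'I_n -> R) a b :
  qform G1 a b + qform G2 a b = qform (fun i j => G1 i j + G2 i j) a b.
Proof.
rewrite /qform -big_split /=; apply: eq_bigr => i _.
rewrite -mulrDr -big_split /=; congr (_ * _); apply: eq_bigr => j _.
by rewrite mulrDr.
Qed.

(** The expansion is known for nonnegative times only, and a positive [t] has a neighbourhood of
    such times. *)
Let derive1_span n (c : 'I_n -> R -> R) (k : 'I_n -> R) (f : R -> R) t : 0 < t ->
  (forall i, derivable (c i) t 1) ->
  (forall s, 0 <= s -> f s = \sum_(i < n) c i s * k i) ->
  derive1 f t = \sum_(i < n) derive1 (c i) t * k i.
Proof.
move=> t0 dc fE; have Dc i : is_derive (t : R) (1 : R) (c i) (derive1 (c i) t).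
  by rewrite derive1E; exact/derivableP.
have H := is_derive_sum (fun i => is_deriveZ (k i) (Dc i)).
have E : \sum_(i < n) (k i \*: c i) = (fun s => \sum_(i < n) c i s * k i).
  by apply/funext => s; rewrite fct_sumE; apply: eq_bigr => i _; rewrite mulrC.
rewrite E in H; rewrite derive1E (@near_eq_derive _ _ _ f (fun s => \sum_(i < n) c i s * k i)).
  case: H => _ ->; apply: eq_bigr => i _; by rewrite /GRing.scale /= mulrC.
by near=> s; apply: fE; apply: ltW; near: s; exact: lt_nbhsr.
Unshelve. all: by end_near. Qed.

(** The witness for [y] is the Gram quadratic form of the coordinates, defined for all real times
    and equal to the energy from time 0 on. *)
Lemma energy_identity psi0 psi : semidiscrete_solution Omega nu mu Sh F psi0 psi ->
  exists2 y : R -> R, {within `[0, +oo[, continuous y} /\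
    (forall t, 0 <= t -> y t = grad_norm Omega (psi t) ^+ 2) &
    exists2 y' : R -> R, (forall t, 0 < t -> is_derive (t : R) (1 : R) y (y' t)) &
      forall t, 0 < t -> 2^-1 * y' t + nu * norm2 (lap (psi t)) ^+ 2 = mu * F (psi t).
Proof.
move=> [_ Vpsi [n [e [c [Ve cc dc psiE]]]] eqn].
have PL i := poincare_C1 oO bO hlam (ltW lam0) (C1V (Ve i)) (hSh0 (Ve i)).
have Lx i : L2 (dx (e i)) by case: (PL i).
have Ly i : L2 (dy (e i)) by case: (PL i).
have de i z : Omega z -> differentiable (e i) z by exact: diffV.
have xE t z : 0 <= t -> Omega z -> dx (psi t) z = \sum_(i < n) c i t * dx (e i) z.
  by move=> t0 Oz; exact: (dx_span oO (fun z => psiE t z t0) de Oz).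
have yE t z : 0 <= t -> Omega z -> dy (psi t) z = \sum_(i < n) c i t * dy (e i) z.
  by move=> t0 Oz; exact: (dy_span oO (fun z => psiE t z t0) de Oz).
pose Gx i j := ip (dx (e i)) (dx (e j)); pose Gy i j := ip (dy (e i)) (dy (e j)).
pose G i j := Gx i j + Gy i j.
have Gsym i j : G i j = G j i.
  exact: (congr2 +%R (ipC Omega (dx (e i)) (dx (e j))) (ipC Omega (dy (e i)) (dy (e j)))).
exists (fun t => qform G (c ^~ t) (c ^~ t)).
  split; first exact: continuous_qform.
  move=> t t0; apply: esym; apply: etrans (grad_normE _) _.
  apply: etrans (congr2 +%R _ _) (qformD Gx Gy _ _).
    apply: etrans _ (bilinear _ _ Lx).
    by apply: eq_ip => z; rewrite inE; exact: xE.
  apply: etrans _ (bilinear _ _ Ly).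
  by apply: eq_ip => z; rewrite inE; exact: yE.
exists (fun t => 2 * qform G (fun i => derive1 (c i) t) (c ^~ t)).
  by move=> t t0; apply: is_derive_qform => // i; exact: dc.
move=> t t0; have t0' := ltW t0; apply: etrans (eqn t (psi t) t0 (Vpsi t t0')).
(* The second factor of the integrand is 0 at every point when both arguments coincide. *)
have fb : form_b Omega (psi t) (psi t) (psi t) = 0.
  apply: etrans (ipC _ _ _) _; apply: etrans _ (ip0l Omega (lap (psi t))).
  by apply: eq_ip => z _ //=; rewrite mulrC subrr.
have fb0 : form_b0 Omega (psi t) (psi t) = 0.
  rewrite /form_b0 (ipC Omega (psi t) (dx (psi t))) subrr mulr0 oppr0//.
rewrite fb fb0 mulr0 !addr0 mulrA mulVf// mul1r /form_a norm2_sq; congr (_ + _).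
apply: etrans (esym (qformD Gx Gy _ _)) _; congr (_ + _).
  apply: etrans (esym (bilinear _ _ Lx)) _; apply: eq_ip => z; rewrite inE => Oz.
    by rewrite (derive1_span t0 (fun i => dc i t t0) (fun s s0 => xE s z s0 Oz)).
  by rewrite xE.
apply: etrans (esym (bilinear _ _ Ly)) _; apply: eq_ip => z; rewrite inE => Oz.
  by rewrite (derive1_span t0 (fun i => dc i t t0) (fun s s0 => yE s z s0 Oz)).
by rewrite yE.
Qed.

Lemma energy_decay psi0 psi : semidiscrete_solution Omega nu mu Sh F psi0 psi ->
  0 < mu ->
  forall t (K := mu ^+ 2 / (nu ^+ 2 * lambda1) * normF ^+ 2), 0 <= t ->
  grad_norm Omega (psi t) ^+ 2 <=
  K + expR (- (nu * lambda1 * t)) * (grad_norm Omega psi0 ^+ 2 - K).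
Proof.
move=> sol mu0 t K t0; have [init Vpsi _ _] := sol.
have [y [cy yE] [y' dy' yy']] := energy_identity sol.
have y0 : y 0 = grad_norm Omega psi0 ^+ 2.
  have e0 := eq_grad_norm (v := psi 0) (w := psi0) init.
  have e1 := yE 0 (lexx 0).
  apply: etrans e1 _.
  by rewrite e0.
suff decay s : 0 < s -> y' s <= nu * lambda1 * (K - y s).
  by have := gronwall dy' decay cy t0; rewrite y0 yE.
move=> s0.
have Vs := Vpsi s (ltW s0).
have [_ _] := poincare_C1 oO bO hlam (ltW lam0) (C1V Vs) (hSh0 Vs).
move=> P0; have {P0} : lambda1 * y s <= norm2 (lap (psi s)) ^+ 2.
  by apply: le_trans P0; rewrite yE ?(ltW s0)// grad_normE.
have := dual_norm_le hF (hSh0 Vs); have := yy' s s0.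
rewrite /K; move: (norm2 _) normF (F (psi s)) (y s) (y' s) => D f Fs ys y's E1 E2 P.
(* [K] is the equilibrium of the comparison equation: decay at rate nu lambda1 balances the forcing
   mu^2 f^2 / nu. *)
have KE : nu * lambda1 * (mu ^+ 2 / (nu ^+ 2 * lambda1) * f ^+ 2) = mu ^+ 2 * f ^+ 2 / nu.
  by field; rewrite !gt_eqF.
rewrite mulrBr KE.
have E3 : mu * Fs <= mu * (f * D) by rewrite ler_wpM2l// ltW.
have E4 : 2 * (mu * (f * D)) <= mu ^+ 2 * f ^+ 2 / nu + nu * D ^+ 2.
  (* Young's inequality as a square: the difference of the two sides is (mu f - nu D)^2 / nu. *)
  rewrite -subr_ge0 (_ : _ - _ = (mu * f - nu * D) ^+ 2 / nu).
    by rewrite divr_ge0 ?sqr_ge0// ltW.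
  by field; rewrite gt_eqF.
have E5 : nu * lambda1 * ys <= nu * D ^+ 2 by rewrite -mulrA ler_wpM2l// ltW.
lra.
Qed.

End Decay.

(** * Radius and entry time of the absorbing ball *)

Unset Implicit Arguments.

Theorem corollary3p3 (R : realType) (Omega : set (R * R)) (nu mu lambda1 : R)
    (N : nat) (T : 'I_N -> set (R * R)) (h sigma : R) (k : nat)
    (Sh : set (R * R -> R)) (F : (R * R -> R) -> R) (alpha : R)
    (hOmega : bounded_domain Omega) (hnu : 0 < nu) (hmu : 0 < mu)
    (hlambda1 : min_dirichlet_eigenvalue Omega lambda1)
    (hT : mesh_partition Omega T) (hh : mesh_size T = h)
    (hsigma : shape_regular T sigma)
    (hk : (3 <= k)%N) (hSh : C1_fe_space Omega T k Sh)
    (hSh0 : forall v, fe_space0 Omega Sh v -> H0space Omega 2 v)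
    (hF : Hm2 Omega F) (hF0 : exists v, H0space Omega 2 v /\ F v <> 0)
    (halpha0 : 0 < alpha) (halpha : alpha < nu * lambda1 / 2) :
  exists rho : R,
    [/\ 0 < rho,
        rho ^+ 2 = mu ^+ 2 / (alpha * nu) * Hm2_norm Omega F ^+ 2 &
        absorbing Omega nu mu Sh F (fe_ball Omega Sh rho)].
Proof.
have [oO _ _ bO] := hOmega.
have C1 v : Sh v -> is_C1 Omega v by case: hSh => _ _ H /H[].
(* Positivity of [lambda1] is read off from 0 < alpha < nu lambda1 / 2. *)
have lam0 : 0 < lambda1 by rewrite -(pmulr_rgt0 _ hnu); lra.
have f0 := dual_norm_gt0 hF hF0; set f := Hm2_norm Omega F in f0 *.
pose rho2 := mu ^+ 2 / (alpha * nu) * f ^+ 2.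
have mf : 0 < mu ^+ 2 * f ^+ 2 by rewrite mulr_gt0// exprn_gt0.
have rho20 : 0 < rho2 by rewrite !mulr_gt0 ?invr_gt0 ?exprn_gt0 ?mulr_gt0.
pose K := mu ^+ 2 / (nu ^+ 2 * lambda1) * f ^+ 2.
pose kappa := nu * lambda1; have kappa0 : 0 < kappa by rewrite mulr_gt0.
have K0 : 0 <= K by rewrite !mulr_ge0 ?invr_ge0 ?exprn_ge0 ?mulr_ge0 ?exprn_ge0 ?ltW.
(* Both sides share mu^2 f^2, so this compares [alpha * nu] with nu^2 lambda1; the factor 1/2 in the
   bound on [alpha] leaves extra room. *)
have Krho : K < rho2.
  rewrite /K /rho2 ltr_pM2r ?exprn_gt0// ltr_pM2l ?exprn_gt0//.
  rewrite ltf_pV2 ?posrE ?mulr_gt0 ?exprn_gt0//.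
  by rewrite expr2 -mulrA mulrC ltr_pM2l//; rewrite -/kappa; rewrite -/kappa in halpha; lra.
exists (Num.sqrt rho2); split; [by rewrite sqrtr_gt0|by rewrite sqr_sqrtr// ltW|].
(* The requirement is exp(- kappa t) r^2 <= rho2 - K. Replacing exp(x) by its lower bound x gives a
   time without a logarithm. *)
move=> r r0; exists (r ^+ 2 / (kappa * (rho2 - K))).
  by rewrite divr_gt0 ?exprn_gt0// mulr_gt0// subr_gt0.
move=> psi0 psi Vpsi0 psi0r sol t tt.
have t0 : 0 <= t.
  by apply: le_trans tt; rewrite divr_ge0 ?sqr_ge0// mulr_ge0 ?subr_ge0 ?ltW.
split; first by case: sol => _ Vpsi _ _; exact: Vpsi.
have := energy_decay oO bO hnu lam0 hlambda1 C1 hSh0 hF sol hmu t0.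
rewrite -/f -/K -/kappa => decay.
have g0 : 0 <= grad_norm Omega (psi t) by exact: sqrtr_ge0.
suff bound : grad_norm Omega (psi t) ^+ 2 <= rho2.
  by rewrite -[leLHS](ger0_norm g0) -sqrtr_sqr ler_sqrt ?(ltW rho20).
apply: (le_trans decay); rewrite -lerBrDl.
have p0 : grad_norm Omega psi0 ^+ 2 <= r ^+ 2.
  by rewrite ler_pXn2r ?nnegrE ?sqrtr_ge0// ltW.
(* [K] is nonnegative, so the bracket multiplying the exponential is at most [r ^+ 2]. *)
apply: (@le_trans _ _ (expR (- (kappa * t)) * r ^+ 2)).
  apply: ler_wpM2l; first exact: expR_ge0.
  by rewrite lerBlDr; apply: (le_trans p0); rewrite lerDl.
rewrite expRN mulrC ler_pdivrMr ?expR_gt0//.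
move: tt; rewrite ler_pdivrMr ?mulr_gt0 ?subr_gt0// => tt.
apply: (le_trans tt); rewrite mulrCA mulrA [leRHS]mulrC.
apply: ler_wpM2r; first by rewrite subr_ge0 ltW.
apply: le_trans (expR_ge1Dx _); rewrite lerDr; exact: ler01.
Qed.
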